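(* Let $r>1$ and let $\mathcal{E}_r=\{x+iy\in\mathbb{C}:\frac{x^2}{r^2}+y^2=1\}$. The $L^2$-norm of the Cauchy transform on $\mathcal{E}_r$ satisfies $$\|\boldsymbol{C}\|_{L^2(\mathcal{E}_r)}\ \ge\ \sqrt{\frac{2}{\pi}\sqrt{1-\tfrac1{r^2}}\cdot\frac{(r^2+1)\cdot\Pi\Big(1-r^2,\sqrt{1-\tfrac1{r^2}}\Big)-K\Big(\sqrt{1-\tfrac1{r^2}}\Big)}{\vartheta_2\Big(0,\big(\tfrac{r-1}{r+1}\big)^2\Big)\,\vartheta_3\Big(0,\big(\tfrac{r-1}{r+1}\big)^2\Big)}}.$$
   Context: For the counterclockwise oriented curve $\gamma=\mathcal{E}_r$ with arc length measure $\sigma$, the Cauchy transform of $h\in L^2(\gamma)=L^2(\gamma,\sigma)$ is $\boldsymbol{C}_\pm h(z)=\pm\frac1{2\pi i}\oint_\gamma\frac{h(\zeta)}{\zeta-z}\,d\zeta$ for $z$ in the interior ($+$) or exterior ($-$) of $\gamma$. Taking nontangential boundary values makes $\boldsymbol{C}_\pm$ a bounded operator on $L^2(\gamma)$; $\|\boldsymbol{C}_+\|=\|\boldsymbol{C}_-\|$, and this common operator norm is denoted $\|\boldsymbol{C}\|_{L^2(\mathcal{E}_r)}$. Elliptic integrals (with modulus $k\in(0,1)$ and characteristic $n$): $K(k)=\int_0^1\frac{dt}{\sqrt{(1-t^2)(1-k^2t^2)}}$ and $\Pi(n,k)=\int_0^1\frac{dt}{(1-nt^2)\sqrt{(1-t^2)(1-k^2t^2)}}$.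 Theta functions (nome $q$, $|q|<1$): $\vartheta_2(z,q)=2q^{1/4}\sum_{j=0}^\infty q^{j(j+1)}\cos[(2j+1)z]$ and $\vartheta_3(z,q)=1+2\sum_{j=1}^\infty q^{j^2}\cos(2jz)$. *)

(* Defs.v *)
From HB Require Import structures.
From mathcomp Require Import all_boot all_order all_algebra.
From mathcomp Require Import all_classical all_reals all_analysis.
From mathcomp Require Import complex.
From mathcomp Require Import lra.

Set Implicit Arguments.
Unset Strict Implicit.
Unset Printing Implicit Defensive.

Import Order.TTheory GRing.Theory Num.Theory.
Import numFieldNormedType.Exports.
Import Normc.

Local Open Scope classical_set_scope.
Local Open Scope ring_scope.
Local Open Scope complex_scope.

(* The topology of the modulus on the complex numbers. *)
HB.instance Definition _ (R : rcfType) := NormedModule.copy R[i] R[i]^o.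

Section EllipticAndTheta.
Variable R : realType.
Implicit Types (n k q z : R).

Definition ellipticK k : R :=
  \int[lebesgue_measure]_(t in `[0, 1])
    (Num.sqrt ((1 - t ^+ 2) * (1 - k ^+ 2 * t ^+ 2)))^-1.

Definition ellipticPi n k : R :=
  \int[lebesgue_measure]_(t in `[0, 1])
    ((1 - n * t ^+ 2) * Num.sqrt ((1 - t ^+ 2) * (1 - k ^+ 2 * t ^+ 2)))^-1.

(* Real argument and real nome 0 <= q < 1, where [powR] is the principal
   fourth root. *)
Definition theta2 z q : R :=
  2 * (q `^ 4^-1)
    * limn (series (fun j : nat => q ^+ (j * j.+1) * cos ((2 * j + 1)%:R * z))).

(* The sum starts at j = 1, hence the shift of the index. *)
Definition theta3 z q : R :=
  1 + 2 * limn (series (fun j : nat =>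
                          q ^+ (j.+1 ^ 2) * cos ((2 * j.+1)%:R * z))).

End EllipticAndTheta.

Section CauchyTransform.
Variables (R : realType) (r : R).
Local Notation mu := (@lebesgue_measure R).
Local Notation Re := (@complex.Re R).
Local Notation Im := (@complex.Im R).
Implicit Types (h g : R[i] -> R[i]) (z w : R[i]) (t : R).

(* x^2/r^2 + y^2: the ellipse, its interior and its exterior are the sets where
   this is = 1, < 1 and > 1. *)
Definition ellipse_eqn z : R := Re z ^+ 2 / r ^+ 2 + Im z ^+ 2.

Definition ellipse : set R[i] := [set z | ellipse_eqn z = 1].

Definition ellipse_side (exterior : bool) : set R[i] :=
  if exterior then [set z | 1 < ellipse_eqn z] else [set z | ellipse_eqn z < 1].

(* Counterclockwise parametrization over [0, 2 pi], with its derivative. *)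
Definition param t : R[i] := (r * cos t) +i* sin t.
Definition dparam t : R[i] := (- (r * sin t)) +i* cos t.

Lemma is_derive_param t :
  is_derive t 1 (fun u => Re (param u)) (Re (dparam t)) /\
  is_derive t 1 (fun u => Im (param u)) (Im (dparam t)).
Proof.
split; rewrite /=; last exact: is_derive_sin.
by rewrite -mulrN; apply: is_deriveZ.
Qed.

Lemma param_ellipse : 1 < r -> param @` `[0, 2 * pi] = ellipse.
Proof.
move=> r1; have r0 : r != 0 by rewrite gt_eqF// (lt_trans _ r1).
apply/seteqP; split => [z [t _ <-]|[x y]]; rewrite /ellipse /ellipse_eqn /=.
  by rewrite exprMn mulrAC divff ?mul1r ?cos2Dsin2// expf_neq0.
rewrite -expr_div_n => xy.
have x2 : (x / r) ^+ 2 <= 1 by rewrite -xy lerDl sqr_ge0.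
have xr : -1 <= x / r <= 1.
  by rewrite -ler_norml -(@expr_le1 _ 2)// -normrX ger0_norm// sqr_ge0.
have yE : y ^+ 2 = 1 - (x / r) ^+ 2 by lra.
have rx : r * (x / r) = x by rewrite mulrC divfK.
have := acos_ge0 xr; have := acos_lepi xr => ale a0.
have [y0|y0] := leP 0 y.
  exists (acos (x / r)); first by rewrite /= in_itv /= a0 /=; lra.
  by rewrite /param acosK// sin_acos// rx -yE sqrtr_sqr ger0_norm.
exists (2 * pi - acos (x / r)).
  by rewrite /= in_itv /=; apply/andP; split; lra.
rewrite /param mulr_natl [_ - _]addrC cosD2pi sinD2pi.
by rewrite cosN sinN acosK// sin_acos// rx -yE sqrtr_sqr ltr0_norm// opprK.
Qed.

(* \int_a^b f of a complex-valued f, componentwise. *)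
Definition cintegral (a b : R) (f : R -> R[i]) : R[i] :=
  (\int[mu]_(t in `[a, b]) Re (f t)) +i*
  (\int[mu]_(t in `[a, b]) Im (f t)).

Definition contour_integral (f : R[i] -> R[i]) : R[i] :=
  cintegral 0 (2 * pi) (fun t => f (param t) * dparam t).

(* The arc length measure on the ellipse is |dparam t| dt. *)
Definition L2norm h : \bar R :=
  sqrte (\int[mu]_(t in `[0%R, (2 * pi)%R])
           (normc (h (param t)) ^+ 2 * normc (dparam t))%:E)%E.

Definition inL2 h : Prop :=
  [/\ measurable_fun `[0, 2 * pi] (fun t => Re (h (param t))),
      measurable_fun `[0, 2 * pi] (fun t => Im (h (param t))) &
      (L2norm h < +oo)%E].

Definition cauchy (exterior : bool) h z : R[i] :=
  (-1) ^+ exterior * (0 +i* (2 * pi))^-1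
    * contour_integral (fun w => h w / (w - z)).

(* {z : |z - w| <= (1 + a) dist(z, ellipse)}, on one side of the ellipse. *)
Definition approach_region (exterior : bool) (a : R) w : set R[i] :=
  [set z | ellipse_side exterior z /\
     forall v, ellipse v -> normc (z - w) <= (1 + a) * normc (z - v)].

Definition nontangential_limit (exterior : bool) (f : R[i] -> R[i])
    (w l : R[i]) : Prop :=
  forall a : R, 0 < a ->
    f z @[z --> within (approach_region exterior a w) (nbhs w)] --> l.

(* Graph of the operator C_+ (exterior = false) or C_- (exterior = true) on
   L^2; [g] is determined by [h] up to a null set. *)
Definition cauchy_boundary (exterior : bool) h g : Prop :=
  [/\ inL2 h, inL2 g &
      {ae mu, forall t, t \in `[0, 2 * pi] ->
         nontangential_limit exterior (cauchy exterior h)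
           (param t) (g (param t))}].

Definition cauchy_opnorm (exterior : bool) : \bar R :=
  ereal_sup [set L2norm g | g in
    [set g | exists2 h, cauchy_boundary exterior h g & (L2norm h <= 1)%E]].

End CauchyTransform.

(* Main.v *)
Require Import Defs.
From HB Require Import structures.
From mathcomp Require Import all_boot all_order all_algebra.
From mathcomp Require Import all_classical all_reals all_analysis.
From mathcomp Require Import measurable_realfun complex ring lra zify.

(** The bound comes from the duality between the Cauchy transform and point
evaluation at the centre of the ellipse.

For a polynomial P the function h(z) = P(z) / z splits on the ellipse as
P(0) / z + H(z) with H a polynomial.  Cauchy's formula (cint_winding,
cint_cauchy_poly) shows that the exterior transform of h is P(0) / z and that the
interior one is H, so the norm of the exterior transform is at least
|P(0)| |1/z| / |P/z|.  The same lower bound holds for the interior transform,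
since two complementary projections of a plane have the same norm
(opnorm_ge_ratio).  It remains to make the norm of P(z) / z small.

Among all functions 1/z + H the norm is minimized by a multiple of
sqrt (phi') / phi, with phi the conformal map of the interior onto the disc; this is
the Garabedian kernel at 0.  For an ellipse phi is given by sn, and the product
expansions of theta functions give the square of this function as a product of
rational factors in z^2 (extremal).  The factors in the numerator are
replaced by squares of polynomials that approximate their square roots, those in
the denominator by squares of approximate inverses; such polynomials exist
because each factor has positive real part on the ellipse (half_plane_disc).

On the ellipse z = a w + b / w with |w| = 1.  With y = w^2 and x = b / a, the
modulus of this product, weighted by |dz| / |z|^2, is a multiple of the theta
quotient prod |1 - x^(2m+1) y|^2 / |1 + x^(2m+1) y|^2
(normc_extremal).  This quotient changes sign under y |-> x^2 y, so the difference
of its means over |y| = 1 and |y| = x^2 is twice its mean, and by the residue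
theorem it is the residue at the only pole y = - x in between (theta_quot_mean).
The products that remain are compared with theta_2 and theta_3 through the finite
form of Jacobi's triple product (theta_product_le).  All of this is done with
truncated products, whose errors are controlled in extremal_norm_lim.

Finally the substitution t = sin u turns (r^2 + 1) Pi - K into a multiple of the
squared norm of 1/z (elliptic_combination_le). *)

Set Implicit Arguments.
Unset Strict Implicit.
Unset Printing Implicit Defensive.

Import Order.TTheory GRing.Theory Num.Theory.
Import numFieldNormedType.Exports.
Import Normc.

Local Open Scope classical_set_scope.
Local Open Scope ring_scope.
Local Open Scope complex_scope.

(** * Integrals of continuous real functions *)

Section RealIntegrals.
Variable R : realType.
Local Notation mu := (@lebesgue_measure R).
Implicit Types (a b c t : R) (f g F : R -> R).

Lemma integrable_continuous a b f : continuous f ->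
  mu.-integrable `[a, b] (EFin \o f).
Proof.
move=> cf; apply: continuous_compact_integrable; first exact: segment_compact.
exact: continuous_subspaceT.
Qed.

Lemma is_derive1_continuous f F :
  (forall t, is_derive t 1 F (f t)) -> continuous F.
Proof.
move=> dF t; apply/differentiable_continuous/derivable1_diffP.
by case: (dF t).
Qed.

Lemma is_derive1_LRcontinuous a b f F :
  (forall t, is_derive t 1 F (f t)) -> derivable_oo_LRcontinuous F a b.
Proof.
move=> dF; have cF := is_derive1_continuous dF; split.
- by move=> t _; case: (dF t).
- exact/cvg_at_right_filter/cF.
- exact/cvg_at_left_filter/cF.
Qed.

Lemma Rintegral_FTC a b f F : a < b -> continuous f ->
  (forall t, is_derive t 1 F (f t)) ->
  \int[mu]_(t in `[a, b]) f t = F b - F a.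
Proof.
move=> ab cf dF; rewrite /Rintegral (@continuous_FTC2 _ f F)//.
- exact: continuous_subspaceT.
- exact: is_derive1_LRcontinuous dF.
- by move=> t _; rewrite derive1E; case: (dF t).
Qed.

Lemma Rintegral_reflect a b c f : a <= b -> continuous f ->
  \int[mu]_(t in `[a, b]) f (c - t) = \int[mu]_(t in `[c - b, c - a]) f t.
Proof.
move=> ab cf.
have dF t : is_derive t 1 (fun u : R => c - u) (-1).
  by apply: is_derive_eq; rewrite add0r mul1r.
have dE : ((fun u : R => c - u)^`() = cst (-1))%classic.
  by apply/funext => t; rewrite derive1E; case: (dF t).
rewrite {2}/Rintegral (@integration_by_substitution_decreasing _ (fun u => c - u))//.
- congr fine; apply: eq_integral => t _ /=.
  by rewrite dE /= fctE opprK mulr1.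
- by move=> x y _ _ xy; rewrite ltrD2l ltrN2.
- by rewrite dE => t _; exact: cst_continuous.
- by rewrite dE; exact: is_cvg_cst.
- by rewrite dE; exact: is_cvg_cst.
- exact: is_derive1_LRcontinuous dF.
- exact: continuous_subspaceT.
Qed.

Lemma Rintegral_shift a b c f : a <= b -> continuous f ->
  \int[mu]_(t in `[a, b]) f (c + t) = \int[mu]_(t in `[c + a, c + b]) f t.
Proof.
move=> ab cf; have cfN : continuous (fun u => f (c - u)).
  move=> u; apply: continuous_comp; last exact: cf.
  by apply: continuousB; [exact: cst_continuous|exact: cvg_id].
have := @Rintegral_reflect a b 0 _ ab cfN; under eq_Rintegral do rewrite sub0r opprK.
move=> ->; rewrite Rintegral_reflect ?lerB//.
by rewrite !sub0r !opprK.
Qed.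

Lemma Rintegral_split a b c f : a <= c -> c <= b -> continuous f ->
  \int[mu]_(t in `[a, b]) f t =
  \int[mu]_(t in `[a, c]) f t + \int[mu]_(t in `[c, b]) f t.
Proof.
move=> ac cb cf.
have := @Rintegral_itvB _ f (BLeft a) (BRight b) c
  (integrable_continuous a b cf); rewrite !bnd_simp => /(_ ac cb) /eqP.
rewrite subr_eq addrC => /eqP ->; congr (_ + _).
rewrite Rintegral_itv_obnd_cbnd//.
apply: integrableS (integrable_continuous c b cf) => //.
exact: subset_itv_oc_cc.
Qed.

End RealIntegrals.

(** * Complex-valued integrals over the circle *)

Section ComplexIntegrals.
Variable R : realType.
Local Notation mu := (@lebesgue_measure R).
Local Notation Re := (@complex.Re R).
Local Notation Im := (@complex.Im R).
Implicit Types (t : R) (f g F : R -> R[i]) (z w : R[i]) (k : int).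

Lemma Re_mul z w : Re (z * w) = Re z * Re w - Im z * Im w.
Proof. by case: z w => [a b] []. Qed.

Lemma Im_mul z w : Im (z * w) = Re z * Im w + Im z * Re w.
Proof. by case: z w => [a b] []. Qed.

Lemma Re_add z w : Re (z + w) = Re z + Re w.
Proof. by case: z w => [a b] []. Qed.

Lemma Im_add z w : Im (z + w) = Im z + Im w.
Proof. by case: z w => [a b] []. Qed.

Lemma Re_opp z : Re (- z) = - Re z. Proof. by case: z. Qed.

Lemma Im_opp z : Im (- z) = - Im z. Proof. by case: z. Qed.

Lemma Re_inv z : Re z^-1 = Re z / (Re z ^+ 2 + Im z ^+ 2).
Proof. by case: z. Qed.

Lemma Im_inv z : Im z^-1 = - (Im z / (Re z ^+ 2 + Im z ^+ 2)).
Proof. by case: z. Qed.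

Lemma normcRe z : normc z = Num.sqrt (Re z ^+ 2 + Im z ^+ 2).
Proof. by case: z. Qed.

Lemma sqr_normcRe z : normc z ^+ 2 = Re z ^+ 2 + Im z ^+ 2.
Proof. by rewrite normcRe sqr_sqrtr// addr_ge0// sqr_ge0. Qed.

Lemma normc_ge0 z : 0 <= normc z.
Proof. by rewrite normcRe sqrtr_ge0. Qed.

Lemma normc_eq0 z : (normc z == 0) = (z == 0).
Proof. by apply/eqP/eqP => [/eq0_normc//|->]; rewrite normc0. Qed.

Lemma normc_gt0 z : (0 < normc z) = (z != 0).
Proof. by rewrite lt_def normc_ge0 andbT normc_eq0. Qed.

Lemma normcX z n : normc (z ^+ n) = normc z ^+ n.
Proof. by elim: n => [|n IH]; rewrite ?expr0 ?normc1// !exprS normcM IH. Qed.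

Lemma real_complex_eq0 t : (t%:C == 0 :> R[i]) = (t == 0).
Proof. by rewrite eq_complex /= eqxx andbT. Qed.

Lemma real_complexD (u v : R) : (u + v)%:C = u%:C + v%:C :> R[i].
Proof. by rewrite rmorphD. Qed.

Lemma real_complexN (u : R) : (- u)%:C = - u%:C :> R[i].
Proof. by rewrite rmorphN. Qed.

Lemma real_complexM (u v : R) : (u * v)%:C = u%:C * v%:C :> R[i].
Proof. by rewrite rmorphM. Qed.

Lemma real_complexV (u : R) : (u^-1)%:C = (u%:C)^-1 :> R[i].
Proof. by rewrite fmorphV. Qed.

Lemma normcR t : normc t%:C = `|t|.
Proof. by rewrite normcRe /= expr0n addr0 sqrtr_sqr. Qed.

Lemma normcB z w : normc (z - w) = normc (w - z).
Proof. by rewrite -normcN opprB. Qed.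

Lemma le_normc_sub z w : normc z - normc w <= normc (z - w).
Proof. by rewrite lerBlDr; apply: le_trans (le_normcD _ _); rewrite subrK. Qed.

Lemma Re_le_normc z : `|Re z| <= normc z.
Proof.
rewrite -(@ler_pXn2r _ 2)// ?nnegrE ?normc_ge0// sqr_normcRe.
by rewrite real_normK ?num_real// lerDl sqr_ge0.
Qed.

Lemma Im_le_normc z : `|Im z| <= normc z.
Proof.
rewrite -(@ler_pXn2r _ 2)// ?nnegrE ?normc_ge0// sqr_normcRe.
by rewrite real_normK ?num_real// lerDr sqr_ge0.
Qed.

Lemma sqr_normc_gt0 z : z != 0 -> 0 < Re z ^+ 2 + Im z ^+ 2.
Proof. by move=> z0; rewrite -sqr_normcRe exprn_gt0// normc_gt0. Qed.

Lemma normc_conj z : normc z^*%C = normc z.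
Proof. by rewrite !normcRe; case: z => a b /=; rewrite sqrrN. Qed.

(** Continuity is asked of the two components because integrals are defined
componentwise. *)
Definition ccontinuous f :=
  continuous (fun t => Re (f t)) /\ continuous (fun t => Im (f t)).

Lemma ccontinuous_cst z : ccontinuous (fun=> z).
Proof. by split; exact: cst_continuous. Qed.

Lemma ccontinuousD f g : ccontinuous f -> ccontinuous g ->
  ccontinuous (fun t => f t + g t).
Proof.
move=> [f1 f2] [g1 g2]; split => t.
  under eq_fun do rewrite Re_add.
  by apply: cvgD; [exact: f1|exact: g1].
under eq_fun do rewrite Im_add.
by apply: cvgD; [exact: f2|exact: g2].
Qed.

Lemma ccontinuousM f g : ccontinuous f -> ccontinuous g ->
  ccontinuous (fun t => f t * g t).
Proof.
move=> [f1 f2] [g1 g2]; split => t.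
  under eq_fun do rewrite Re_mul.
  by apply: cvgB; apply: cvgM;
    [exact: f1|exact: g1|exact: f2|exact: g2].
under eq_fun do rewrite Im_mul.
by apply: cvgD; apply: cvgM;
  [exact: f1|exact: g2|exact: f2|exact: g1].
Qed.

Lemma ccontinuousN f : ccontinuous f -> ccontinuous (fun t => - f t).
Proof.
move=> /(ccontinuousM (ccontinuous_cst (-1))).
by under eq_fun do rewrite mulN1r.
Qed.

Lemma ccontinuousB f g : ccontinuous f -> ccontinuous g ->
  ccontinuous (fun t => f t - g t).
Proof. by move=> cf /ccontinuousN; exact: ccontinuousD. Qed.

Lemma continuous_sqr_normc f : ccontinuous f ->
  continuous (fun t => Re (f t) ^+ 2 + Im (f t) ^+ 2).
Proof.
move=> [f1 f2] t; under eq_fun do rewrite !expr2.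
by apply: cvgD; apply: cvgM;
  [exact: f1|exact: f1|exact: f2|exact: f2].
Qed.

Lemma continuous_normc f : ccontinuous f -> continuous (fun t => normc (f t)).
Proof.
move=> cf t; under eq_fun do rewrite normcRe.
apply: (@continuous_comp _ _ _ (fun t => Re (f t) ^+ 2 + Im (f t) ^+ 2)).
  exact: continuous_sqr_normc.
exact: sqrt_continuous.
Qed.

Lemma ccontinuousV f : ccontinuous f -> (forall t, f t != 0) ->
  ccontinuous (fun t => (f t)^-1).
Proof.
move=> cf f0; have [f1 f2] := cf.
have cn t : {for t, continuous (fun t => (Re (f t) ^+ 2 + Im (f t) ^+ 2)^-1)}.
  apply: cvgV; first by rewrite gt_eqF// sqr_normc_gt0.
  exact: continuous_sqr_normc.
split => t.
  by under eq_fun do rewrite Re_inv; apply: cvgM; [exact: f1|exact: cn].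
under eq_fun do rewrite Im_inv.
by apply: cvgN; apply: cvgM; [exact: f2|exact: cn].
Qed.

Lemma ccontinuousX f n : ccontinuous f -> ccontinuous (fun t => f t ^+ n).
Proof.
move=> cf; elim: n => [|n IH]; first exact: ccontinuous_cst.
by under eq_fun do rewrite exprS; exact: ccontinuousM.
Qed.

Definition cint f : R[i] := cintegral 0 (2 * pi) f.

Lemma twopi_gt0 : 0 < 2 * pi :> R.
Proof. by rewrite mulr_gt0// pi_gt0. Qed.
Let pi2 := twopi_gt0.

Let icont (f : R -> R) : continuous f ->
  mu.-integrable `[0, 2 * pi] (EFin \o f).
Proof. exact: integrable_continuous. Qed.

Lemma cintD f g : ccontinuous f -> ccontinuous g ->
  cint (fun t => f t + g t) = cint f + cint g.
Proof.
move=> [f1 f2] [g1 g2]; rewrite /cint /cintegral.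
under eq_Rintegral do rewrite Re_add.
under [X in _ +i* X]eq_Rintegral do rewrite Im_add.
by rewrite !RintegralD//; exact: icont.
Qed.

Lemma cintZ z f : ccontinuous f -> cint (fun t => z * f t) = z * cint f.
Proof.
move=> [f1 f2]; rewrite /cint /cintegral.
under eq_Rintegral do rewrite Re_mul.
under [X in _ +i* X]eq_Rintegral do rewrite Im_mul.
have cZ (u : R) (h : R -> R) : continuous h -> continuous (fun t => u * h t).
  by move=> ch t; apply: cvgM; [exact: cst_continuous|exact: ch].
rewrite RintegralB ?RintegralD//; try exact/icont/cZ.
rewrite !RintegralZl//; try exact: icont.
by apply/eqP; rewrite eq_complex Re_mul Im_mul /= !eqxx.
Qed.

Lemma cintB f g : ccontinuous f -> ccontinuous g ->
  cint (fun t => f t - g t) = cint f - cint g.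
Proof.
move=> cf cg; rewrite -mulN1r -cintZ// -cintD//; last first.
  by apply: ccontinuousM => //; exact: ccontinuous_cst.
by under [in RHS]eq_fun do rewrite mulN1r.
Qed.

Lemma cint_cst z : cint (fun=> z) = (2 * pi)%:C * z.
Proof.
rewrite /cint /cintegral !Rintegral_cst//= lebesgue_measure_itv/= lte_fin pi2.
rewrite -EFinD /= subr0.
by apply/eqP; rewrite eq_complex Re_mul Im_mul /= !mul0r subr0 addr0 ![_ * (2 * pi)]mulrC !eqxx.
Qed.

Lemma cint_FTC f F : ccontinuous f ->
  (forall t, is_derive t 1 (fun u => Re (F u)) (Re (f t)) /\
             is_derive t 1 (fun u => Im (F u)) (Im (f t))) ->
  cint f = F (2 * pi) - F 0.
Proof.
move=> [f1 f2] dF; rewrite /cint /cintegral.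
rewrite (Rintegral_FTC pi2 f1 (fun t => (dF t).1)).
rewrite (Rintegral_FTC pi2 f2 (fun t => (dF t).2)).
by apply/eqP; rewrite eq_complex Re_add Im_add Re_opp Im_opp /= !eqxx.
Qed.

(** The two components are bounded separately, which costs a factor 2. *)
Lemma cint_normc_le f (C : R) : ccontinuous f ->
  (forall t, normc (f t) <= C) -> normc (cint f) <= 4 * pi * C.
Proof.
move=> [f1 f2] fC.
have bnd (h : R -> R) : continuous h -> (forall t, `|h t| <= C) ->
    `|\int[mu]_(t in `[0, (2 * pi)%R]) h t| <= 2 * pi * C.
  move=> ch hC; apply: le_trans (le_normr_Rintegral _ (icont ch)) _ => //.
  have -> : 2 * pi * C = \int[mu]_(t in `[0, (2 * pi)%R]) (cst C t).
    by rewrite Rintegral_cst//= lebesgue_measure_itv/= lte_fin pi2 -EFinD/= subr0 mulrC.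
  apply: le_Rintegral => //.
    by apply: icont => t; apply: continuous_comp; [exact: ch|exact: norm_continuous].
  by apply: icont; exact: cst_continuous.
have C0 : 0 <= C by apply: le_trans (fC 0); exact: normc_ge0.
have A := bnd _ f1 (fun t => le_trans (Re_le_normc _) (fC t)).
have B := bnd _ f2 (fun t => le_trans (Im_le_normc _) (fC t)).
have -> : cint f = (Re (cint f))%:C + 'i%C * (Im (cint f))%:C by exact: complexE.
apply: le_trans (le_normcD _ _) _; rewrite normcM !normcR.
have -> : normc 'i%C = 1 :> R by rewrite normcRe /= expr0n add0r expr1n sqrtr1.
rewrite mul1r; apply: le_trans (lerD A B) _.
by have := pi_gt0 R; nra.
Qed.

Definition expi k t : R[i] := cos (k%:~R * t) +i* sin (k%:~R * t).

Lemma expiD k l t : expi (k + l) t = expi k t * expi l t.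
Proof.
apply/eqP; rewrite eq_complex Re_mul Im_mul /= rmorphD /= mulrDl cosD sinD.
by rewrite eqxx /= addrC eqxx.
Qed.

Lemma expi0 t : expi 0 t = 1.
Proof. by rewrite /expi mul0r cos0 sin0. Qed.

Lemma normc_expi k t : normc (expi k t) = 1.
Proof. by rewrite normcRe /= cos2Dsin2 sqrtr1. Qed.

Lemma expi_neq0 k t : expi k t != 0.
Proof. by rewrite -normc_gt0 normc_expi. Qed.

Lemma expiN k t : expi (- k) t = (expi k t)^-1.
Proof. by apply: (mulIf (expi_neq0 k t)); rewrite mulVf ?expi_neq0// -expiD addNr expi0. Qed.

Lemma expiM k (n : nat) t : expi (k * n%:Z) t = expi k t ^+ n.
Proof.
elim: n => [|n IH]; first by rewrite mulr0 expi0.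
by rewrite intS mulrDr mulr1 expiD IH exprS.
Qed.

Lemma is_derive_expi k t :
  is_derive t 1 (fun u => Re (expi k u)) (Re ('i%C * k%:~R * expi k t)) /\
  is_derive t 1 (fun u => Im (expi k u)) (Im ('i%C * k%:~R * expi k t)).
Proof.
have -> : (k%:~R : R[i]) = (k%:~R : R)%:C by rewrite rmorph_int.
have dl : is_derive t 1 (fun u => (k%:~R : R) * u) k%:~R.
  by apply: is_derive_eq; rewrite scaler1.
rewrite Re_mul Im_mul Re_mul Im_mul /= !(mul0r, mulr0, add0r, subr0, addr0, mul1r, sub0r, oppr0).
split.
  have := @is_derive1_comp _ cos _ t _ _ (is_derive_cos _) dl.
  by rewrite mulrC mulrN.
have := @is_derive1_comp _ sin _ t _ _ (is_derive_sin _) dl.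
by rewrite mulrC.
Qed.

Lemma ccontinuous_expi k : ccontinuous (expi k).
Proof.
split; apply: is_derive1_continuous => t; [exact: (is_derive_expi k t).1|exact: (is_derive_expi k t).2].
Qed.

Lemma expi_2pi k : expi k (2 * pi) = 1.
Proof.
have e1 : expi 1 (2 * pi) = 1.
  by rewrite /expi mul1r mulr_natl cos2pi -[X in sin X]add0r sinD2pi sin0.
case: k => n; first by rewrite -[Posz n]mul1r expiM e1 expr1n.
by rewrite NegzE expiN -[Posz _]mul1r expiM e1 expr1n invr1.
Qed.

Lemma expi_0 k : expi k 0 = 1.
Proof. by rewrite /expi mulr0 cos0 sin0. Qed.

Lemma cint_expi k : k != 0 -> cint (expi k) = 0.
Proof.
move=> k0.
have cE : ccontinuous (fun t => 'i%C * k%:~R * expi k t).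
  by apply: ccontinuousM; [exact: ccontinuous_cst|exact: ccontinuous_expi].
have := cint_FTC cE (is_derive_expi k).
rewrite expi_2pi expi_0 subrr cintZ; last exact: ccontinuous_expi.
move/eqP; rewrite !mulf_eq0 intr_eq0 (negbTE k0) eq_complex /= eqxx oner_eq0 /=.
by move/eqP.
Qed.

Lemma one_sub_expi_neq0 k w t : normc w < 1 -> 1 - w * expi k t != 0.
Proof.
move=> w1; rewrite -normc_gt0; apply: lt_le_trans (le_normc_sub _ _).
by rewrite normc1 normcM normc_expi mulr1 subr_gt0.
Qed.

Lemma ccontinuous_geom k w : normc w < 1 ->
  ccontinuous (fun t => (1 - w * expi k t)^-1).
Proof.
move=> w1; apply: ccontinuousV; last by move=> t; exact: one_sub_expi_neq0.
apply: ccontinuousB; first exact: ccontinuous_cst.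
by apply: ccontinuousM; [exact: ccontinuous_cst|exact: ccontinuous_expi].
Qed.

(** Of the geometric expansion only the constant term has a nonzero mean.  The
remainders T n = int e^{ikn} / (1 - w e^{ik}) satisfy T n = w T (n + 1) for n > 0
and stay bounded, so that T 1 = 0. *)
Lemma cint_geom k w : k != 0 -> normc w < 1 ->
  cint (fun t => (1 - w * expi k t)^-1) = (2 * pi)%:C.
Proof.
move=> k0 w1; pose G t := (1 - w * expi k t)^-1.
have cG : ccontinuous G by exact: ccontinuous_geom.
pose T n := cint (fun t => expi (k * n%:Z) t * G t).
have cT n : ccontinuous (fun t => expi (k * n%:Z) t * G t).
  by apply: ccontinuousM => //; exact: ccontinuous_expi.
have TE n : T n = cint (expi (k * n%:Z)) + w * T n.+1.
  rewrite -cintZ// -cintD; last 2 first.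
  - exact: ccontinuous_expi.
  - by apply: ccontinuousM => //; exact: ccontinuous_cst.
  congr cint; apply/funext => t; rewrite intS mulrDr mulr1 expiD /G.
  have := one_sub_expi_neq0 k t w1; set u := expi k t => u1.
  by move: (expi (k * n) t) => v; field.
have T1E n : T 1%N = w ^+ n * T n.+1.
  elim: n => [|n IH]; first by rewrite mul1r.
  rewrite IH TE cint_expi ?mulf_neq0// add0r mulrA -exprSr//.
have G1 t : normc (G t) <= (1 - normc w)^-1.
  rewrite /G normcV lef_pV2 ?posrE ?subr_gt0//; last first.
    by rewrite normc_gt0; exact: one_sub_expi_neq0.
  apply: le_trans (le_normc_sub _ _).
  by rewrite normc1 normcM normc_expi mulr1.
have TB n : normc (T n) <= 4 * pi * (1 - normc w)^-1.
  apply: cint_normc_le => // t.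
  by rewrite normcM normc_expi mul1r.
have T10 : T 1%N = 0.
  apply: eq0_normc; apply/eqP; rewrite eq_le normc_ge0 andbT.
  have cv : (fun n => normc w ^+ n * (4 * pi * (1 - normc w)^-1)) @ \oo --> (0 : R).
    rewrite -[X in _ --> X](mul0r (4 * pi * (1 - normc w)^-1)).
    apply: cvgM; last exact: cvg_cst.
    by apply: cvg_expr; rewrite ger0_norm ?normc_ge0.
  rewrite -(cvg_lim _ cv)//; apply: limr_ge; first exact: cvgP cv.
  near=> n; rewrite (T1E n) normcM normcX ler_wpM2l// ?exprn_ge0// ?normc_ge0//.
have -> : cint (fun t => (1 - w * expi k t)^-1) = T 0%N.
  congr cint; apply/funext => t; by rewrite mulr0 expi0 mul1r.
rewrite TE T10 [w * 0]mulr0 addr0.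
have -> : expi (k * 0) = fun=> 1 by apply/funext => t; rewrite mulr0 expi0.
by rewrite cint_cst mulr1.
Unshelve. all: by end_near. Qed.

End ComplexIntegrals.

(** * The winding number of the ellipse *)

Section CauchyKernel.
Variable R : realType.
Local Notation mu := (@lebesgue_measure R).
Local Notation Re := (@complex.Re R).
Local Notation Im := (@complex.Im R).
Implicit Types (t : R) (z w : R[i]) (k : int).

Lemma expi_sub_neq0 k w t : normc w != 1 -> expi k t - w != 0.
Proof. by apply: contra_neq => /subr0_eq <-; rewrite normc_expi. Qed.

Lemma ccontinuous_kernel k w : normc w != 1 ->
  ccontinuous (fun t => expi k t / (expi k t - w)).
Proof.
move=> w1; apply: ccontinuousM; first exact: ccontinuous_expi.
apply: ccontinuousV; last by move=> t; exact: expi_sub_neq0.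
by apply: ccontinuousB; [exact: ccontinuous_expi|exact: ccontinuous_cst].
Qed.

Lemma cint_kernel_in k w : k != 0 -> normc w < 1 ->
  cint (fun t => expi k t / (expi k t - w)) = (2 * pi)%:C.
Proof.
move=> k0 w1; rewrite -(@cint_geom _ (- k) w)// ?oppr_eq0//.
congr cint; apply/funext => t; rewrite expiN.
have := expi_sub_neq0 k t (negbT (lt_eqF w1)); have := expi_neq0 k t.
by move: (expi k t) => u u0 uw; field; rewrite u0.
Qed.

(** Here e / (e - w) = 1 - 1 / (1 - e / w), and both terms have mean 1. *)
Lemma cint_kernel_out k w : k != 0 -> 1 < normc w ->
  cint (fun t => expi k t / (expi k t - w)) = 0.
Proof.
move=> k0 w1.
have w0 : w != 0 by rewrite -normc_gt0 (lt_trans _ w1).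
have wV1 : normc w^-1 < 1 by rewrite normcV invf_lt1// (lt_trans _ w1).
have -> : (fun t => expi k t / (expi k t - w)) =
    (fun t => 1 - (1 - w^-1 * expi k t)^-1).
  apply/funext => t.
  have := expi_sub_neq0 k t (negbT (gt_eqF w1)).
  have := one_sub_expi_neq0 k t wV1.
  move: (expi k t) => u u1 uw; field; rewrite w0 uw andbT /=.
  by rewrite -opprB oppr_eq0.
rewrite cintB; [|exact: ccontinuous_cst|exact: ccontinuous_geom].
by rewrite cint_cst cint_geom// mulr1 subrr.
Qed.

Variables (r : R) (r1 : 1 < r).
Let a := (r + 1) / 2.
Let b := (r - 1) / 2.
Let r0 : 0 < r := lt_trans ltr01 r1.

Lemma param_expi t :
  param r t = a%:C * expi 1 t + b%:C * (expi 1 t)^-1.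
Proof.
rewrite -expiN; apply/eqP; rewrite eq_complex Re_add Im_add !Re_mul !Im_mul /=.
by rewrite !mul0r !mul1r !mulNr !mul1r cosN sinN /a /b; apply/andP; split; apply/eqP; field.
Qed.

Lemma dparam_expi t :
  dparam r t = 'i%C * (a%:C * expi 1 t - b%:C * (expi 1 t)^-1).
Proof.
rewrite -expiN; apply/eqP; rewrite eq_complex Re_mul Im_mul Re_add Im_add Re_opp Im_opp !Re_mul !Im_mul /=.
by rewrite !mul0r !mul1r !mulNr !mul1r cosN sinN /a /b; apply/andP; split; apply/eqP; field.
Qed.

Lemma ccontinuous_param : ccontinuous (param r).
Proof.
rewrite (funext param_expi).
apply: ccontinuousD; apply: ccontinuousM; try exact: ccontinuous_cst.
  exact: ccontinuous_expi.
by apply: ccontinuousV; [exact: ccontinuous_expi|move=> t; exact: expi_neq0].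
Qed.

Lemma ccontinuous_dparam : ccontinuous (dparam r).
Proof.
rewrite (funext dparam_expi).
apply: ccontinuousM; first exact: ccontinuous_cst.
apply: ccontinuousB; apply: ccontinuousM; try exact: ccontinuous_cst.
  exact: ccontinuous_expi.
by apply: ccontinuousV; [exact: ccontinuous_expi|move=> t; exact: expi_neq0].
Qed.

Lemma ellipse_eqn_param t : ellipse_eqn r (param r t) = 1.
Proof.
by rewrite /ellipse_eqn /param /= exprMn mulrAC divff ?mul1r ?cos2Dsin2// expf_neq0// gt_eqF.
Qed.

Lemma param_neq0 t : param r t != 0.
Proof.
apply/eqP => z0; have := ellipse_eqn_param t.
by rewrite z0 /ellipse_eqn /= expr0n mul0r addr0 => /eqP; rewrite eq_sym oner_eq0.
Qed.

Lemma param_sub_neq0 t z : ellipse_eqn r z != 1 -> param r t - z != 0.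
Proof. by apply: contra_neq => /subr0_eq <-; exact: ellipse_eqn_param. Qed.

(** With |w|^2 = n, the map w |-> a w + b / w sends the circles |w| = 1 and
|w| = b / a to the ellipse and the annulus between them into its interior. *)
Lemma ellipse_eqn_joukowski w : w != 0 ->
  let n := Re w ^+ 2 + Im w ^+ 2 in
  ellipse_eqn r (a%:C * w + b%:C * w^-1) - 1 =
  (n - 1) * (a ^+ 2 * n - b ^+ 2) * ((Re w ^+ 2 / r ^+ 2 + Im w ^+ 2) / n ^+ 2).
Proof.
move=> /sqr_normc_gt0 n0 n.
rewrite /ellipse_eqn Re_add Im_add !Re_mul !Im_mul Re_inv Im_inv /=.
move: n0; rewrite {}/n; move: (Re w) (Im w) => X Y n0.
rewrite /a /b; field; apply/andP; split; first by rewrite gt_eqF.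
by rewrite gt_eqF.
Qed.

Let a0 : 0 < a. Proof. by rewrite /a; move: r1; lra. Qed.
Let b0 : 0 < b. Proof. by rewrite /b; move: r1; lra. Qed.
Let ba : b < a. Proof. by rewrite /b /a; lra. Qed.

(** Winding number of the ellipse: the roots w1, w2 of a w + b / w = z satisfy
|w1 w2| = b / a < 1; for z inside both lie in the unit disc, and for z outside
exactly one of them does. *)
Lemma cint_winding z : ellipse_eqn r z != 1 ->
  cint (fun t => dparam r t / (param r t - z)) =
  if ellipse_eqn r z < 1 then 'i%C * (2 * pi)%:C else 0.
Proof.
move=> z1; pose d := sqrtc (z ^+ 2 - 4 * a%:C * b%:C).
pose w1 := (z + d) / (2 * a%:C); pose w2 := (z - d) / (2 * a%:C).
have aC0 : a%:C != 0 :> R[i] by rewrite real_complex_eq0 gt_eqF.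
have d2 : d ^+ 2 = z ^+ 2 - 4 * a%:C * b%:C by rewrite sqr_sqrtc.
have w12 : a%:C * (w1 * w2) = b%:C.
  have -> : a%:C * (w1 * w2) = (z ^+ 2 - d ^+ 2) / (4 * a%:C) by rewrite /w1 /w2; field.
  by rewrite d2; field.
have zE : z = a%:C * (w1 + w2) by rewrite /w1 /w2; field.
clearbody w1 w2; clear d d2.
have n12 : normc w1 * normc w2 = b / a.
  apply: (mulfI (lt0r_neq0 a0)); rewrite -{1}(ger0_norm (ltW a0)) -normcR.
  by rewrite -!normcM w12 normcR ger0_norm ?ltW//; field; rewrite gt_eqF.
(* The position of one root relative to the unit circle decides that of z. *)
have side v v' : a%:C * (v * v') = b%:C -> z = a%:C * (v + v') ->
  normc v * normc v' = b / a ->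
  [/\ (1 < normc v -> 1 < ellipse_eqn r z),
      (normc v < 1 -> normc v' < 1 -> ellipse_eqn r z < 1) & normc v != 1].
  move=> vv zv nvv.
  have v0 : v != 0.
    apply/eqP => v0; move: vv; rewrite v0 mul0r mulr0 => /eqP.
    by rewrite eq_sym real_complex_eq0 gt_eqF.
  have zJ : z = a%:C * v + b%:C * v^-1 by rewrite zv -vv; field.
  have := ellipse_eqn_joukowski v0; rewrite -zJ /= -sqr_normcRe => E.
  have nv0 : 0 < normc v by rewrite normc_gt0.
  have S0 : 0 < (Re v ^+ 2 / r ^+ 2 + Im v ^+ 2) / (normc v ^+ 2) ^+ 2.
    rewrite divr_gt0 ?exprn_gt0// -(@pmulr_rgt0 _ (r ^+ 2)) ?exprn_gt0//.
    have -> : r ^+ 2 * (Re v ^+ 2 / r ^+ 2 + Im v ^+ 2) =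
      Re v ^+ 2 + r ^+ 2 * Im v ^+ 2 by field; rewrite gt_eqF.
    apply: lt_le_trans (sqr_normc_gt0 v0) _; rewrite lerD2l ler_peMl ?sqr_ge0//.
    by rewrite expr_ge1// ltW.
  split.
  - move=> v1; rewrite -subr_gt0 E pmulr_lgt0// mulr_gt0//.
      by rewrite subr_gt0 expr_gt1// ltW.
    rewrite subr_gt0 -exprMn ltr_pXn2r ?nnegrE ?(ltW b0) ?(mulr_ge0 (ltW a0) (normc_ge0 v))//.
    by apply: lt_trans ba _; rewrite ltr_pMr.
  - move=> v1 v'1; rewrite -subr_lt0 E pmulr_llt0// nmulr_rlt0 ?subr_lt0 ?expr_lt1 ?ltW//.
    rewrite subr_gt0 -exprMn ltr_pXn2r ?nnegrE ?(ltW b0) ?(mulr_ge0 (ltW a0) (normc_ge0 v))//.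
    have -> : b = a * (normc v * normc v') by rewrite nvv; field; rewrite gt_eqF.
    by rewrite ltr_pM2l// gtr_pMr.
  - apply: contra_neq z1 => v1; apply/eqP; rewrite -subr_eq0 E v1 expr1n subrr.
    by rewrite !mul0r.
have [out1 ins1 e1] := side _ _ w12 zE n12.
have [out2 ins2 e2] : [/\ (1 < normc w2 -> 1 < ellipse_eqn r z),
      (normc w2 < 1 -> normc w1 < 1 -> ellipse_eqn r z < 1) & normc w2 != 1].
  by apply: side; [rewrite [w2 * _]mulrC|rewrite [w2 + _]addrC|rewrite mulrC].
have -> : (fun t => dparam r t / (param r t - z)) = (fun t => 'i%C *
    (expi 1 t / (expi 1 t - w1) + expi 1 t / (expi 1 t - w2) - 1)).
  apply/funext => t; have := param_sub_neq0 t z1.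
  rewrite dparam_expi param_expi -w12 zE.
  have := expi_sub_neq0 1 t e1; have := expi_sub_neq0 1 t e2.
  move: (expi 1 t) (expi_neq0 1 t) => u u0 uw2 uw1.
  have -> : a%:C * u + a%:C * (w1 * w2) / u - a%:C * (w1 + w2) =
    a%:C * (u - w1) * (u - w2) / u by field.
  by move=> _; field; rewrite u0 aC0 uw1 uw2.
have c1 := @ccontinuous_kernel 1 _ e1; have c2 := @ccontinuous_kernel 1 _ e2.
rewrite cintZ; last first.
  by apply: ccontinuousB; [exact: ccontinuousD|exact: ccontinuous_cst].
rewrite cintB; [|exact: ccontinuousD|exact: ccontinuous_cst].
rewrite cintD// cint_cst mulr1.
have [lt1|ge1] := ltP (normc w1) 1; have [lt2|ge2] := ltP (normc w2) 1.
- by rewrite ins1// !cint_kernel_in// addrK.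
- have gt2 : 1 < normc w2 by rewrite lt_neqAle eq_sym e2.
  rewrite ltNge (ltW (out2 gt2)) /= cint_kernel_in// cint_kernel_out//.
  by rewrite addr0 subrr mulr0.
- have gt1 : 1 < normc w1 by rewrite lt_neqAle eq_sym e1.
  rewrite ltNge (ltW (out1 gt1)) /= cint_kernel_out// cint_kernel_in//.
  by rewrite add0r subrr mulr0.
- exfalso; have : 1 <= normc w1 * normc w2 by rewrite mulr_ege1.
  by rewrite n12 leNgt ltr_pdivrMr// mul1r ba.
Qed.

End CauchyKernel.

(** * Cauchy's formula for polynomials *)

Section PolynomialCauchy.
Variable R : realType.
Local Notation mu := (@lebesgue_measure R).
Local Notation Re := (@complex.Re R).
Local Notation Im := (@complex.Im R).
Variables (r : R) (r1 : 1 < r).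
Implicit Types (t : R) (z w beta : R[i]) (P Q : {poly R[i]}) (h g : R[i] -> R[i]).
Let cpar := ccontinuous_param r.
Let cdpar := ccontinuous_dparam r.

Lemma ccontinuous_horner P (f : R -> R[i]) : ccontinuous f ->
  ccontinuous (fun t => P.[f t]).
Proof.
move=> cf; elim/poly_ind: P => [|P c IH].
  by under eq_fun do rewrite horner0; exact: ccontinuous_cst.
under eq_fun do rewrite hornerMXaddC.
by apply: ccontinuousD; [exact: ccontinuousM|exact: ccontinuous_cst].
Qed.

Lemma ccontinuous_param_inv z : ellipse_eqn r z != 1 ->
  ccontinuous (fun t => (param r t - z)^-1).
Proof.
move=> z1; apply: ccontinuousV; last by move=> t; exact: param_sub_neq0.
by apply: ccontinuousB => //; exact: ccontinuous_cst.
Qed.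

Lemma is_derive_param_exp n t :
  is_derive t 1 (fun u => Re (param r u ^+ n.+1))
    (Re (n.+1%:R * param r t ^+ n * dparam r t)) /\
  is_derive t 1 (fun u => Im (param r u ^+ n.+1))
    (Im (n.+1%:R * param r t ^+ n * dparam r t)).
Proof.
have [dRe dIm] := is_derive_param r t.
elim: n => [|n [IHRe IHIm]].
  by rewrite expr0 !mul1r; split.
have E : n.+2%:R * param r t ^+ n.+1 * dparam r t =
    param r t * (n.+1%:R * param r t ^+ n * dparam r t) +
    param r t ^+ n.+1 * dparam r t by rewrite exprS -[n.+2]addn1 natrD; ring.
have [-> ->] : (fun u => Re (param r u ^+ n.+2)) =
      (fun u => Re (param r u)) * (fun u => Re (param r u ^+ n.+1)) -
      (fun u => Im (param r u)) * (fun u => Im (param r u ^+ n.+1)) /\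
    (fun u => Im (param r u ^+ n.+2)) =
      (fun u => Re (param r u)) * (fun u => Im (param r u ^+ n.+1)) +
      (fun u => Im (param r u)) * (fun u => Re (param r u ^+ n.+1)).
  by split; apply/funext => u; rewrite exprS ?Re_mul ?Im_mul.
rewrite E; move: IHRe IHIm; move: (n.+1%:R * _ * _) => D IHRe IHIm.
rewrite Re_add Im_add !(Re_mul _ D) !(Im_mul _ D) !(Re_mul _ (dparam r t)).
rewrite !(Im_mul _ (dparam r t)); split; apply: is_derive_eq => /=;
  by rewrite /GRing.scale /=; ring.
Qed.

Lemma cint_param_exp n : cint (fun t => param r t ^+ n * dparam r t) = 0.
Proof.
have n0 : n.+1%:R != 0 :> R[i] by rewrite pnatr_eq0.
have cf : ccontinuous (fun t => param r t ^+ n * dparam r t).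
  by apply: ccontinuousM => //; exact: ccontinuousX.
apply: (mulfI n0); rewrite mulr0 -cintZ//.
under eq_fun do rewrite mulrA.
rewrite (@cint_FTC _ _ (fun t => param r t ^+ n.+1)).
- suff -> : param r (2 * pi) = param r 0 by rewrite subrr.
  by rewrite /param mulr_natl -[pi *+ 2]add0r cosD2pi sinD2pi.
- under eq_fun do rewrite -mulrA; apply: ccontinuousM => //.
  exact: ccontinuous_cst.
- by move=> t; exact: is_derive_param_exp.
Qed.

(** Cauchy's theorem for polynomials, in the form that passes through Horner's
recursion. *)
Lemma cint_poly_exp P n :
  cint (fun t => P.[param r t] * param r t ^+ n * dparam r t) = 0.
Proof.
elim/poly_ind: P n => [|P c IH] n.
  under eq_fun do rewrite horner0 !mul0r.
  by rewrite cint_cst mulr0.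
have E t : (P * 'X + c%:P).[param r t] * param r t ^+ n * dparam r t =
    P.[param r t] * param r t ^+ n.+1 * dparam r t +
    c * (param r t ^+ n * dparam r t).
  by rewrite hornerMXaddC exprS; ring.
have cn k : ccontinuous (fun t => param r t ^+ k * dparam r t).
  by apply: ccontinuousM => //; exact: ccontinuousX.
rewrite (funext E) cintD.
- by rewrite IH cintZ// cint_param_exp mulr0 addr0.
- under eq_fun do rewrite -mulrA.
  by apply: ccontinuousM => //; exact: ccontinuous_horner.
- by apply: ccontinuousM => //; exact: ccontinuous_cst.
Qed.

(** Since the differences P(x) - P(z) are divisible by x - z, Cauchy's integral
formula for polynomials only involves the winding number. *)
Lemma cint_cauchy_poly P z : ellipse_eqn r z != 1 ->
  cint (fun t => P.[param r t] * (dparam r t / (param r t - z))) =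
  P.[z] * cint (fun t => dparam r t / (param r t - z)).
Proof.
move=> z1; have cz := ccontinuous_param_inv z1.
have cJ : ccontinuous (fun t => dparam r t / (param r t - z)).
  exact: ccontinuousM.
elim/poly_ind: P => [|P c IH].
  under eq_fun do rewrite horner0 mul0r.
  by rewrite horner0 mul0r cint_cst mulr0.
have E t : (P * 'X + c%:P).[param r t] * (dparam r t / (param r t - z)) =
    P.[param r t] * param r t ^+ 0 * dparam r t +
    z * (P.[param r t] * (dparam r t / (param r t - z))) +
    c * (dparam r t / (param r t - z)).
  rewrite hornerMXaddC expr0.
  by have := param_sub_neq0 r1 t z1; move: (param r t) => u uz; field.
have cP : ccontinuous (fun t => P.[param r t] * (dparam r t / (param r t - z))).
  by apply: ccontinuousM => //; exact: ccontinuous_horner.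
have cP0 : ccontinuous (fun t => P.[param r t] * param r t ^+ 0 * dparam r t).
  apply: ccontinuousM => //; apply: ccontinuousM; first exact: ccontinuous_horner.
  exact: ccontinuousX.
have cst_mul w f : ccontinuous f -> ccontinuous (fun t => w * f t).
  by move=> cf; apply: ccontinuousM => //; exact: ccontinuous_cst.
rewrite (funext E) cintD; [|by apply: ccontinuousD => //; exact: cst_mul|exact: cst_mul].
rewrite cintD//; last exact: cst_mul.
rewrite cint_poly_exp !cintZ// IH hornerMXaddC; ring.
Qed.

End PolynomialCauchy.

(** * Test functions and the operator norm *)

Section TestFunctions.
Variable R : realType.
Local Notation mu := (@lebesgue_measure R).
Local Notation Re := (@complex.Re R).
Local Notation Im := (@complex.Im R).
Variables (r : R) (r1 : 1 < r).
Implicit Types (t : R) (z w beta : R[i]) (P Q : {poly R[i]}) (h g : R[i] -> R[i]).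
Let cpar := ccontinuous_param r.
Let cdpar := ccontinuous_dparam r.
Let pi2 := twopi_gt0 R.

(** Both Cauchy transforms act on these functions as the projections onto the two
summands. *)
Definition test_fun P beta z : R[i] := P.[z] + beta / z.

Lemma ccontinuous_test P beta : ccontinuous (fun t => test_fun P beta (param r t)).
Proof.
apply: ccontinuousD; first exact: ccontinuous_horner.
apply: ccontinuousM; first exact: ccontinuous_cst.
by apply: ccontinuousV => //; move=> t; exact: param_neq0.
Qed.

Lemma ellipse_eqn0 : ellipse_eqn r 0 = 0.
Proof. by rewrite /ellipse_eqn /= expr0n mul0r addr0. Qed.

Definition test_part (exterior : bool) P beta : R[i] -> R[i] :=
  if exterior then test_fun 0 beta else test_fun P 0.

(** Partial fractions reduce beta / (zeta (zeta - z)) to the winding numbers around z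
and 0, whose difference vanishes for z inside. *)
Lemma cauchy_test (exterior : bool) P beta z : z != 0 ->
  ellipse_side r exterior z ->
  Defs.cauchy r exterior (test_fun P beta) z = test_part exterior P beta z.
Proof.
move=> z0 zside.
have z1 : ellipse_eqn r z != 1.
  by case: exterior zside => /= zs; rewrite ?(gt_eqF zs) ?(lt_eqF zs).
have o1 : ellipse_eqn r 0 != 1 by rewrite ellipse_eqn0 eq_sym oner_eq0.
have cJ w : ellipse_eqn r w != 1 ->
    ccontinuous (fun t => dparam r t / (param r t - w)).
  by move=> w1; apply: ccontinuousM => //; exact: ccontinuous_param_inv.
have cst_mul w f : ccontinuous f -> ccontinuous (fun t => w * f t).
  by move=> cf; apply: ccontinuousM => //; exact: ccontinuous_cst.
have E t : test_fun P beta (param r t) / (param r t - z) * dparam r t =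
    P.[param r t] * (dparam r t / (param r t - z)) +
    beta / z * (dparam r t / (param r t - z) - dparam r t / (param r t - 0)).
  rewrite /test_fun subr0; have := param_sub_neq0 r1 t z1.
  have := param_neq0 r1 t; move: (param r t) => u u0 uz.
  by field; rewrite u0 z0 uz.
rewrite /Defs.cauchy /contour_integral -/(cint _) (funext E) cintD; last 2 first.
- by apply: ccontinuousM; [exact: ccontinuous_horner|exact: cJ].
- by apply/cst_mul/ccontinuousB; exact: cJ.
rewrite cint_cauchy_poly// cintZ; last by apply: ccontinuousB; exact: cJ.
rewrite cintB ?cint_winding//; [|exact: cJ|exact: cJ].
rewrite ellipse_eqn0 ltr01 /test_part /test_fun.
have iE : (0 +i* (2 * pi))^-1 * ('i%C * (2 * pi)%:C) = 1 :> R[i].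
  have -> : 'i%C * (2 * pi)%:C = 0 +i* (2 * pi) :> R[i].
    by apply/eqP; rewrite eq_complex Re_mul Im_mul /= !(mul0r, mulr0, mul1r) subrr add0r !eqxx.
  rewrite mulVf// eq_complex /= eqxx /=; exact: lt0r_neq0.
case: exterior zside => /= zs.
  rewrite ltNge (ltW zs) /= expr1 horner0 add0r mulr0 !add0r.
  transitivity ((0 +i* (2 * pi))^-1 * ('i%C * (2 * pi)%:C) * (beta / z)); first by ring.
  by rewrite iE mul1r.
rewrite zs expr0 subrr mulr0 addr0 mul0r addr0.
transitivity ((0 +i* (2 * pi))^-1 * ('i%C * (2 * pi)%:C) * P.[z]); first by ring.
by rewrite iE mul1r.
Qed.

Lemma continuous_test P beta z : z != 0 -> {for z, continuous (test_fun P beta)}.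
Proof.
move=> z0; have cP : {for z, continuous (horner P)}.
  elim/poly_ind: P => [|P c IH].
    rewrite (_ : horner 0 = fun=> 0); last first.
      by apply/funext => v; rewrite horner0.
    exact: cst_continuous.
  rewrite (_ : horner _ = fun v => P.[v] * v + c).
    apply: continuousD; last exact: cst_continuous.
    apply: (@continuousM R[i] R[i] (horner P) id z IH); exact: cvg_id.
  by apply/funext => v; rewrite hornerMXaddC.
apply: continuousD; first exact: cP.
apply: (@continuousM R[i] R[i] (fun=> beta) GRing.inv z).
  exact: cst_continuous.
exact: inv_continuous.
Qed.

(** Near a boundary point the transform coincides with a continuous function; the
neighbourhood only has to avoid the origin. *)
Lemma nontangential_limit_test (exterior : bool) P beta t :
  nontangential_limit r exterior (Defs.cauchy r exterior (test_fun P beta))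
    (param r t) (test_part exterior P beta (param r t)).
Proof.
move=> alpha alpha0; set w := param r t; have w0 : w != 0 by exact: param_neq0.
have cg : {for w, continuous (test_part exterior P beta)}.
  by rewrite /test_part; case: exterior; exact: continuous_test.
have cgw : test_part exterior P beta z @[z --> within
    (approach_region r exterior alpha w) (nbhs w)] --> test_part exterior P beta w.
  exact: cvg_within_filter.
apply: cvg_trans cgw; apply: near_eq_cvg.
rewrite near_withinE; near=> z => -[zs _].
rewrite cauchy_test//; near: z.
apply: open_nbhs_nbhs; split => //.
rewrite (_ : (fun x : R[i] => _) = ~` [set 0]); last by apply/seteqP; split => v /eqP.
apply/closed_openC/accessible_closed_set1/hausdorff_accessible.
exact: norm_hausdorff.
Unshelve. all: by end_near. Qed.

Definition sqr_norm h : R :=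
  \int[mu]_(t in `[0%R, (2 * pi)%R]) (normc (h (param r t)) ^+ 2 * normc (dparam r t)).

Let cnorm h : ccontinuous (fun t => h (param r t)) ->
  continuous (fun t => normc (h (param r t)) ^+ 2 * normc (dparam r t)).
Proof.
move=> ch t; under eq_fun do rewrite sqr_normcRe.
by apply: cvgM; [exact: continuous_sqr_normc|exact: continuous_normc].
Qed.

Lemma L2norm_sqr_norm h : ccontinuous (fun t => h (param r t)) ->
  L2norm r h = (Num.sqrt (sqr_norm h))%:E.
Proof.
move=> ch; rewrite /L2norm /sqr_norm /Rintegral.
rewrite -{1}(@fineK _ (\int[mu]_(t in _) _)%E)//.
by apply: integrable_fin_num => //; exact/integrable_continuous/cnorm.
Qed.

Lemma inL2_ccontinuous h : ccontinuous (fun t => h (param r t)) -> inL2 r h.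
Proof.
move=> ch; have [ch1 ch2] := ch; split; last by rewrite L2norm_sqr_norm// ltry.
- by apply: measurable_funTS; exact: continuous_measurable_fun.
- by apply: measurable_funTS; exact: continuous_measurable_fun.
Qed.

Lemma cauchy_boundary_test (exterior : bool) P beta :
  cauchy_boundary r exterior (test_fun P beta) (test_part exterior P beta).
Proof.
split.
- exact/inL2_ccontinuous/ccontinuous_test.
- by rewrite /test_part; case: exterior; exact/inL2_ccontinuous/ccontinuous_test.
- by apply: aeW => t _; exact: nontangential_limit_test.
Qed.

Lemma sqr_norm_ge0 h : 0 <= sqr_norm h.
Proof.
by apply: Rintegral_ge0 => t _; rewrite mulr_ge0 ?sqr_ge0 ?normc_ge0.
Qed.

Lemma normc_dparam_ge1 t : 1 <= normc (dparam r t).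
Proof.
rewrite -(@ler_pXn2r _ 2)// ?nnegrE ?normc_ge0// sqr_normcRe /= expr1n sqrrN.
rewrite -(cos2Dsin2 t) addrC lerD2r exprMn ler_peMl ?sqr_ge0//.
by rewrite expr_ge1// ltW// (lt_trans ltr01).
Qed.

Lemma sqr_norm_gt0 h (m : R) : 0 < m -> ccontinuous (fun t => h (param r t)) ->
  (forall t, m <= normc (h (param r t))) -> 0 < sqr_norm h.
Proof.
move=> m0 ch mh; apply: (@lt_le_trans _ _ (m ^+ 2 * (2 * pi))).
  by rewrite mulr_gt0 ?exprn_gt0.
have -> : m ^+ 2 * (2 * pi) = \int[mu]_(t in `[0, (2 * pi)%R]) (cst (m ^+ 2) t).
  by rewrite Rintegral_cst//= lebesgue_measure_itv/= lte_fin pi2 -EFinD/= subr0.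
apply: le_Rintegral => //.
- by apply: integrable_continuous; exact: cst_continuous.
- by apply: integrable_continuous; exact: cnorm.
- move=> t _ /=; rewrite -[leLHS]mulr1 ler_pM ?sqr_ge0 ?normc_dparam_ge1//.
  by rewrite ler_pXn2r ?nnegrE ?normc_ge0 ?(ltW m0)//.
Qed.

Lemma sqr_normZ (l : R) h : ccontinuous (fun t => h (param r t)) ->
  sqr_norm (fun z => l%:C * h z) = l ^+ 2 * sqr_norm h.
Proof.
move=> ch; rewrite -RintegralZl//; last exact/integrable_continuous/cnorm.
apply: eq_Rintegral => t _; rewrite normcM normcR exprMn real_normK ?num_real//. exact/esym/mulrA.
Qed.

Lemma test_funZ w P beta : test_fun (w *: P) (w * beta) = fun z => w * test_fun P beta z.
Proof. by apply/funext => z; rewrite /test_fun hornerZ mulrDr mulrA. Qed.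

(** The test function is rescaled to norm at most 1; if its norm vanishes, the
scaling factor comes from the norm of its image. *)
Lemma opnorm_ge (exterior : bool) P beta (s : R) : 0 <= s ->
  0 < sqr_norm (test_part exterior P beta) ->
  s ^+ 2 * sqr_norm (test_fun P beta) <= sqr_norm (test_part exterior P beta) ->
  (s%:E <= cauchy_opnorm r exterior)%E.
Proof.
set g := test_part exterior P beta; set h := test_fun P beta => s0 g0 shg.
have cg : ccontinuous (fun t => g (param r t)).
  by rewrite /g /test_part; case: exterior {g g0 shg}; exact: ccontinuous_test.
have [l [lh lg]] : exists l : R, l ^+ 2 * sqr_norm h <= 1 /\ s ^+ 2 <= l ^+ 2 * sqr_norm g.
  have := sqr_norm_ge0 h; rewrite le_eqVlt => /predU1P[h0|h0].
    exists (s / Num.sqrt (sqr_norm g)); rewrite -h0 mulr0 ler01; split => //.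
    by rewrite expr_div_n sqr_sqrtr ?(ltW g0)// divfK// gt_eqF.
  exists (Num.sqrt (sqr_norm h))^-1; rewrite exprVn sqr_sqrtr ?(ltW h0)//.
  by rewrite mulVf ?gt_eqF//; split => //; rewrite mulrC ler_pdivlMr.
have gE : test_part exterior (l%:C *: P) (l%:C * beta) = fun z => l%:C * g z.
  rewrite /g /test_part; case: exterior {g g0 shg cg lg} => /=.
    by rewrite -[X in test_fun X _](scaler0 _ l%:C) test_funZ.
  by rewrite -[X in test_fun _ X](mulr0 l%:C) test_funZ.
apply: (@le_trans _ _ (L2norm r (fun z => l%:C * g z))).
  rewrite L2norm_sqr_norm; last by apply: ccontinuousM => //; exact: ccontinuous_cst.
  rewrite lee_fin sqr_normZ// -{1}(ger0_norm s0) -sqrtr_sqr.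
  by rewrite ler_sqrt// mulr_ge0 ?sqr_ge0// sqr_norm_ge0.
apply: ereal_sup_ubound; exists (fun z => l%:C * g z) => //=.
exists (test_fun (l%:C *: P) (l%:C * beta)).
  by rewrite -gE; exact: cauchy_boundary_test.
rewrite L2norm_sqr_norm; last exact: ccontinuous_test.
rewrite test_funZ sqr_normZ; last exact: ccontinuous_test.
by rewrite lee_fin -[leRHS]sqrtr1 ler_sqrt.
Qed.

Lemma sqr_norm_test_expand P beta : exists c : R, forall l : R,
  sqr_norm (test_fun P (l%:C * beta)) =
  sqr_norm (test_fun P 0) + l * (2 * c) + l ^+ 2 * sqr_norm (test_fun 0 beta).
Proof.
pose u t := test_fun P 0 (param r t); pose v t := test_fun 0 beta (param r t).
have cu : ccontinuous u by exact: ccontinuous_test.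
have cv : ccontinuous v by exact: ccontinuous_test.
have [cu1 cu2] := cu; have [cv1 cv2] := cv.
pose k t := (Re (u t) * Re (v t) + Im (u t) * Im (v t)) * normc (dparam r t).
have ck : continuous k.
  move=> t; apply: cvgM; last exact: continuous_normc.
  by apply: cvgD; apply: cvgM; [exact: cu1|exact: cv1|exact: cu2|exact: cv2].
have cst_mul (w : R) (f : R -> R) : continuous f -> continuous (fun t => w * f t).
  by move=> cf t; apply: cvgM; [exact: cvg_cst|exact: cf].
exists (\int[mu]_(t in `[0%R, (2 * pi)%R]) k t) => l.
have iu := integrable_continuous 0 (2 * pi) (cnorm cu).
have iv := integrable_continuous 0 (2 * pi) (cnorm cv).
have ik := integrable_continuous 0 (2 * pi) ck.
rewrite mulrA -!RintegralZl// -!RintegralD//.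
- apply: eq_Rintegral => t _.
  have -> : test_fun P (l%:C * beta) (param r t) = u t + l%:C * v t.
    by rewrite /u /v /test_fun horner0 mul0r addr0 add0r mulrA.
  rewrite -/(u t) -/(v t) !sqr_normcRe Re_add Im_add Re_mul Im_mul /k; move: (normc _) => d /=; ring.
- apply: integrable_continuous => t; apply: cvgD; first exact: (cnorm cu).
  exact: cst_mul.
- by apply: integrable_continuous; apply: cst_mul; exact: (cnorm cv).
- by apply: integrable_continuous; apply: cst_mul.
Qed.

(** For u = P and v = beta / z, the exterior transform sends u + v to v.  In
the plane spanned by u and v the two complementary projections have the same norm:
the interior transform sends u - c v to u, and for the best c the ratio of the
norms is the one between v and the distance of v to the line of u. *)
Lemma opnorm_ge_ratio (exterior : bool) P beta (s : R) : 0 <= s ->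
  0 < sqr_norm (test_fun 0 beta) ->
  s ^+ 2 * sqr_norm (test_fun P beta) <= sqr_norm (test_fun 0 beta) ->
  (s%:E <= cauchy_opnorm r exterior)%E.
Proof.
move=> s0 v0 sv; case: exterior; first exact: (@opnorm_ge true P beta).
have [c cE] := sqr_norm_test_expand P beta.
have := cE 1; rewrite !mul1r expr1n mul1r => hE; rewrite hE in sv.
have := sqr_norm_ge0 (test_fun P 0); rewrite le_eqVlt => /predU1P[u0|u0].
  (* The polynomial part vanishes almost everywhere, so that the bound is at
     most 1 and is attained by the constant functions. *)
  have c0 : c = 0.
    have := cE (- c / sqr_norm (test_fun 0 beta)); rewrite -u0 add0r => E.
    have := sqr_norm_ge0 (test_fun P ((- c / sqr_norm (test_fun 0 beta))%:C * beta)).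
    rewrite E; have -> : - c / sqr_norm (test_fun 0 beta) * (2 * c) +
      (- c / sqr_norm (test_fun 0 beta)) ^+ 2 * sqr_norm (test_fun 0 beta) =
      - (c ^+ 2 / sqr_norm (test_fun 0 beta)) by field; rewrite gt_eqF.
    rewrite oppr_ge0 pmulr_lle0 ?invr_gt0// => c2.
    by apply/eqP; rewrite -sqrf_eq0 eq_le c2 sqr_ge0.
  have s1 : s ^+ 2 <= 1.
    by move: sv; rewrite -u0 c0 mulr0 !add0r ger_pMl.
  have n1 : 0 < sqr_norm (test_fun 1 0).
    apply: (@sqr_norm_gt0 _ 1 ltr01); first exact: ccontinuous_test.
    by move=> t; rewrite /test_fun hornerC mul0r addr0 normc1.
  by apply: (@opnorm_ge false 1 0) => //=; rewrite ger_pMl.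
(* c is the real inner product of u and v; u - (c / |v|^2) v is orthogonal to v. *)
apply: (@opnorm_ge false P ((- (c / sqr_norm (test_fun 0 beta)))%:C * beta)) => //=.
rewrite cE; move: (sqr_norm (test_fun P 0)) (sqr_norm (test_fun 0 beta)) v0 u0 sv.
move=> A B B0 A0 sv.
have -> : A + - (c / B) * (2 * c) + (- (c / B)) ^+ 2 * B = (A * B - c ^+ 2) / B.
  by field; rewrite gt_eqF.
rewrite mulrA ler_pdivrMr//.
have : s ^+ 2 * (A * B - c ^+ 2) / A <= B.
  apply: le_trans sv; rewrite -mulrA ler_wpM2l ?sqr_ge0// ler_pdivrMr//.
  rewrite -subr_ge0.
  have -> : (A + 2 * c + B) * A - (A * B - c ^+ 2) = (A + c) ^+ 2 by ring.
  exact: sqr_ge0.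
by rewrite ler_pdivrMr// [B * A]mulrC.
Qed.

End TestFunctions.

(** * Residues for products of cotangents *)

Section ThetaQuotient.
Variable R : realType.
Local Notation mu := (@lebesgue_measure R).
Local Notation Re := (@complex.Re R).
Local Notation Im := (@complex.Im R).
Implicit Types (t p w s x : R) (S : seq R).

(** In the variable y = e^{2it} this is, up to constants, a cotangent with its
pole at y = p. *)
Definition kap p t : R[i] := (expi 2 t + p%:C) / (expi 2 t - p%:C).

Lemma kap_den_neq0 p t : `|p| != 1 -> expi 2 t - p%:C != 0.
Proof. by move=> p1; apply: expi_sub_neq0; rewrite normcR. Qed.

Lemma kapE p t : `|p| != 1 ->
  kap p t = 2 * (expi 2 t / (expi 2 t - p%:C)) - 1.
Proof. by move=> p1; have d := kap_den_neq0 t p1; rewrite /kap; field. Qed.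

Lemma ccontinuous_kap p : `|p| != 1 -> ccontinuous (kap p).
Proof.
move=> p1; rewrite (funext (fun t => kapE t p1)).
apply: ccontinuousB; last exact: ccontinuous_cst.
apply: ccontinuousM; first exact: ccontinuous_cst.
by apply: ccontinuous_kernel; rewrite normcR.
Qed.

Lemma cint_kap p : `|p| != 1 ->
  cint (kap p) = if `|p| < 1 then (2 * pi)%:C else - (2 * pi)%:C.
Proof.
move=> p1; have cK : ccontinuous (fun t => expi 2 t / (expi 2 t - p%:C)).
  by apply: ccontinuous_kernel; rewrite normcR.
rewrite (funext (fun t => kapE t p1)) cintB; last 2 first.
- by apply: ccontinuousM => //; exact: ccontinuous_cst.
- exact: ccontinuous_cst.
rewrite cintZ// cint_cst mulr1; case: ltP => p1'.
  by rewrite cint_kernel_in ?normcR//; ring.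
rewrite cint_kernel_out ?normcR//; last by rewrite lt_neqAle eq_sym p1.
by rewrite mulr0 sub0r.
Qed.

(** The addition theorem of the cotangent, in multiplicative form. *)
Lemma kap_mul p w t : p != w -> `|p| != 1 -> `|w| != 1 ->
  kap w t * kap p t = 1 + ((w + p) / (w - p))%:C * (kap w t - kap p t).
Proof.
move=> pw p1 w1; have dp := kap_den_neq0 t p1; have dw := kap_den_neq0 t w1.
have pwC : w%:C - p%:C != 0 :> R[i].
  by rewrite -rmorphB real_complex_eq0 subr_eq0 eq_sym.
rewrite rmorphM fmorphV rmorphB rmorphD /kap /=; field.
by rewrite pwC dw dp.
Qed.

Definition kaps S t := \prod_(p <- S) kap p t.

Lemma kaps_nil : kaps [::] = fun=> 1.
Proof. by apply/funext => t; rewrite /kaps big_nil. Qed.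

Lemma kaps_cons p S : kaps (p :: S) = fun t => kap p t * kaps S t.
Proof. by apply/funext => t; rewrite /kaps big_cons. Qed.

Lemma ccontinuous_kaps S : all (fun p => `|p| != 1) S -> ccontinuous (kaps S).
Proof.
elim: S => [|p S IH] /=; first by rewrite kaps_nil => _; exact: ccontinuous_cst.
move=> /andP[p1 /IH cS]; rewrite kaps_cons.
exact: ccontinuousM (ccontinuous_kap p1) cS.
Qed.

Variables (sig : R) (sig0 : 0 < sig) (sig1 : sig < 1).

(** Replacing p by p / sig amounts to taking the mean on the circle |y| = sig. *)
Definition circle_diff S := cint (kaps S) - cint (kaps [seq p / sig | p <- S]).

Definition outside p := (1 < `|p|) || (`|p| < sig).
Definition inside p := sig < `|p| < 1.

Let nsig p : `|p / sig| = `|p| / sig.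
Proof. by rewrite normrM normfV (gtr0_norm sig0). Qed.

Lemma off_circles p : outside p || inside p -> (`|p| != 1) && (`|p / sig| != 1).
Proof.
rewrite nsig !neq_lt ltr_pdivrMr// ltr_pdivlMr// !mul1r.
rewrite /outside /inside => /orP[/orP[h|h]|/andP[h1 h2]].
- by rewrite h (lt_trans sig1 h) !orbT.
- by rewrite h (lt_trans h sig1).
- by rewrite h1 h2 orbT.
Qed.

Lemma circle_diff_cons2 p w S : p != w ->
  all (fun u => outside u || inside u) [:: w, p & S] ->
  circle_diff [:: w, p & S] = circle_diff S + ((w + p) / (w - p))%:C *
    (circle_diff (w :: S) - circle_diff (p :: S)).
Proof.
move=> pw /= /and3P[ow op oS].
have red v u S' : u != v -> `|u| != 1 -> `|v| != 1 -> all (fun p => `|p| != 1) S' ->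
    cint (kaps [:: v, u & S']) = cint (kaps S') + ((v + u) / (v - u))%:C *
    (cint (kaps (v :: S')) - cint (kaps (u :: S'))).
  move=> uv u1 v1 S1; have cS := ccontinuous_kaps S1.
  have cc z : `|z| != 1 -> ccontinuous (kaps (z :: S')).
    by move=> z1; apply: ccontinuous_kaps; rewrite /= z1.
  rewrite -cintB; [|exact: cc|exact: cc].
  rewrite -cintZ; last by apply: ccontinuousB; exact: cc.
  rewrite -cintD//; last first.
    by apply: ccontinuousM; [exact: ccontinuous_cst|apply: ccontinuousB; exact: cc].
  congr cint; apply/funext => t; rewrite !kaps_cons mulrA kap_mul//; ring.
have [w1 w2] := andP (off_circles ow); have [p1 p2] := andP (off_circles op).
have S1 : all (fun p => `|p| != 1) S.
  by apply: sub_all oS => u /off_circles /andP[].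
have S2 : all (fun p => `|p| != 1) [seq p / sig | p <- S].
  by rewrite all_map; apply: sub_all oS => u /off_circles /andP[].
have sigV : sig^-1 != 0 by rewrite invr_eq0 gt_eqF.
have -> : (w + p) / (w - p) = (w / sig + p / sig) / (w / sig - p / sig).
  by rewrite -mulrDl -mulrBl -mulf_div divff// mulr1.
rewrite /circle_diff /= (red w p)// (red (w / sig) (p / sig))//; last first.
  by rewrite (inj_eq (mulIf sigV)).
have -> : (w + p) / (w - p) = (w / sig + p / sig) / (w / sig - p / sig).
  by rewrite -mulrDl -mulrBl -mulf_div divff// mulr1.
ring.
Qed.

(** The addition theorem lowers the number of factors until each mean is known. *)
Lemma circle_diff_outside S : uniq S -> all outside S -> circle_diff S = 0.
Proof.
have [n] := ubnP (size S); elim: n S => // n IH [|w [|p S]] sz.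
- by move=> _ _; rewrite /circle_diff /= kaps_nil subrr.
- rewrite /= => _ /andP[ow _].
  have [w1 w2] := andP (off_circles (introT orP (or_introl ow))).
  have E u : kaps [:: u] = kap u by apply/funext => t; rewrite /kaps big_seq1.
  rewrite /circle_diff /= !E !cint_kap// nsig ltr_pdivrMr// mul1r.
  case/orP: ow => ow.
    by rewrite !ltNge (ltW ow) (ltW (lt_trans sig1 ow)) /= subrr.
  by rewrite ow (lt_trans ow sig1) subrr.
- move=> uS oS; have [wpS pS uS'] : [/\ w \notin p :: S, p \notin S & uniq S].
    by move: uS => /= /and3P[].
  move: (oS) => /= /and3P[ow op oS'].
  rewrite circle_diff_cons2//.
  + have wS : w \notin S by move: wpS; rewrite inE negb_or => /andP[].
    rewrite (IH S)//; last exact: ltn_trans (ltnSn _) (ltnSE sz).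
    rewrite (IH (w :: S) (ltnSE sz)) /= ?wS ?ow//.
    by rewrite (IH (p :: S) (ltnSE sz)) /= ?pS ?op// subrr mulr0 addr0.
  + by move: wpS; rewrite inE negb_or eq_sym => /andP[].
  + by apply: sub_all oS => u ->.
Qed.

(** The residue theorem in the annulus, for a product with exactly one pole w
in it. *)
Lemma circle_diff_inside w S : inside w -> uniq S -> all outside S ->
  circle_diff (w :: S) = (4 * pi)%:C * \prod_(p <- S) ((w + p) / (w - p))%:C.
Proof.
move=> iw; have ow' : outside w || inside w by rewrite iw orbT.
have ne p : outside p -> p != w.
  move=> op; apply/eqP => pw; move: op iw; rewrite /outside /inside pw.
  by move=> /orP[h /andP[_ /(lt_trans h)]|h /andP[/(lt_trans h)]]; rewrite ltxx.
elim: S => [|p S IH] /= => [_ _|/andP[pS uS] /andP[op oS]].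
  have [w1 w2] := andP (off_circles ow').
  have E u : kaps [:: u] = kap u by apply/funext => t; rewrite /kaps big_seq1.
  rewrite big_nil mulr1 /circle_diff /= !E !cint_kap// nsig ltr_pdivrMr// mul1r.
  case/andP: iw => i1 i2; rewrite i2 ltNge (ltW i1) /= opprK -rmorphD /=.
  by congr (_%:C); ring.
rewrite circle_diff_cons2 ?ne//; last first.
  by rewrite /= ow' op /=; apply: sub_all oS => u ->.
rewrite IH// (circle_diff_outside uS oS) (@circle_diff_outside (p :: S)) /= ?pS ?op//.
by rewrite big_cons subr0 add0r; ring.
Qed.

End ThetaQuotient.

(** * The mean of a theta quotient *)

Section ThetaQuotientMean.
Variable R : realType.
Local Notation mu := (@lebesgue_measure R).
Local Notation Re := (@complex.Re R).
Local Notation Im := (@complex.Im R).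
Implicit Types (t p w s : R) (S : seq R).

Lemma sqr_normc_conj (z : R[i]) : (normc z ^+ 2)%:C = z * z^*%C.
Proof.
rewrite sqr_normcRe; apply/eqP; rewrite eq_complex Re_mul Im_mul.
by case: z => a b /=; apply/andP; split; apply/eqP; ring.
Qed.

Definition gquot s t : R :=
  normc (1 - s%:C * expi 2 t) ^+ 2 / normc (1 + s%:C * expi 2 t) ^+ 2.

Lemma one_add_neq0 s t : `|s| < 1 -> 1 + s%:C * expi 2 t != 0.
Proof.
move=> s1; rewrite -[s%:C]opprK mulNr; apply: one_sub_expi_neq0.
by rewrite normcN normcR.
Qed.

Lemma conj_one_add s t :
  (1 + s%:C * expi 2 t)^*%C = 1 + s%:C / expi 2 t.
Proof.
rewrite -expiN /expi; apply/eqP; rewrite eq_complex /= rmorphN /= !mulNr cosN sinN.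
by apply/andP; split; apply/eqP; ring.
Qed.

Lemma gquot_ge0 s t : 0 <= gquot s t.
Proof. by rewrite divr_ge0 ?sqr_ge0. Qed.

Lemma continuous_gquot s : `|s| < 1 -> continuous (gquot s).
Proof.
move=> s1.
have cE (u : R) : ccontinuous (fun t => 1 + u%:C * expi 2 t).
  apply: ccontinuousD; first exact: ccontinuous_cst.
  by apply: ccontinuousM; [exact: ccontinuous_cst|exact: ccontinuous_expi].
have cN t : {for t, continuous (fun t => normc (1 - s%:C * expi 2 t) ^+ 2)}.
  have -> : (fun t => normc (1 - s%:C * expi 2 t) ^+ 2) =
      (fun t => Re (1 + (- s)%:C * expi 2 t) ^+ 2 + Im (1 + (- s)%:C * expi 2 t) ^+ 2).
    by apply/funext => u; rewrite sqr_normcRe rmorphN mulNr.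
  exact: continuous_sqr_normc (cE _) t.
move=> t; apply: cvgM; first exact: cN.
apply: cvgV.
  by rewrite expf_neq0// normc_eq0 one_add_neq0.
under eq_fun do rewrite sqr_normcRe; rewrite sqr_normcRe.
exact: continuous_sqr_normc (cE _) t.
Qed.

(** A pair of poles that are symmetric in the unit circle gives a real function. *)
Lemma kap_pair s t : 0 < s < 1 ->
  kap (- s) t * kap (- s^-1) t = - (gquot s t)%:C.
Proof.
move=> /andP[s0 s1]; have as1 : `|s| < 1 by rewrite gtr0_norm.
have sC : s%:C != 0 :> R[i] by rewrite real_complex_eq0 gt_eqF.
have -> : (gquot s t)%:C = (1 - s%:C * expi 2 t) * (1 - s%:C / expi 2 t) /
    ((1 + s%:C * expi 2 t) * (1 + s%:C / expi 2 t)).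
  have -> : 1 - s%:C / expi 2 t = (1 - s%:C * expi 2 t)^*%C.
    by rewrite -!mulNr -rmorphN conj_one_add.
  have -> : 1 + s%:C / expi 2 t = (1 + s%:C * expi 2 t)^*%C.
    by rewrite conj_one_add.
  by rewrite -!sqr_normc_conj -fmorphV -rmorphM.
have d1 := one_add_neq0 t as1.
have d2 : expi 2 t + s%:C != 0.
  have -> : expi 2 t + s%:C = expi 2 t * (1 + s%:C * expi 2 t)^*%C.
    rewrite conj_one_add mulrDr mulr1.
    by rewrite mulrCA divff ?mulr1// expi_neq0.
  by rewrite mulf_neq0 ?expi_neq0// conjc_eq0.
rewrite /kap !real_complexN !opprK real_complexV.
move: (expi 2 t) (expi_neq0 2 t) d1 d2 sC => y y0; move: (s%:C) => u d1 d2 u0.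
by field; rewrite y0 d2 d1 u0.
Qed.

Variables (x : R) (x0 : 0 < x) (x1 : x < 1).

Definition odd_pow m : R := x ^+ m.*2.+1.

Lemma odd_pow_gt0 m : 0 < odd_pow m. Proof. exact: exprn_gt0. Qed.

Lemma odd_pow_lt1 m : odd_pow m < 1.
Proof. by rewrite exprn_ilt1// ltW. Qed.

Let spos m : 0 < odd_pow m < 1.
Proof. by rewrite odd_pow_gt0 odd_pow_lt1. Qed.

(** The quotient theta_4 (t) / theta_3 (t) with nome x, its products truncated. *)
Definition theta_quot M t := \prod_(m < M) gquot (odd_pow m) t.

Lemma theta_quot_ge0 M t : 0 <= theta_quot M t.
Proof. by apply: prodr_ge0 => m _; exact: gquot_ge0. Qed.

Lemma continuous_theta_quot M : continuous (theta_quot M).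
Proof.
elim: M => [|M IH].
  have -> : theta_quot 0 = fun=> 1 by apply/funext => t; rewrite /theta_quot big_ord0.
  exact: cst_continuous.
have -> : theta_quot M.+1 = fun t => theta_quot M t * gquot (odd_pow M) t.
  by apply/funext => t; rewrite /theta_quot big_ord_recr.
move=> t; apply: cvgM; first exact: IH.
by apply: continuous_gquot; rewrite gtr0_norm ?odd_pow_gt0 ?odd_pow_lt1.
Qed.

Definition poles M :=
  [seq - odd_pow m | m <- iota 0 M] ++ [seq - (odd_pow m)^-1 | m <- iota 0 M].

Lemma kaps_poles M t : kaps (poles M) t = (-1) ^+ M * (theta_quot M t)%:C.
Proof.
rewrite /kaps /poles big_cat !big_map /= -big_split /= -[M in iota 0 M]subn0.
rewrite -/(index_iota 0 M) big_mkord /theta_quot.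
elim: M => [|M IH]; first by rewrite !big_ord0 mul1r.
rewrite !big_ord_recr /= IH kap_pair ?spos// (real_complexM _ (gquot _ _)) exprS; ring.
Qed.

(** The list of poles and its rescaling differ in one element at each end. *)
Lemma kaps_poles_rescaled M t :
  kaps [seq p / x ^+ 2 | p <- poles M] t * kap (- (odd_pow M / x ^+ 2)) t =
  kaps (poles M) t * kap (- (odd_pow M)^-1) t.
Proof.
have x2 : x ^+ 2 != 0 by rewrite expf_neq0// gt_eqF.
have sS m : odd_pow m.+1 / x ^+ 2 = odd_pow m.
  by rewrite /odd_pow doubleS -(addn2 m.*2.+1) exprD mulfK.
have sV m : - (odd_pow m)^-1 / x ^+ 2 = - (odd_pow m.+1)^-1.
  by rewrite -(sS m) mulNr invfM invrK mulfK.
rewrite /kaps /poles map_cat -!map_comp !big_cat !big_map /= -!big_split /=.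
rewrite -[M in iota 0 M]subn0 -/(index_iota 0 M) !big_mkord.
elim: M => [|M IH].
  rewrite !big_ord0 !mul1r /odd_pow expr1 expr2 invfM mulrA divff ?mul1r//.
  by rewrite gt_eqF.
rewrite !big_ord_recr /= sV mulNr sS.
transitivity (\prod_(m < M) (kap (- odd_pow m / x ^+ 2) t *
    kap (- (odd_pow m)^-1 / x ^+ 2) t) * kap (- (odd_pow M / x ^+ 2)) t *
    (kap (- (odd_pow M.+1)^-1) t * kap (- odd_pow M) t)); first by ring.
by rewrite IH; ring.
Qed.

Let sig0 : 0 < x ^+ 2. Proof. exact: exprn_gt0. Qed.
Let sig1 : x ^+ 2 < 1. Proof. by rewrite exprn_ilt1// ltW. Qed.

Let odd_pow_lt m n : (m < n)%N -> odd_pow n < odd_pow m.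
Proof. by move=> mn; rewrite ltr_iXn2l//  !ltnS ltn_double. Qed.

Let odd_pow_inj : injective odd_pow.
Proof.
by move=> m n E; case: (ltngtP m n) => // /odd_pow_lt; rewrite E ltxx.
Qed.

Definition trunc_err M : R :=
  2 * (odd_pow M.+1 + odd_pow M) / ((1 - odd_pow M.+1) * (1 - odd_pow M)).

Definition euler_quot M : R :=
  \prod_(m < M) ((1 + x ^+ m.+1.*2) / (1 - x ^+ m.+1.*2)).

(** Only the truncation prevents the theta quotient from changing sign under
y |-> x^2 y; the factor e collects the two unmatched poles. *)
Lemma edge_quotient M t : exists e : R[i],
  kaps [seq p / x ^+ 2 | p <- poles M.+1] t = - (kaps (poles M.+1) t * e) /\
  `|1 - Re e| <= trunc_err M.
Proof.
have tauE : odd_pow M.+1 / x ^+ 2 = odd_pow M.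
  by rewrite /odd_pow doubleS -(addn2 M.*2.+1) exprD mulfK// expf_neq0// gt_eqF.
have := kaps_poles_rescaled M.+1 t; rewrite tauE.
have := odd_pow_gt0 M.+1; have := odd_pow_lt1 M.+1.
have := odd_pow_gt0 M; have := odd_pow_lt1 M; rewrite /trunc_err {tauE}.
move: (odd_pow M) (odd_pow M.+1) => tau s tau1 tau0 s1 s0 H.
have sC : s%:C != 0 :> R[i] by rewrite real_complex_eq0 gt_eqF.
have cN (u v : R[i]) : normc v < normc u -> u - v != 0.
  by move=> uv; rewrite subr_eq0; apply/eqP => E; rewrite E ltxx in uv.
have nexp := normc_expi 2 t; have y0 := expi_neq0 2 t.
move: H; rewrite /kap !real_complexN !opprK real_complexV.
move: (expi 2 t) nexp y0 => y ny y0.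
have nt : normc (tau%:C) = tau by rewrite normcR gtr0_norm.
have ns : normc (s%:C) = s by rewrite normcR gtr0_norm.
have d1 : 1 + s%:C * y != 0.
  by rewrite -[s%:C * y]opprK cN// normc1 normcN normcM ns ny mulr1.
have d2 : y - tau%:C != 0 by rewrite cN// nt ny.
have d3 : y + tau%:C != 0 by rewrite -[tau%:C]opprK cN// normcN nt ny.
have d4 : y + (s%:C)^-1 != 0.
  have -> : y + (s%:C)^-1 = (s%:C)^-1 * (1 + s%:C * y) by field.
  by rewrite mulf_neq0// invr_eq0.
move=> H; exists ((1 - s%:C * y) * (y + tau%:C) / ((1 + s%:C * y) * (y - tau%:C))).
split.
  have d5 : (y - tau%:C) / (y + tau%:C) != 0 by rewrite mulf_neq0// invr_eq0.
  apply: (mulIf d5); rewrite H; field.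
  by rewrite d3 d2 d1 sC.
set e := _ / _; have -> : 1 - Re e = Re (1 - e) by rewrite Re_add Re_opp.
apply: le_trans (Re_le_normc _) _.
have -> : 1 - e = 2 * (s%:C * (y * y) - tau%:C) / ((1 + s%:C * y) * (y - tau%:C)).
  by rewrite /e; field; rewrite d2 d1.
have n2 : normc (2 : R[i]) = 2 by rewrite normcRe /= !addr0 expr0n addr0 sqrtr_sqr ger0_norm.
rewrite normcM normcV !normcM n2 -!mulrA ler_pM2l//.
have h1 : normc (s%:C * (y * y) - tau%:C) <= s + tau.
  by apply: le_trans (le_normcD _ _) _; rewrite normcN nt !normcM ns ny !mulr1.
have h2 : 1 - s <= normc (1 + s%:C * y).
  rewrite -[s%:C * y]opprK; apply: le_trans (le_normc_sub _ _).
  by rewrite normc1 normcN normcM ns ny mulr1.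
have h3 : 1 - tau <= normc (y - tau%:C).
  by apply: le_trans (le_normc_sub _ _); rewrite nt ny.
apply: ler_pM; rewrite ?normc_ge0 ?invr_ge0 ?mulr_ge0 ?normc_ge0//.
rewrite lef_pV2 ?posrE ?mulr_gt0 ?normc_gt0 ?subr_gt0//.
by apply: ler_pM => //; rewrite subr_ge0 ltW.
Qed.

Lemma prod_poles M :
  \prod_(m <- iota 1 M) ((- x - odd_pow m) / (- x - - odd_pow m))%:C *
  \prod_(m <- iota 0 M.+1)
     ((- x - (odd_pow m)^-1) / (- x - - (odd_pow m)^-1))%:C =
  (-1) ^+ M.+1 * (euler_quot M * euler_quot M.+1)%:C :> R[i].
Proof.
have pow_ne m : 1 - x ^+ m.+1.*2 != 0.
  by rewrite gt_eqF// subr_gt0 exprn_ilt1// ltW.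
have xn0 : x != 0 by rewrite gt_eqF.
rewrite real_complexM mulrCA; congr (_ * _).
  have -> : iota 1 M = index_iota 1 M.+1 by rewrite /index_iota subSS subn0.
  rewrite big_add1 big_mkord.
  rewrite /euler_quot (big_morph (fun u : R => u%:C) (@real_complexM R) (erefl _)).
  apply: eq_bigr => m _; congr (_%:C); have := pow_ne m.
  rewrite /odd_pow exprS; move: (x ^+ _) => u u1; field.
  have -> : - x - - (x * u) = - (x * (1 - u)) by ring.
  by rewrite u1 oppr_eq0 mulf_neq0.
have -> : iota 0 M.+1 = index_iota 0 M.+1 by rewrite /index_iota subn0.
rewrite big_mkord.
rewrite /euler_quot; elim: M.+1 => [|n IH]; first by rewrite !big_ord0 mulr1.
rewrite !big_ord_recr /= IH exprS.
have -> : (- x - (odd_pow n)^-1) / (- x - - (odd_pow n)^-1) =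
    - ((1 + x ^+ n.+1.*2) / (1 - x ^+ n.+1.*2)).
  have := pow_ne n; have := odd_pow_gt0 n.
  have -> : x ^+ n.+1.*2 = x * odd_pow n by rewrite doubleS exprS.
  move: (odd_pow n) => u u0 u1; field.
  by rewrite u1 gt_eqF.
rewrite real_complexN real_complexM (real_complexM (\prod_(i < n) _)); ring.
Qed.

(** Since the full quotient changes sign under y |-> x^2 y, twice its mean is the
residue at y = - x.  For the truncated one, the factor 2 becomes
2 - trunc_err M; nonnegativity of the quotient is what allows to compare. *)
Lemma theta_quot_mean M :
  (2 - trunc_err M) *
    \int[mu]_(t in `[0%R, (2 * pi)%R]) theta_quot M.+1 t <=
  4 * pi * (euler_quot M * euler_quot M.+1).
Proof.
pose S := [seq - odd_pow m | m <- iota 1 M] ++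
          [seq - (odd_pow m)^-1 | m <- iota 0 M.+1].
have SE : poles M.+1 = - x :: S by [].
have nS m : `|- odd_pow m| = odd_pow m by rewrite normrN gtr0_norm ?odd_pow_gt0.
have nV m : `|- (odd_pow m)^-1| = (odd_pow m)^-1.
  by rewrite normrN gtr0_norm ?invr_gt0 ?odd_pow_gt0.
have uS : uniq S.
  rewrite cat_uniq; apply/and3P; split.
  - by rewrite map_inj_uniq ?iota_uniq// => m n /oppr_inj /odd_pow_inj.
  - apply/hasPn => _ /mapP[m _ ->]; apply/mapP => -[n _ E].
    have : 1 < `|- (odd_pow m)^-1| by rewrite nV invf_gt1 ?odd_pow_gt0 ?odd_pow_lt1.
    by rewrite E nS ltNge (ltW (odd_pow_lt1 n)).
  - by rewrite map_inj_uniq ?iota_uniq// => m n /oppr_inj /invr_inj /odd_pow_inj.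
have oS : all (outside (x ^+ 2)) S.
  rewrite all_cat !all_map; apply/andP; split; apply/allP => m mI /=.
    rewrite /outside nS; apply/orP; right; rewrite ltr_iXn2l//.
    by move: mI; rewrite mem_iota; case: m => // m _; rewrite doubleS.
  by rewrite /outside nV invf_gt1 ?odd_pow_gt0 ?odd_pow_lt1.
have iw : inside (x ^+ 2) (- x).
  by rewrite /inside normrN gtr0_norm// x1 andbT -[ltRHS]expr1 ltr_iXn2l.
have cK : ccontinuous (kaps (poles M.+1)).
  apply: ccontinuous_kaps; rewrite SE /=; apply/andP; split.
    by rewrite normrN gtr0_norm// lt_eqF.
  by apply: sub_all oS => u ou; case/andP: (off_circles sig0 sig1 (introT orP (or_introl ou))).
have cK' : ccontinuous (kaps [seq p / x ^+ 2 | p <- poles M.+1]).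
  apply: ccontinuous_kaps; rewrite SE /= all_map; apply/andP; split.
    by case/andP: (off_circles sig0 sig1 (introT orP (or_intror iw))).
  by apply: sub_all oS => u ou; case/andP: (off_circles sig0 sig1 (introT orP (or_introl ou))).
have sgn2 n : (-1) ^+ n * (-1) ^+ n = 1 :> R[i].
  by rewrite -exprD addnn -muln2 exprM sqrr_sign.
have CE : \prod_(p <- S) ((- x + p) / (- x - p))%:C =
    (-1) ^+ M.+1 * (euler_quot M * euler_quot M.+1)%:C :> R[i].
  rewrite big_cat !big_map /=; exact: prod_poles.
have := circle_diff_inside sig0 sig1 iw uS oS; rewrite -SE /circle_diff -cintB// CE.
(* The sign makes f a positive multiple of the quotient, up to the factor 1 + e. *)
pose f t := (-1) ^+ M.+1 * (kaps (poles M.+1) t -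
    kaps [seq p / x ^+ 2 | p <- poles M.+1] t).
have cf : ccontinuous f.
  by apply: ccontinuousM; [exact: ccontinuous_cst|exact: ccontinuousB].
move=> H; have fE : cint f = (4 * pi * (euler_quot M * euler_quot M.+1))%:C.
  rewrite /f cintZ; last exact: ccontinuousB.
  by rewrite H [RHS]real_complexM mulrCA [X in _ * X]mulrA sgn2 mul1r.
have /(congr1 Re) /= <- := fE.
have ctq := continuous_theta_quot (M := M.+1).
rewrite -RintegralZl//; last exact: integrable_continuous.
apply: le_Rintegral => //.
- apply: integrable_continuous => t; apply: cvgM; first exact: cst_continuous.
  exact: ctq.
- by apply: integrable_continuous; case: cf.
move=> t _; have [e [K'E err]] := edge_quotient M t.
rewrite /f K'E opprK kaps_poles.
have -> : (-1) ^+ M.+1 * ((-1) ^+ M.+1 * (theta_quot M.+1 t)%:C +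
    (-1) ^+ M.+1 * (theta_quot M.+1 t)%:C * e) = (theta_quot M.+1 t)%:C * (1 + e).
  by rewrite -mulrA -mulrDr mulrA sgn2 mul1r mulrDr mulr1.
rewrite Re_mul Re_add /= mul0r subr0 mulrC.
rewrite ler_wpM2l ?theta_quot_ge0//.
by have := ler_norm (1 - Re e); lra.
Qed.

End ThetaQuotientMean.

(** * A finite form of the triple product *)

Section FiniteTripleProduct.
Variable R : realType.
Variables (q : R) (q0 : 0 < q) (q1 : q < 1).
Implicit Types (n k N : nat).

(** Gaussian binomial coefficients in base q^2. *)
Fixpoint gauss n k : R :=
  match n, k with
  | _, 0 => 1
  | 0, _.+1 => 0
  | n.+1, k'.+1 => gauss n k + q ^+ (n - k').*2 * gauss n k'
  end.

Lemma gauss0 n : gauss n 0 = 1. Proof. by case: n. Qed.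

Lemma gaussS n k : gauss n.+1 k.+1 = gauss n k.+1 + q ^+ (n - k).*2 * gauss n k.
Proof. by []. Qed.

Lemma gauss_small n k : (n < k)%N -> gauss n k = 0.
Proof.
elim: n k => [|n IH] [|k]// nk; rewrite gaussS !IH ?mulr0 ?addr0//.
exact: ltnW.
Qed.

Lemma mulnS_pred k : (k.+1 * k = k * k.-1 + k.*2)%N.
Proof. by case: k => // k /=; lia. Qed.

(** The q-binomial theorem of Cauchy. *)
Lemma gauss_binomial n (u : R) :
  \prod_(i < n) (u + q ^+ i.*2) =
  \sum_(k < n.+1) q ^+ (k * k.-1) * gauss n k * u ^+ (n - k).
Proof.
elim: n => [|n IH]; first by rewrite big_ord0 big_ord_recr big_ord0 /= add0r !mulr1.
rewrite big_ord_recr /= IH [RHS]big_ord_recl /= mul0n mulr1 mul1r subn0.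
pose A k := q ^+ (k * k.-1) * gauss n k * u ^+ (n - k).
have step k : (k <= n)%N ->
    q ^+ (k.+1 * k) * gauss n.+1 k.+1 * u ^+ (n - k) =
    (if (k < n)%N then u * A k.+1 else 0) + q ^+ n.*2 * A k.
  move=> kn; rewrite gaussS mulrDr mulrDl; congr (_ + _).
    case: ltnP => [kn'|nk]; last by rewrite gauss_small// mulr0 mul0r.
    by rewrite /A /= -[(n - k)%N]prednK ?subn_gt0// -subnS exprS; ring.
  rewrite /A.
  have -> : q ^+ (k.+1 * k) = q ^+ (k * k.-1) * q ^+ k.*2.
    by rewrite -exprD mulnS_pred.
  have -> : q ^+ n.*2 = q ^+ k.*2 * q ^+ (n - k).*2.
    by rewrite -exprD; congr (q ^+ _); lia.
  ring.
rewrite [X in _ = _ + X](eq_bigr (fun k : 'I_n.+1 =>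
  (if (k < n)%N then u * A k.+1 else 0) + q ^+ n.*2 * A k)); last first.
  by move=> k _; have kn : (k <= n)%N := ltn_ord k; rewrite -(step k kn) ?lift0 ?subSS.
rewrite big_split /= -big_distrr /= addrA mulrDr [LHS]addrC mulrC addrC.
rewrite [X in _ + X]mulrC -/(A _); congr (_ + _).
  rewrite mulrC [in LHS]big_ord_recl [in RHS]big_ord_recr /= ltnn addr0 mulrDr.
  rewrite gauss0 subn0 mul0n !mul1r -exprS; congr (_ + _); rewrite big_distrr /=.
  by apply: eq_bigr => k _; rewrite ltn_ord.
by rewrite mulrC.
Qed.

Definition qpoch n : R := \prod_(i < n) (1 - q ^+ i.+1.*2).

Lemma qpochS n : qpoch n.+1 = qpoch n * (1 - q ^+ n.+1.*2).
Proof. by rewrite /qpoch big_ord_recr. Qed.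

Lemma qpow_lt1 n : q ^+ n.+1 < 1.
Proof. by rewrite exprn_ilt1// ltW. Qed.

Lemma qpoch_gt0 n : 0 < qpoch n.
Proof. by apply: prodr_gt0 => i _; rewrite subr_gt0 doubleS qpow_lt1. Qed.

Lemma qpoch_le m n : (m <= n)%N -> qpoch n <= qpoch m.
Proof.
elim: n => [|n IH]; first by rewrite leqn0 => /eqP ->.
rewrite leq_eqVlt => /predU1P[->//|/IH]; apply: le_trans.
by rewrite qpochS ger_pMr ?qpoch_gt0// gerBl exprn_ge0// ltW.
Qed.

Lemma gauss_qpoch n k : (k <= n)%N -> gauss n k * qpoch k * qpoch (n - k) = qpoch n.
Proof.
elim: n k => [|n IH] [|k]//.
- by rewrite /qpoch big_ord0 !mulr1.
- by rewrite gauss0 /qpoch big_ord0 subn0 !mul1r.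
rewrite ltnS subSS => kn; rewrite gaussS !mulrDl.
have -> : q ^+ (n - k).*2 * gauss n k * qpoch k.+1 * qpoch (n - k) =
    q ^+ (n - k).*2 * (1 - q ^+ k.+1.*2) * qpoch n.
  by rewrite -(IH k kn) qpochS; ring.
have -> : gauss n k.+1 * qpoch k.+1 * qpoch (n - k) =
    (1 - q ^+ (n - k).*2) * qpoch n.
  move: kn; rewrite leq_eqVlt => /predU1P[->|kn].
    by rewrite gauss_small// subnn subrr !mul0r.
  rewrite -(IH _ kn) -[(n - k)%N]prednK ?subn_gt0// (qpochS _.-1) -subnS; ring.
rewrite qpochS mulrBr mulr1 -exprD.
have -> : ((n - k).*2 + k.+1.*2 = n.+1.*2)%N by lia.
ring.
Qed.

Lemma gauss_ge0 n k : 0 <= gauss n k.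
Proof.
elim: n k => [|n IH] [|k]//; rewrite gaussS addr_ge0// mulr_ge0// exprn_ge0//.
exact: ltW.
Qed.

(** One of the two factorials in the denominator has index at most N, and the
other one is at least the numerator. *)
Lemma gauss_central N k : (k <= N.*2)%N -> gauss N.*2 k * qpoch N <= 1.
Proof.
move=> kN; have := gauss_qpoch kN; set m := (N.*2 - k)%N.
have bnd i j : (i <= N)%N -> (j <= N.*2)%N ->
    gauss N.*2 k * qpoch i * qpoch j = qpoch N.*2 -> gauss N.*2 k * qpoch N <= 1.
  move=> iN jN E; apply: (@le_trans _ _ (gauss N.*2 k * qpoch i)).
    by rewrite ler_wpM2l ?gauss_ge0// qpoch_le.
  by rewrite -(ler_pM2r (qpoch_gt0 j)) E mul1r qpoch_le.
move=> E; have [kN'|Nk] := leqP k N; first by apply: (bnd k m) => //; rewrite leq_subr.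
by apply: (bnd m k) => //; [rewrite /m; lia|rewrite -mulrA [qpoch m * _]mulrC mulrA].
Qed.

Lemma prod_pair (F : nat -> R) N :
  \prod_(i < N.*2) F i = \prod_(i < N) F i * \prod_(i < N) F (N + i)%N.
Proof.
rewrite -addnn big_split_ord /=; congr (_ * _).
Qed.

Lemma prod_qpow_sum N : \prod_(i < N) q ^+ i.*2 = q ^+ (N * N.-1).
Proof.
elim: N => [|N IH]; first by rewrite big_ord0.
by rewrite big_ord_recr /= IH -exprD mulnS_pred.
Qed.

(** The distance |k - N|, in truncated arithmetic. *)
Definition dist k N := ((k - N) + (N - k))%N.

Lemma mul_predD n : (n * n.-1 + n = n * n)%N.
Proof. by case: n => // n; rewrite /= -mulnSr. Qed.

Lemma dist_cases k N : (k <= N.*2)%N ->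
  (exists j, [/\ N = (k + j)%N, (N.*2 - k)%N = (k + j.*2)%N, dist k N = j &
                 dist k N.+1 = j.+1]) \/
  (exists j l, [/\ N = (j.+1 + l)%N, k = (N + j.+1)%N, (N.*2 - k)%N = l,
                 dist k N = j.+1 & dist k N.+1 = j]).
Proof.
move=> kN; have [h|h] := leqP k N.
  by left; exists (N - k)%N; rewrite /dist; split; lia.
by right; exists (k - N).-1, (N.*2 - k)%N; rewrite /dist; split; lia.
Qed.

(** Completing the square in k; the term that does not depend on k is the exponent
of the power of q that is divided out of the product. *)
Lemma theta3_exponent k N : (0 < N)%N -> (k <= N.*2)%N ->
  (k * k.-1 + N.*2.-1 * (N.*2 - k) =
   N * N.-1 + N * N.*2.-1 + dist k N ^ 2)%N.
Proof.
move=> N0 kN; have hk := mul_predD k; have hN := mul_predD N.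
have hM : (N.*2.-1 + 1 = N + N)%N by lia.
move: (N.*2.-1) (k * k.-1)%N (N * N.-1)%N hM hk hN => M A B hM hk hN.
case: (dist_cases kN) => [[j [NE -> -> _]]|[j [l [NE kE -> -> _]]]].
  have h4 : (j * M + j = j * (N + N))%N by rewrite -hM mulnDr muln1.
  by subst N; rewrite expnS expn1; lia.
have h4 : (j.+1 * M + j.+1 = j.+1 * (N + N))%N by rewrite -hM mulnDr muln1.
by subst k N; rewrite expnS expn1; lia.
Qed.

Lemma theta2_exponent k N : (k <= N.*2)%N ->
  (k * k.-1 + N.*2 * (N.*2 - k) =
   N * N.-1 + N * N.*2 + dist k N * dist k N.+1)%N.
Proof.
move=> kN; have hk := mul_predD k; have hN := mul_predD N.
have hM : (N.*2 = N + N)%N by lia.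
move: (k * k.-1)%N (N * N.-1)%N hk hN => A B hk hN.
case: (dist_cases kN) => [[j [NE -> -> ->]]|[j [l [NE kE -> -> ->]]]].
  by rewrite hM; subst N; lia.
by rewrite hM; subst k N; lia.
Qed.

(** The q-binomial theorem with 2 N factors and u = q^(2N - 1), recentred at k = N. *)
Lemma finite_theta3 N :
  \prod_(i < N) (1 + q ^+ i.*2.+1) ^+ 2 =
  \sum_(k < N.*2.+1) gauss N.*2 k * q ^+ (dist k N ^ 2).
Proof.
have qn0 : q != 0 by rewrite gt_eqF.
have [->|N0] := posnP N; first by rewrite big_ord0 big_ord_recr big_ord0 /= add0r mulr1.
apply: (mulfI (expf_neq0 (N * N.-1 + N * N.*2.-1) qn0)).
transitivity (\prod_(i < N.*2) (q ^+ N.*2.-1 + q ^+ i.*2)).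
  rewrite (prod_pair (fun i => q ^+ N.*2.-1 + q ^+ i.*2)).
  have -> : \prod_(i < N) (q ^+ N.*2.-1 + q ^+ i.*2) =
      q ^+ (N * N.-1) * \prod_(i < N) (1 + q ^+ i.*2.+1).
    rewrite -prod_qpow_sum [X in _ * X](reindex_inj rev_ord_inj) -big_split /=.
    apply: eq_bigr => i _; rewrite mulrDr mulr1 addrC -exprD; congr (_ + q ^+ _).
    by have := ltn_ord i; lia.
  have -> : \prod_(i < N) (q ^+ N.*2.-1 + q ^+ (N + i).*2) =
      q ^+ (N * N.*2.-1) * \prod_(i < N) (1 + q ^+ i.*2.+1).
    have -> : q ^+ (N * N.*2.-1) = \prod_(i < N) q ^+ N.*2.-1.
      by rewrite prodr_const card_ord -exprM mulnC.
    rewrite -big_split /=; apply: eq_bigr => i _; rewrite mulrDr mulr1 -exprD.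
    by congr (_ + q ^+ _); lia.
  by under eq_bigr do rewrite expr2; rewrite big_split exprD /=; ring.
rewrite gauss_binomial big_distrr /=; apply: eq_bigr => k _.
rewrite -exprM mulrAC -exprD [RHS]mulrA mulrAC -exprD mulrC [RHS]mulrC.
congr (_ * q ^+ _); exact: theta3_exponent (ltn_ord k).
Qed.

(** The same with u = q^(2N). *)
Lemma finite_theta2 N : (0 < N)%N ->
  \prod_(i < N) (1 + q ^+ i.+1.*2) * \prod_(i < N) (1 + q ^+ i.*2) =
  \sum_(k < N.*2.+1) gauss N.*2 k * q ^+ (dist k N * (dist k N.+1)).
Proof.
move=> N0; have qn0 : q != 0 by rewrite gt_eqF.
apply: (mulfI (expf_neq0 (N * N.-1 + N * N.*2) qn0)).
transitivity (\prod_(i < N.*2) (q ^+ N.*2 + q ^+ i.*2)).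
  rewrite (prod_pair (fun i => q ^+ N.*2 + q ^+ i.*2)).
  have -> : \prod_(i < N) (q ^+ N.*2 + q ^+ i.*2) =
      q ^+ (N * N.-1) * \prod_(i < N) (1 + q ^+ i.+1.*2).
    rewrite -prod_qpow_sum [X in _ * X](reindex_inj rev_ord_inj) -big_split /=.
    apply: eq_bigr => i _; rewrite mulrDr mulr1 addrC -exprD; congr (_ + q ^+ _).
    by have := ltn_ord i; lia.
  have -> : \prod_(i < N) (q ^+ N.*2 + q ^+ (N + i).*2) =
      q ^+ (N * N.*2) * \prod_(i < N) (1 + q ^+ i.*2).
    have -> : q ^+ (N * N.*2) = \prod_(i < N) q ^+ N.*2.
      by rewrite prodr_const card_ord -exprM mulnC.
    rewrite -big_split /=; apply: eq_bigr => i _; rewrite mulrDr mulr1 -exprD.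
    by congr (_ + q ^+ _); lia.
  by rewrite exprD /=; ring.
rewrite gauss_binomial big_distrr /=; apply: eq_bigr => k _.
rewrite -exprM mulrAC -exprD [RHS]mulrA mulrAC -exprD mulrC [RHS]mulrC.
congr (_ * q ^+ _); exact: theta2_exponent (ltn_ord k).
Qed.

End FiniteTripleProduct.

(** * Theta series and infinite products *)

Section ThetaBounds.
Variable R : realType.
Variables (q : R) (q0 : 0 < q) (q1 : q < 1).
Implicit Types (n k N : nat).

Lemma partial_sum_le_limn (e : nat -> nat) n : (forall j, j <= e j)%N ->
  \sum_(j < n) q ^+ e j <= limn (series (fun j => q ^+ e j)).
Proof.
move=> je.
have ge0 j : 0 <= q ^+ e j by rewrite exprn_ge0// ltW.
have cv : cvgn (series (fun j => q ^+ e j)).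
  apply: (@series_le_cvg _ _ (geometric 1 q)) => //.
  - by move=> j; rewrite /= mul1r exprn_ge0// ltW.
  - by move=> j; rewrite /= mul1r ler_wiXn2l// ltW.
  - by apply: is_cvg_geometric_series; rewrite gtr0_norm.
have := @nondecreasing_cvgn_le _ _ _ cv n; rewrite /series /= big_mkord; apply.
by apply/nondecreasing_seqP => m; rewrite /series /= big_nat_recr//= lerDl.
Qed.

Lemma sum_dist (F : nat -> nat -> R) N :
  \sum_(k < N.*2.+1) F (dist k N) (dist k N.+1) =
  \sum_(j < N) F j.+1 j.+2 + (F 0 1%N + \sum_(j < N) F j.+1 j).
Proof.
have -> : N.*2.+1 = (N + N.+1)%N by lia.
rewrite big_split_ord /=; congr (_ + _).
  rewrite [LHS](reindex_inj rev_ord_inj) /=; apply: eq_bigr => j _.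
  by have := ltn_ord j => jN; congr (F _ _); rewrite /dist; lia.
rewrite big_ord_recl /= /dist; congr (_ + _); first by congr (F _ _); lia.
by apply: eq_bigr => j _; rewrite ?/bump ?leq0n; congr (F _ _); lia.
Qed.

(** Ramanujan's psi at q^2; theta_2 is 2 q^(1/4) times it. *)
Definition psi : R := limn (series (fun j => q ^+ (j * j.+1))).

Lemma theta3_ge N : \sum_(k < N.*2.+1) q ^+ (dist k N ^ 2) <= theta3 0 q.
Proof.
rewrite (sum_dist (fun i _ => q ^+ (i ^ 2))) exp0n// expr0 /theta3.
under [in X in _ <= X]eq_fun do rewrite mulr0 cos0 mulr1.
have H : \sum_(j < N) q ^+ (j.+1 ^ 2) <= limn (series (fun j => q ^+ (j.+1 ^ 2))).
  by apply: (@partial_sum_le_limn (fun j => (j.+1 ^ 2)%N)) => j; nia.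
by move: (limn _) H => L; lra.
Qed.

Lemma psi_ge N : \sum_(k < N.*2.+1) q ^+ (dist k N * dist k N.+1) <= 2 * psi.
Proof.
rewrite (sum_dist (fun i j => q ^+ (i * j))) mul0n expr0.
have H n := @partial_sum_le_limn (fun j => (j * j.+1)%N) n (fun j => ltac:(lia)).
have HS : 1 + \sum_(j < N) q ^+ (j.+1 * j.+2) <= psi.
  by have := H N.+1; rewrite big_ord_recl.
have HN : \sum_(j < N) q ^+ (j.+1 * j) <= psi.
  by have := H N; under eq_bigr do rewrite mulnC.
lra.
Qed.

Lemma theta2E : theta2 0 q = 2 * q `^ 4^-1 * psi.
Proof.
by rewrite /theta2 /psi; under [in LHS]eq_fun do rewrite mulr0 cos0 mulr1.
Qed.

Lemma psi_gt0 : 0 < psi.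
Proof.
apply: lt_le_trans ltr01 _.
have := @partial_sum_le_limn (fun j => (j * j.+1)%N) 1 (fun j => ltac:(lia)).
by rewrite big_ord1 mul0n expr0.
Qed.

Lemma theta3_gt0 : 0 < theta3 0 q.
Proof.
by have := theta3_ge 0; rewrite big_ord1; apply: lt_le_trans; rewrite exprn_gt0.
Qed.

Definition odd_poch N : R := \prod_(i < N) (1 - q ^+ i.*2.+1).

Lemma odd_poch_gt0 N : 0 < odd_poch N.
Proof. by apply: prodr_gt0 => i _; rewrite subr_gt0 qpow_lt1. Qed.

(** Euler's product 1 / (q; q^2) = (-q; q), in a finite form. *)
Lemma euler_finite N :
  \prod_(i < N) (1 + q ^+ i.*2.+1) * \prod_(i < N) (1 + q ^+ i.+1.*2) *
  odd_poch N * qpoch q N = qpoch q N.*2.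
Proof.
elim: N => [|N IH]; first by rewrite /odd_poch /qpoch !big_ord0 !mulr1.
rewrite doubleS !qpochS -IH /odd_poch !big_ord_recr /=.
have -> : q ^+ N.*2.+1.*2 = q ^+ N.*2.+1 * q ^+ N.*2.+1.
  by rewrite -exprD; congr (q ^+ _); lia.
have -> : q ^+ N.*2.+2.*2 = q ^+ N.+1.*2 * q ^+ N.+1.*2.
  by rewrite -exprD; congr (q ^+ _); lia.
ring.
Qed.

(** In the finite identities the central binomials are at most 1 / qpoch N and the
sums are partial sums of the theta series, so that every step goes in the same
direction; the square on the left tends to the product theta_3 psi. *)
Lemma theta_product_le N : (0 < N)%N ->
  (qpoch q N.*2 / odd_poch N) ^+ 2 <= (1 + q ^+ N.*2) * (theta3 0 q * psi).
Proof.
move=> N0; rewrite -euler_finite.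
set A := \prod_(i < N) _; set B := \prod_(i < N) _.
have A0 : 0 <= A by apply: prodr_ge0 => i _; rewrite addr_ge0// exprn_ge0// ltW.
have B0 : 0 <= B by apply: prodr_ge0 => i _; rewrite addr_ge0// exprn_ge0// ltW.
have -> : A * B * odd_poch N * qpoch q N / odd_poch N = A * B * qpoch q N.
  by field; rewrite gt_eqF ?odd_poch_gt0.
have cent k : (k < N.*2.+1)%N -> qpoch q N * gauss q N.*2 k <= 1.
  by move=> kN; rewrite mulrC gauss_central.
have HA : qpoch q N * A ^+ 2 <= theta3 0 q.
  apply: le_trans (theta3_ge N); rewrite -prodrXl finite_theta3// big_distrr /=.
  apply: ler_sum => k _; rewrite mulrA ler_piMl ?exprn_ge0 ?(ltW q0)//.
  exact: cent (ltn_ord k).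
have HB : qpoch q N * B ^+ 2 <= (1 + q ^+ N.*2) * psi.
  have BB : (1 + q ^+ N.*2) * \prod_(i < N) (1 + q ^+ i.*2) = 2 * B.
    rewrite mulrC -(big_ord_recr N (fun i => 1 + q ^+ (val i).*2)) big_ord_recl /=.
    by congr (_ * _).
  rewrite -(ler_pM2l (ltr0n _ 2)).
  have -> : 2 * (qpoch q N * B ^+ 2) =
    (1 + q ^+ N.*2) * (qpoch q N * (B * \prod_(i < N) (1 + q ^+ i.*2))).
    by rewrite expr2 [LHS]mulrCA [2 * (B * B)]mulrA -BB; ring.
  rewrite [X in _ <= X]mulrCA ler_wpM2l ?addr_ge0 ?exprn_ge0 ?(ltW q0)//.
  apply: le_trans (psi_ge N); rewrite finite_theta2// big_distrr /=.
  apply: ler_sum => k _; rewrite mulrA ler_piMl ?exprn_ge0 ?(ltW q0)//.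
  exact: cent (ltn_ord k).
have -> : (A * B * qpoch q N) ^+ 2 = (qpoch q N * A ^+ 2) * (qpoch q N * B ^+ 2) by ring.
rewrite [leRHS]mulrCA; apply: ler_pM => //; rewrite mulr_ge0 ?sqr_ge0 ?(ltW (qpoch_gt0 _ _ _))//.
Qed.

(** A product of factors 1 - c_i is at least 1 - sum c_i, and here the c_i are
geometric. *)
Lemma qpoch_ratio_ge N : 1 - q ^+ N.+1.*2 / (1 - q ^+ 2) <= qpoch q N.*2 / qpoch q N.
Proof.
have qq : 0 < 1 - q ^+ 2 by rewrite subr_gt0 qpow_lt1.
have H n : 1 - q ^+ N.+1.*2 * ((1 - q ^+ n.*2) / (1 - q ^+ 2)) <=
    qpoch q (N + n) / qpoch q N.
  elim: n => [|n IH].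
    by rewrite addn0 expr0 subrr mul0r mulr0 subr0 divff// gt_eqF ?qpoch_gt0.
  rewrite addnS qpochS [leRHS]mulrAC; set c := q ^+ N.+1.*2 in IH *.
  have -> : q ^+ (N + n).+1.*2 = c * q ^+ n.*2.
    by rewrite /c -exprD; congr (q ^+ _); lia.
  have c0 : 0 <= c * q ^+ n.*2 by rewrite mulr_ge0// exprn_ge0// ltW.
  have r1 : qpoch q (N + n) / qpoch q N <= 1.
    by rewrite ler_pdivrMr ?qpoch_gt0// mul1r qpoch_le// leq_addr.
  have -> : 1 - c * ((1 - q ^+ n.+1.*2) / (1 - q ^+ 2)) =
     1 - c * ((1 - q ^+ n.*2) / (1 - q ^+ 2)) - c * q ^+ n.*2.
    have -> : q ^+ n.+1.*2 = q ^+ n.*2 * q ^+ 2 by rewrite -exprD doubleS addn2.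
    by field; rewrite gt_eqF.
  by move: (qpoch q (N + n) / _) IH r1 => z; nra.
have := H N; rewrite addnn; apply: le_trans; rewrite lerD2l lerN2.
rewrite ler_wpM2l ?exprn_ge0 ?(ltW q0)// -[leRHS]mul1r ler_wpM2r ?invr_ge0 ?(ltW qq)//.
by rewrite gerBl exprn_ge0// ltW.
Qed.

End ThetaBounds.

(** * Polynomial approximation of square roots *)

Section SquareApproximation.
Variable R : realType.
Local Notation Re := (@complex.Re R).
Local Notation Im := (@complex.Im R).
Variable K : set R[i].
Implicit Types (f g : R[i] -> R[i]) (F P Q : {poly R[i]}) (z : R[i]).

(** Approximation by squares of polynomials avoids the choice of a branch of the
square root. *)
Definition sq_approx f := forall e : R, 0 < e ->
  exists P, forall z, K z -> normc (P.[z] ^+ 2 - f z) <= e.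

Definition cbounded f := exists2 B : R, 0 < B & forall z, K z -> normc (f z) <= B.

Lemma cboundedM f g : cbounded f -> cbounded g -> cbounded (fun z => f z * g z).
Proof.
move=> [B B0 fB] [C C0 gC]; exists (B * C) => [|z Kz]; first exact: mulr_gt0.
by rewrite normcM ler_pM ?normc_ge0 ?fB ?gC.
Qed.

Lemma cbounded1 : cbounded (fun=> 1).
Proof. by exists 1 => // z _; rewrite normc1. Qed.

Lemma sq_approx1 : sq_approx (fun=> 1).
Proof.
move=> e e0; exists 1 => z _; rewrite hornerC expr1n subrr normc0; exact: ltW.
Qed.

Lemma sq_approxM f g : cbounded f -> cbounded g ->
  sq_approx f -> sq_approx g -> sq_approx (fun z => f z * g z).
Proof.
move=> [B B0 fB] [C C0 gC] af ag e e0.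
have [P Pf] := af (e / (2 * (C + 1))) (divr_gt0 e0 (mulr_gt0 (ltr0n _ 2) (addr_gt0 C0 ltr01))).
pose d := Num.min 1 (e / (2 * B)).
have d0 : 0 < d by rewrite lt_min ltr01 divr_gt0// mulr_gt0.
have [Q Qg] := ag d d0.
exists (P * Q) => z Kz; rewrite hornerM exprMn.
have -> : P.[z] ^+ 2 * Q.[z] ^+ 2 - f z * g z =
   (P.[z] ^+ 2 - f z) * Q.[z] ^+ 2 + f z * (Q.[z] ^+ 2 - g z) by ring.
apply: le_trans (le_normcD _ _) _; rewrite (normcM (_ - _)) (normcM (f z)).
have h1 := Pf z Kz; have h2 := Qg z Kz; have h3 := fB z Kz; have h4 := gC z Kz.
have h5 : normc (Q.[z] ^+ 2) <= C + 1.
  rewrite -(subrK (g z) (Q.[z] ^+ 2)); apply: le_trans (le_normcD _ _) _.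
  by rewrite addrC lerD// (le_trans h2)// /d ge_min lexx.
have -> : e = e / (2 * (C + 1)) * (C + 1) + B * (e / (2 * B)).
  by field; rewrite !gt_eqF// addr_gt0.
apply: lerD; apply: ler_pM; rewrite ?normc_ge0//.
by apply: le_trans h2 _; rewrite /d ge_min lexx orbT.
Qed.

Section HalfPlane.
Variables (F : {poly R[i]}) (d B : R) (d0 : 0 < d).
Hypothesis Fd : forall z, K z -> d <= Re F.[z].
Hypothesis FB : forall z, K z -> normc F.[z] <= B.

(** A bounded part of the half-plane Re >= d > 0 lies in a disc around some S > 0
that avoids the origin. *)
Lemma half_plane_disc : exists S rho : R, [/\ 0 < S, 0 <= rho < 1 &
  forall z, K z -> normc (1 - F.[z] / S%:C) <= rho].
Proof.
pose S := (B ^+ 2 + d ^+ 2) / d; pose rho := Num.sqrt (1 - d / S).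
have S0 : 0 < S.
  by rewrite divr_gt0// ltr_wpDl ?sqr_ge0// exprn_gt0.
have dS : d <= S.
  by rewrite /S ler_pdivlMr// -expr2 lerDr sqr_ge0.
have dS1 : d / S <= 1 by rewrite ler_pdivrMr// mul1r.
have r0 : 0 <= 1 - d / S by rewrite subr_ge0.
exists S, rho; split => //.
  by rewrite sqrtr_ge0 /= -sqrtr1 ltr_sqrt// gtrBl divr_gt0.
move=> z Kz; rewrite -(@ler_pXn2r _ 2)// ?nnegrE ?normc_ge0 ?sqrtr_ge0//.
rewrite sqr_sqrtr//.
have -> : 1 - F.[z] / S%:C = (S%:C - F.[z]) / S%:C.
  by field; rewrite real_complex_eq0 gt_eqF.
rewrite normcM normcV normcR gtr0_norm// exprMn exprVn ler_pdivrMr ?exprn_gt0//.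
have -> : (1 - d / S) * S ^+ 2 = S ^+ 2 - d * S by field; rewrite gt_eqF.
have := Fd Kz; have : normc F.[z] ^+ 2 <= B ^+ 2.
  by rewrite ler_pXn2r ?nnegrE ?normc_ge0 ?FB// (le_trans (normc_ge0 _) (FB Kz)).
rewrite !sqr_normcRe Re_add Im_add Re_opp Im_opp /=.
have : d * S = B ^+ 2 + d ^+ 2 by rewrite /S mulrCA divff ?mulr1 ?gt_eqF.
move: (Re _) (Im _) (B ^+ 2) => X Y C; nra.
Qed.

(** With E = 1 - F / S the iteration y -> (E + y^2) / 2 tends to 1 - sqrt (1 - E):
the residual E - 2 y + y^2 is multiplied by the mean of two consecutive terms. *)
Lemma sq_approx_horner : sq_approx (horner F).
Proof.
have [S [rho [S0 /andP[rho0 rho1] FS]]] := half_plane_disc.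
pose E : {poly R[i]} := 1 - (S%:C)^-1 *: F.
pose y := fix y n : {poly R[i]} :=
  if n is n'.+1 then (2^-1 : R[i]) *: (E + y n' ^+ 2) else 0.
have Ez z : K z -> normc E.[z] <= rho.
  by move=> /FS; rewrite /E !hornerE mulrC.
have n2 : normc (2^-1 : R[i]) = 2^-1.
  by rewrite normcV normcRe /= !addr0 expr0n addr0 sqrtr_sqr ger0_norm.
have yz n z : K z -> normc (y n).[z] <= rho.
  move=> Kz; elim: n => [|n IH]; first by rewrite /= hornerC normc0.
  rewrite /= hornerZ hornerD horner_exp normcM n2.
  have := le_normcD E.[z] ((y n).[z] ^+ 2); rewrite normcX => h.
  have := Ez z Kz; have := normc_ge0 (y n).[z]; move: h IH.
  move: (normc (_ + _)) (normc (y n).[z]) (normc E.[z]) => u v w; nra.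
have res n z : K z -> normc (E.[z] - 2 * (y n).[z] + (y n).[z] ^+ 2) <= rho ^+ n.+1.
  move=> Kz; elim: n => [|n IH].
    by rewrite /= hornerC mulr0 subr0 expr0n addr0 expr1 Ez.
  have -> : E.[z] - 2 * (y n.+1).[z] + (y n.+1).[z] ^+ 2 =
      (E.[z] - 2 * (y n).[z] + (y n).[z] ^+ 2) * (2^-1 * ((y n.+1).[z] + (y n).[z])).
    by rewrite /= hornerZ hornerD horner_exp; field.
  rewrite normcM [leRHS]exprSr.
  apply: ler_pM; [exact: normc_ge0|exact: normc_ge0|exact: IH|].
  rewrite normcM n2.
  have := le_normcD (y n.+1).[z] (y n).[z].
  by have := yz n.+1 z Kz; have := yz n z Kz; lra.
move=> e e0.
have [n ne] : exists n, S * rho ^+ n.+1 <= e.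
  have cv : (fun n => S * rho ^+ n) @ \oo --> (0 : R).
    rewrite -[X in _ --> X](mulr0 S); apply: cvgM; first exact: cvg_cst.
    by apply: cvg_expr; rewrite ger0_norm.
  have /cvgrPdist_le /(_ e e0) [n _ /(_ n.+1 (leqnSn n))] := cv.
  by rewrite sub0r normrN => /(le_trans (ler_norm _)); exists n.
exists ((Num.sqrt S)%:C *: (1 - y n)) => z Kz.
have SS : (Num.sqrt S)%:C ^+ 2 = S%:C :> R[i].
  by rewrite expr2 -real_complexM -expr2 sqr_sqrtr// ltW.
have -> : ((Num.sqrt S)%:C *: (1 - y n)).[z] ^+ 2 - F.[z] =
    S%:C * (E.[z] - 2 * (y n).[z] + (y n).[z] ^+ 2).
  rewrite hornerZ !hornerE exprMn SS; field.
  by rewrite real_complex_eq0 gt_eqF.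
rewrite normcM normcR gtr0_norm//; apply: le_trans ne.
by rewrite ler_pM2l// res.
Qed.

(** The geometric series of E = 1 - F / S approximates S / F. *)
Lemma sq_approx_inv : sq_approx (fun z => F.[z] ^- 2).
Proof.
have [S [rho [S0 /andP[rho0 rho1] FS]]] := half_plane_disc.
pose E : {poly R[i]} := 1 - (S%:C)^-1 *: F.
have Ez z : K z -> normc E.[z] <= rho.
  by move=> /FS; rewrite /E !hornerE mulrC.
have SC : S%:C != 0 :> R[i] by rewrite real_complex_eq0 gt_eqF.
move=> e e0.
have [n ne] : exists n, 3 / d ^+ 2 * rho ^+ n <= e.
  have cv : (fun n => 3 / d ^+ 2 * rho ^+ n) @ \oo --> (0 : R).
    rewrite -[X in _ --> X](mulr0 (3 / d ^+ 2)); apply: cvgM; first exact: cvg_cst.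
    by apply: cvg_expr; rewrite ger0_norm.
  have /cvgrPdist_le /(_ e e0) [n _ /(_ n (leqnn n))] := cv.
  by rewrite sub0r normrN => /(le_trans (ler_norm _)); exists n.
pose Q := (S%:C)^-1 *: \sum_(k < n) E ^+ k.
exists Q => z Kz.
have Fz0 : F.[z] != 0.
  by apply/eqP => Fz; have := Fd Kz; rewrite Fz leNgt d0.
have FV : normc F.[z]^-1 <= d^-1.
  rewrite normcV lef_pV2 ?posrE ?normc_gt0//.
  by apply: le_trans (Fd Kz) _; apply: le_trans (ler_norm _) (Re_le_normc _).
have QE : F.[z]^-1 - Q.[z] = E.[z] ^+ n / F.[z].
  have EF : E.[z] = 1 - F.[z] / S%:C by rewrite /E !hornerE mulrC.
  apply: (mulIf Fz0); rewrite mulrBl mulVf// divfK//.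
  have -> : Q.[z] * F.[z] = (1 - E.[z]) * \sum_(k < n) E.[z] ^+ k.
    rewrite /Q hornerZ horner_sum {1}EF opprB addrC subrK.
    by under eq_bigr do rewrite horner_exp; field.
  have -> : \sum_(k < n) E.[z] ^+ k = \sum_(k < n) 1 ^+ (n.-1 - k) * E.[z] ^+ k.
    by apply: eq_bigr => k _; rewrite expr1n mul1r.
  have := subrXX 1 E.[z] n; rewrite expr1n => <-.
  by rewrite opprB addrC subrK.
have En : normc (E.[z] ^+ n) <= rho ^+ n.
  by rewrite normcX lerXn2r ?nnegrE ?normc_ge0 ?Ez.
have rn : rho ^+ n <= 1 by rewrite exprn_ile1// ltW.
have dV : 0 < d^-1 by rewrite invr_gt0.
have diff : normc (F.[z]^-1 - Q.[z]) <= rho ^+ n * d^-1.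
  by rewrite QE normcM ler_pM ?normc_ge0.
have -> : Q.[z] ^+ 2 - F.[z] ^- 2 =
    (F.[z]^-1 - Q.[z]) * ((F.[z]^-1 - Q.[z]) - 2 * F.[z]^-1).
  by rewrite -exprVn; ring.
rewrite normcM; apply: le_trans ne.
have -> : 3 / d ^+ 2 * rho ^+ n = (rho ^+ n * d^-1) * (3 * d^-1).
  by field; rewrite gt_eqF.
apply: ler_pM; [exact: normc_ge0|exact: normc_ge0|exact: diff|].
apply: le_trans (le_normcD _ _) _; rewrite normcN normcM.
have -> : normc (2 : R[i]) = 2 by rewrite normcRe /= !addr0 expr0n addr0 sqrtr_sqr ger0_norm.
have : rho ^+ n * d^-1 <= d^-1 by rewrite ger_pMl.
by move: diff FV; lra.
Qed.

End HalfPlane.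
End SquareApproximation.

(** * The extremal function *)

Section Extremal.
Variable R : realType.
Local Notation mu := (@lebesgue_measure R).
Local Notation Re := (@complex.Re R).
Local Notation Im := (@complex.Im R).
Variables (x : R) (x0 : 0 < x) (x1 : x < 1).
Implicit Types (p s t : R) (z : R[i]) (N M : nat).

(** The long semi-axis r, in terms of x = (r - 1) / (r + 1). *)
Definition axis : R := (1 + x) / (1 - x).
Local Notation r := axis.

Let omx : 0 < 1 - x. Proof. by rewrite subr_gt0. Qed.
Let omx0 : 1 - x != 0. Proof. by rewrite gt_eqF. Qed.
Let xn0 : x != 0. Proof. by rewrite gt_eqF. Qed.

Let nxC : (1 - x)%:C != 0 :> R[i]. Proof. by rewrite real_complex_eq0. Qed.

Lemma axis_gt1 : 1 < r.
Proof. by rewrite /axis ltr_pdivlMr// mul1r; move: x0; lra. Qed.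

Let cpar := ccontinuous_param r.
Let cdpar := ccontinuous_dparam r.
Let pi2 := twopi_gt0 R.

Lemma axis_halfD : (r + 1) / 2 = (1 - x)^-1.
Proof. by rewrite /axis; field. Qed.

Lemma axis_halfB : (r - 1) / 2 = x / (1 - x).
Proof. by rewrite /axis; field. Qed.

Definition unorm s t : R := normc (1 - s%:C * expi 2 t).

Lemma expi2E t : expi 2 t = expi 1 t ^+ 2.
Proof. by rewrite -expiM. Qed.

Lemma normc_conj_one_sub s t : normc (1 - s%:C / expi 2 t) = unorm s t.
Proof.
rewrite -normc_conj /unorm; congr normc.
have := conj_one_add (- s) t; rewrite real_complexN !mulNr => <-.
by rewrite conjcK.
Qed.

Lemma normc_dparam t : normc (dparam r t) = unorm x t / (1 - x).
Proof.
rewrite (dparam_expi r) axis_halfD axis_halfB -normc_conj_one_sub expi2E.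
have u0 := expi_neq0 1 t; have nu := normc_expi 1 t.
rewrite real_complexM real_complexV; move: (expi 1 t) u0 nu => u u0 nu.
have -> : 'i%C * ((1 - x)%:C^-1 * u - x%:C * (1 - x)%:C^-1 / u) =
  'i%C * u * (1 - x%:C / u ^+ 2) * (1 - x)%:C^-1.
  by move: ((1 - x)%:C) nxC => v v0; field; rewrite u0 v0.
rewrite !normcM nu normcV normcR gtr0_norm//.
have -> : normc 'i%C = 1 :> R by rewrite normcRe /= expr0n add0r expr1n sqrtr1.
by rewrite !mul1r.
Qed.

Lemma paramE t : param r t =
  expi 1 t * (1 - (- x)%:C / expi 2 t) * (1 - x)%:C^-1.
Proof.
rewrite (param_expi r) axis_halfD axis_halfB expi2E.
have u0 := expi_neq0 1 t; rewrite real_complexM real_complexV real_complexN.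
move: ((1 - x)%:C) nxC (expi 1 t) u0 => v v0 u u0; by field; rewrite u0 v0.
Qed.

Lemma normc_param t : normc (param r t) = unorm (- x) t / (1 - x).
Proof.
by rewrite paramE !normcM normc_expi normc_conj_one_sub normcV normcR mul1r gtr0_norm.
Qed.

Definition lam p : R := - p * (1 - x) ^+ 2 / (x * (1 + p) ^+ 2).

(** On the ellipse the quadratic factors of the theta products, as functions of
z, split into factors that are holomorphic inside and outside the circle. *)
Lemma lam_param p t : 1 + p != 0 -> (1 + p)%:C ^+ 2 * (1 + (lam p)%:C * param r t ^+ 2) =
  (1 - (p / x)%:C * expi 2 t) * (1 - (p * x)%:C / expi 2 t).
Proof.
move=> p1; rewrite paramE expi2E /lam.
have u0 := expi_neq0 1 t.
have npC : (1 + p)%:C != 0 :> R[i] by rewrite real_complex_eq0.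
have xC : x%:C != 0 :> R[i] by rewrite real_complex_eq0.
have sq (v : R) : (v ^+ 2)%:C = v%:C ^+ 2 :> R[i] by rewrite !expr2 real_complexM.
rewrite !(sq, real_complexM, real_complexV, real_complexN).
have E1 : (1 + p)%:C = 1 + p%:C :> R[i] by rewrite real_complexD.
have E2 : (1 - x)%:C = 1 - x%:C :> R[i] by rewrite real_complexD real_complexN.
move: nxC npC; rewrite E1 E2;  move: (expi 1 t) u0 (p%:C) (x%:C) xC => u u0 P X X0 n1 n2.
by field; rewrite u0 n1 n2 X0.
Qed.

(** The extreme values of Re z^2 on the ellipse are taken at z = r and z = i, where
the factorization of lam_param has positive factors. *)
Lemma lam_bounds p : `|p| < x -> lam p < 1 /\ 0 < 1 + lam p * r ^+ 2.
Proof.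
move=> /[dup] px; rewrite ltr_norml => /andP[p1 p2].
have d : 0 < 1 + p by move: x1; lra.
have A : 0 < (1 + p) ^+ 2 by exact: exprn_gt0.
have bx : `|p| * x < x by rewrite gtr_pMl// (lt_trans px x1).
have [q1 q2] : p * x < 1 /\ - 1 < p * x.
  have : `|p * x| < 1 by rewrite normrM (gtr0_norm x0) (lt_trans bx).
  by rewrite ltr_norml => /andP[].
split.
  rewrite -subr_gt0 -(pmulr_rgt0 _ A).
  have -> : (1 + p) ^+ 2 * (1 - lam p) = (1 + p / x) * (1 + p * x).
    by rewrite /lam; field; rewrite xn0 (gt_eqF d).
  rewrite mulr_gt0//; last by move: q2; lra.
  have : -1 < p / x by rewrite ltr_pdivlMr// mulN1r.
  lra.
rewrite -(pmulr_rgt0 _ A).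
have -> : (1 + p) ^+ 2 * (1 + lam p * r ^+ 2) = (1 - p / x) * (1 - p * x).
  by rewrite /lam /axis; field; rewrite xn0 omx0 (gt_eqF d).
rewrite mulr_gt0//; last by move: q1; lra.
by rewrite subr_gt0 ltr_pdivrMr// mul1r.
Qed.

(** The origin is included because the value there normalizes the test functions. *)
Definition boundary0 : set R[i] := [set z | (exists t, z = param r t) \/ z = 0].

Lemma boundary0_sqr z : boundary0 z ->
  [/\ -1 <= Re (z ^+ 2), Re (z ^+ 2) <= r ^+ 2 & normc z ^+ 2 <= r ^+ 2].
Proof.
have r2 : 1 <= r ^+ 2 by rewrite expr_ge1// ?(ltW axis_gt1)// (le_trans ler01 (ltW axis_gt1)).
case=> [[t ->]|->].
  rewrite sqr_normcRe expr2 Re_mul /= -!expr2 exprMn.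
  have := cos2Dsin2 t; have := sqr_ge0 (cos t); have := sqr_ge0 (sin t).
  by move: (cos t ^+ 2) (sin t ^+ 2) (r ^+ 2) r2 => c s u u1 s0 c0 e; split; nra.
by rewrite normc0 expr0n /=; split; lra.
Qed.

Definition lam_poly p : {poly R[i]} := 1 + (lam p)%:C *: 'X^2.

Lemma lam_polyE p z : (lam_poly p).[z] = 1 + (lam p)%:C * z ^+ 2.
Proof. by rewrite /lam_poly !hornerE. Qed.

Lemma lam_half_plane p : `|p| < x -> exists d B : R, [/\ 0 < d, 0 < B,
  forall z, boundary0 z -> d <= Re (lam_poly p).[z] &
  forall z, boundary0 z -> normc (lam_poly p).[z] <= B].
Proof.
move=> /lam_bounds [l1 l2].
exists (Num.min 1 (Num.min (1 - lam p) (1 + lam p * r ^+ 2))), (1 + `|lam p| * r ^+ 2); split.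
- by rewrite !lt_min ltr01 subr_gt0 l1 l2.
- by rewrite ltr_wpDr// mulr_ge0// sqr_ge0.
- move=> z /boundary0_sqr[z1 z2 _]; rewrite lam_polyE Re_add Re_mul /= mul0r subr0.
  have [l0|l0] := leP 0 (lam p).
    apply: (@le_trans _ _ (1 - lam p)); first by rewrite !ge_min lexx orbT.
    by rewrite lerD2l -mulrN1 ler_wpM2l.
  apply: (@le_trans _ _ (1 + lam p * r ^+ 2)); first by rewrite !ge_min lexx !orbT.
  by rewrite lerD2l ler_wnM2l// ltW.
- move=> z /boundary0_sqr[_ _ z3]; rewrite lam_polyE.
  apply: le_trans (le_normcD _ _) _; rewrite normc1 lerD2l normcM normcR normcX.
  by rewrite ler_wpM2l.
Qed.

Lemma lam_num p : `|p| < x ->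
  sq_approx boundary0 (fun z => 1 + (lam p)%:C * z ^+ 2) /\
  cbounded boundary0 (fun z => 1 + (lam p)%:C * z ^+ 2).
Proof.
move=> /lam_half_plane [d [B [d0 B0 Fd FB]]].
have E : horner (lam_poly p) = fun z => 1 + (lam p)%:C * z ^+ 2.
  by apply/funext => z; exact: lam_polyE.
rewrite -E; split; first exact: sq_approx_horner d0 Fd FB.
by exists B.
Qed.

Lemma lam_den p : `|p| < x ->
  sq_approx boundary0 (fun z => (1 + (lam p)%:C * z ^+ 2) ^- 2) /\
  cbounded boundary0 (fun z => (1 + (lam p)%:C * z ^+ 2) ^- 2).
Proof.
move=> /lam_half_plane [d [B [d0 B0 Fd FB]]].
have E : (fun z => (1 + (lam p)%:C * z ^+ 2) ^- 2) = (fun z => (lam_poly p).[z] ^- 2).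
  by apply/funext => z; rewrite lam_polyE.
rewrite E; split; first exact: sq_approx_inv d0 Fd FB.
exists (d ^- 2) => [|z Kz]; first by rewrite invr_gt0 exprn_gt0.
rewrite normcV normcX lef_pV2 ?posrE ?exprn_gt0//.
  rewrite ler_pXn2r ?nnegrE ?normc_ge0 ?(ltW d0)//.
  by apply: le_trans (Fd _ Kz) _; apply: le_trans (ler_norm _) (Re_le_normc _).
apply: lt_le_trans d0 _.
by apply: le_trans (Fd _ Kz) _; apply: le_trans (ler_norm _) (Re_le_normc _).
Qed.

(** The square of the extremal function z sqrt (phi' (z)) / phi (z), normalized at
0, with truncated products. *)
Definition extremal N z : R[i] :=
  \prod_(m < N.*2.+1) (1 + (lam (x ^+ m.+1.*2))%:C * z ^+ 2) *
  \prod_(n < N) (1 + (lam (- x ^+ n.+1.*2.*2))%:C * z ^+ 2) ^- 2.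

Lemma pow_bound n : `|x ^+ n.+2| < x.
Proof.
by rewrite gtr0_norm ?exprn_gt0// -[ltRHS]expr1 ltr_iXn2l.
Qed.

Lemma extremal_approx N : sq_approx boundary0 (extremal N).
Proof.
have prodP (F : nat -> R[i] -> R[i]) n :
    (forall i, sq_approx boundary0 (F i) /\ cbounded boundary0 (F i)) ->
    sq_approx boundary0 (fun z => \prod_(i < n) F i z) /\
    cbounded boundary0 (fun z => \prod_(i < n) F i z).
  move=> FP; elim: n => [|n [IH1 IH2]].
    have -> : (fun z => \prod_(i < 0) F i z) = fun=> 1 by apply/funext => z; rewrite big_ord0.
    by split; [exact: sq_approx1|exact: cbounded1].
  have -> : (fun z => \prod_(i < n.+1) F i z) = fun z => \prod_(i < n) F i z * F n z.
    by apply/funext => z; rewrite big_ord_recr.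
  have [F1 F2] := FP n.
  by split; [exact: sq_approxM|exact: cboundedM].
have [a1 b1] := prodP (fun m z => 1 + (lam (x ^+ m.+1.*2))%:C * z ^+ 2) N.*2.+1
  (fun m => lam_num (pow_bound m.*2)).
have den n : `|- x ^+ n.+1.*2.*2| < x by rewrite normrN; exact: pow_bound.
have [a2 b2] := prodP (fun n z => (1 + (lam (- x ^+ n.+1.*2.*2))%:C * z ^+ 2) ^- 2) N
  (fun n => lam_den (den n)).
exact: sq_approxM.
Qed.

Lemma extremal0 N : extremal N 0 = 1.
Proof.
rewrite /extremal !big1 ?mulr1// => i _; rewrite expr0n mulr0 addr0//.
by rewrite expr1n invr1.
Qed.

Local Notation q := (x ^+ 2).

Definition norm_const N : R :=
  qpoch q N ^+ 4 / \prod_(m < N.*2.+1) (1 + q ^+ m.+1) ^+ 2.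

Lemma normc_lam p t : 0 < 1 + p ->
  (1 + p) ^+ 2 * normc (1 + (lam p)%:C * param r t ^+ 2) =
  unorm (p / x) t * unorm (p * x) t.
Proof.
move=> p1; have pn0 : 1 + p != 0 by rewrite gt_eqF.
have := congr1 (@normc R) (lam_param t pn0).
by rewrite [X in X = _]normcM [X in _ = X]normcM normcX normcR normc_conj_one_sub gtr0_norm.
Qed.

Lemma unorm_gt0 s t : `|s| < 1 -> 0 < unorm s t.
Proof. by move=> s1; rewrite normc_gt0 one_sub_expi_neq0// normcR. Qed.

Let u m t := unorm (odd_pow x m) t.
Let v m t := unorm (- odd_pow x m) t.

Let u_gt0 m t : 0 < u m t.
Proof. by apply: unorm_gt0; rewrite gtr0_norm ?odd_pow_gt0 ?odd_pow_lt1. Qed.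

Let v_gt0 m t : 0 < v m t.
Proof. by apply: unorm_gt0; rewrite normrN gtr0_norm ?odd_pow_gt0 ?odd_pow_lt1. Qed.

Lemma theta_quotE M t : theta_quot x M t = \prod_(m < M) (u m t ^+ 2 / v m t ^+ 2).
Proof.
apply: eq_bigr => m _; rewrite /gquot /u /v /unorm.
by rewrite real_complexN mulNr opprK.
Qed.

Lemma normc_num_factor m t :
  normc (1 + (lam (x ^+ m.+1.*2))%:C * param r t ^+ 2) =
  u m t * u m.+1 t / (1 + q ^+ m.+1) ^+ 2.
Proof.
have p0 : 0 < 1 + x ^+ m.+1.*2 by rewrite addr_gt0// exprn_gt0.
have := normc_lam t p0.
have -> : x ^+ m.+1.*2 / x = odd_pow x m by rewrite doubleS exprSr mulfK.
have -> : x ^+ m.+1.*2 * x = odd_pow x m.+1 by rewrite -exprSr.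
rewrite -/(u m t) -/(u m.+1 t) => <-.
have -> : q ^+ m.+1 = x ^+ m.+1.*2 by rewrite -exprM mul2n.
by field; rewrite gt_eqF.
Qed.

Lemma normc_den_factor n t :
  normc ((1 + (lam (- x ^+ n.+1.*2.*2))%:C * param r t ^+ 2) ^- 2) =
  (1 - q ^+ n.+1.*2) ^+ 4 / (v n.*2.+1 t * v n.*2.+2 t) ^+ 2.
Proof.
have p1 : x ^+ n.+1.*2.*2 < 1 by rewrite exprn_ilt1// ltW.
have p0 : 0 < 1 + - x ^+ n.+1.*2.*2 by rewrite subr_gt0.
have := normc_lam t p0; rewrite !mulNr.
have -> : x ^+ n.+1.*2.*2 / x = odd_pow x n.*2.+1.
  have -> : n.+1.*2.*2 = (n.*2.+1).*2.+2 by lia.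
  by rewrite exprSr mulfK.
have -> : x ^+ n.+1.*2.*2 * x = odd_pow x n.*2.+2 by rewrite -exprSr.
rewrite -/(v n.*2.+1 t) -/(v n.*2.+2 t) => <-.
have -> : q ^+ n.+1.*2 = x ^+ n.+1.*2.*2 by rewrite -exprM mul2n.
rewrite normcV normcX; set w := normc _.
have w0 : w != 0.
  apply/eqP => w0; have := mulr_gt0 (v_gt0 n.*2.+1 t) (v_gt0 n.*2.+2 t).
  have := normc_lam t p0; rewrite !mulNr.
  have -> : x ^+ n.+1.*2.*2 / x = odd_pow x n.*2.+1.
    have -> : n.+1.*2.*2 = (n.*2.+1).*2.+2 by lia.
  by rewrite exprSr mulfK.
  have -> : x ^+ n.+1.*2.*2 * x = odd_pow x n.*2.+2 by rewrite -exprSr.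
  by rewrite -/w w0 mulr0 /v => <-; rewrite ltxx.
by field; rewrite w0 gt_eqF.
Qed.

Lemma normc_prod (I : Type) (s : seq I) (F : I -> R[i]) :
  normc (\prod_(i <- s) F i) = \prod_(i <- s) normc (F i).
Proof. by apply: big_morph; [exact: normcM|exact: normc1]. Qed.

(** On the circle |1 - s / y| = |1 - s y|, which turns the factors of extremal into
squares: neighbouring factors with p = x^(2m) share one term, |dz| and |z|^2 supply
the terms that are missing at the lower end, and one term is left over at the
upper end. *)
Lemma normc_extremal N t :
  normc (extremal N (param r t)) * normc (dparam r t) / normc (param r t) ^+ 2 =
  (1 - x) * norm_const N * unorm (odd_pow x N.*2.+1) t * theta_quot x N.*2.+1 t.
Proof.
rewrite /extremal normcM !normc_prod normc_dparam normc_param.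
under eq_bigr do rewrite normc_num_factor.
under [X in _ * X * _ / _]eq_bigr do rewrite normc_den_factor.
rewrite theta_quotE -/(u N.*2.+1 t) -[x in unorm x t]expr1 -/(u 0 t).
rewrite -[x in unorm (- x) t]expr1 -/(v 0 t) /norm_const.
have un0 m : u m t != 0 by rewrite gt_eqF.
have vn0 m : v m t != 0 by rewrite gt_eqF.
have cn0 m : 1 + q ^+ m.+1 != 0.
  by rewrite gt_eqF// addr_gt0// exprn_gt0// exprn_gt0.
have P1 M : \prod_(m < M) (u m t * u m.+1 t / (1 + q ^+ m.+1) ^+ 2) * u 0 t =
    (\prod_(m < M) u m t ^+ 2) * u M t / \prod_(m < M) (1 + q ^+ m.+1) ^+ 2.
  elim: M => [|M IH]; first by rewrite !big_ord0 divr1.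
  rewrite !big_ord_recr /= mulrAC IH.
  have : \prod_(m < M) (1 + q ^+ m.+1) ^+ 2 != 0.
    by apply/prodf_neq0 => i _; rewrite expf_neq0.
  by move=> n0; field; rewrite n0 cn0.
have P2 n : \prod_(n < n) ((1 - q ^+ n.+1.*2) ^+ 4 / (v n.*2.+1 t * v n.*2.+2 t) ^+ 2) /
    v 0 t ^+ 2 = qpoch q n ^+ 4 / \prod_(m < n.*2.+1) v m t ^+ 2.
  elim: n => [|n IH].
    by rewrite /qpoch !big_ord0 big_ord_recr big_ord0 /= expr1n !mul1r.
  rewrite big_ord_recr /= mulrAC IH qpochS doubleS !(big_ord_recr n.*2.+2) (big_ord_recr n.*2.+1) /=.
  have : \prod_(m < n.*2.+1) v m t ^+ 2 != 0.
    by apply/prodf_neq0 => i _; rewrite expf_neq0.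
  by move=> n0; field; rewrite n0 !vn0.
have P3 M : \prod_(m < M) (u m t ^+ 2 / v m t ^+ 2) =
    (\prod_(m < M) u m t ^+ 2) / (\prod_(m < M) v m t ^+ 2).
  by rewrite -prodf_div.
have := P1 N.*2.+1; have := P2 N; rewrite P3.
move: (\prod_(i < N) _) (\prod_(m < N.*2.+1) (u m t * _ / _)) => B A.
have : \prod_(m < N.*2.+1) (1 + q ^+ m.+1) ^+ 2 != 0.
  by apply/prodf_neq0 => i _; rewrite expf_neq0.
have : \prod_(m < N.*2.+1) v m t ^+ 2 != 0.
  by apply/prodf_neq0 => i _; rewrite expf_neq0.
move: (\prod_(m < _) v m t ^+ 2) (\prod_(m < _) (1 + _) ^+ 2) (\prod_(m < _) u m t ^+ 2).
move=> VV CC UU VV0 CC0 HB HA.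
transitivity ((A * u 0 t) * (B / v 0 t ^+ 2) * (1 - x)).
  by field; rewrite omx0 vn0.
by rewrite HA HB; field; rewrite VV0 CC0.
Qed.

End Extremal.

(** * The norm of the extremal function *)

Section ExtremalNorm.
Variable R : realType.
Local Notation mu := (@lebesgue_measure R).
Local Notation Re := (@complex.Re R).
Local Notation Im := (@complex.Im R).
Variables (x : R) (x0 : 0 < x) (x1 : x < 1).
Local Notation r := (axis x).
Local Notation q := (x ^+ 2).
Let q0 : 0 < q. Proof. exact: exprn_gt0. Qed.
Let q1 : q < 1. Proof. by rewrite exprn_ilt1// ltW. Qed.
Let r1 : 1 < r := axis_gt1 x0 x1.
Let pi2 := twopi_gt0 R.

Definition extremal_norm N : R := \int[mu]_(t in `[0%R, (2 * pi)%R])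
  (normc (extremal x N (param r t)) * normc (dparam r t) / normc (param r t) ^+ 2).

Lemma unorm_le (s t : R) : 0 <= s -> unorm s t <= 1 + s.
Proof.
move=> s0; apply: le_trans (le_normcD _ _) _.
by rewrite normcN normc1 normcM normcR normc_expi mulr1 ger0_norm.
Qed.

Lemma continuous_unorm (s : R) : continuous (unorm s).
Proof.
apply: (@continuous_normc R (fun t => 1 - s%:C * expi 2 t)); apply: ccontinuousB; first exact: ccontinuous_cst.
by apply: ccontinuousM; [exact: ccontinuous_cst|exact: ccontinuous_expi].
Qed.

Lemma continuous_extremal_weight N : continuous (fun t =>
  normc (extremal x N (param r t)) * normc (dparam r t) / normc (param r t) ^+ 2).
Proof.
rewrite (funext (normc_extremal x0 x1 N)) => t.
apply: cvgM; last exact: (continuous_theta_quot x0 x1).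
by apply: cvgM; [exact: cst_continuous|exact: continuous_unorm].
Qed.

Lemma prod_one_sub N : \prod_(m < N.*2) (1 - q ^+ m.+1) = odd_poch q N * qpoch q N.
Proof.
elim: N => [|N IH]; first by rewrite /odd_poch /qpoch !big_ord0 mulr1.
rewrite doubleS !big_ord_recr /= IH /odd_poch big_ord_recr /= qpochS.
by rewrite doubleS; ring.
Qed.

(** The factors 1 + q^m cancel; what remains is a partial product of the square of
the product for Ramanujan's psi at q. *)
Lemma norm_const_euler N :
  norm_const x N * (euler_quot x N.*2 * euler_quot x N.*2.+1) =
  (qpoch q N / odd_poch q N) ^+ 2 / (1 - q ^+ N.*2.+1 ^+ 2).
Proof.
have eE M : euler_quot x M = \prod_(m < M) (1 + q ^+ m.+1) / \prod_(m < M) (1 - q ^+ m.+1).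
  rewrite -prodf_div; apply: eq_bigr => m _.
  by have -> : x ^+ m.+1.*2 = q ^+ m.+1 by rewrite -exprM mul2n.
rewrite !eE /norm_const prodrXl !(big_ord_recr N.*2) /= prod_one_sub.
have o0 : odd_poch q N != 0 by rewrite gt_eqF ?odd_poch_gt0.
have p0 : qpoch q N != 0 by rewrite gt_eqF ?qpoch_gt0.
have c1 : q ^+ N.*2.+1 < 1 by rewrite exprn_ilt1// ltW.
have c0 : 0 < q ^+ N.*2.+1 by rewrite exprn_gt0.
have : \prod_(m < N.*2) (1 + q ^+ m.+1) != 0.
  by apply/prodf_neq0 => i _; rewrite gt_eqF// addr_gt0// exprn_gt0.
move: (odd_poch q N) (qpoch q N) (q ^+ N.*2.+1) (\prod_(m < N.*2) _) o0 p0 c0 c1.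
move=> o p c A o0 p0 c0 c1 A0.
have c2 : 1 - c != 0 by rewrite gt_eqF// subr_gt0.
have c3 : 1 + c != 0 by rewrite gt_eqF// addr_gt0.
have -> : 1 - c ^+ 2 = (1 - c) * (1 + c) by ring.
by field; rewrite o0 p0 c2 c3 A0.
Qed.

Lemma extremal_norm_le N : (0 < N)%N ->
  trunc_err x N.*2 <= 2 -> q ^+ N.+1.*2 / (1 - q ^+ 2) <= 1 ->
  (2 - trunc_err x N.*2) * (1 - q ^+ N.+1.*2 / (1 - q ^+ 2)) ^+ 2 *
    (1 - q ^+ N.*2.+1 ^+ 2) * extremal_norm N <=
  4 * pi * (1 - x) * (1 + odd_pow x N.*2.+1) * (1 + q ^+ N.*2) *
    (theta3 0 q * psi q).
Proof.
move=> N0 e2 e1.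
have C0 : 0 <= norm_const x N.
  rewrite divr_ge0 ?exprn_ge0 ?(ltW (qpoch_gt0 q0 q1 _))//.
  by apply: prodr_ge0 => i _; exact: sqr_ge0.
have h1 : extremal_norm N <= (1 - x) * norm_const x N * (1 + odd_pow x N.*2.+1) *
    \int[mu]_(t in `[0%R, (2 * pi)%R]) theta_quot x N.*2.+1 t.
  have cq := continuous_theta_quot x0 x1 (M := N.*2.+1).
  rewrite -RintegralZl//; last exact: integrable_continuous.
  apply: le_Rintegral => //.
  - exact/integrable_continuous/continuous_extremal_weight.
  - apply: integrable_continuous => t.
    by apply: cvgM; [exact: cst_continuous|exact: cq].
  - move=> t _; rewrite normc_extremal// ler_wpM2r ?theta_quot_ge0//.
    have A0 : 0 <= (1 - x) * norm_const x N by rewrite mulr_ge0// subr_ge0 ltW.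
    by rewrite ler_wpM2l// unorm_le// ltW// odd_pow_gt0.
have h2 := theta_quot_mean x0 x1 N.*2.
have h3 := theta_product_le q0 q1 N0.
have h4 := qpoch_ratio_ge q0 q1 N.
have h5 := norm_const_euler N.
have o0 : 0 < odd_poch q N by exact: odd_poch_gt0.
have p0 : 0 < qpoch q N by exact: qpoch_gt0.
have p'0 : 0 < qpoch q N.*2 by exact: qpoch_gt0.
have w0 : 0 <= odd_pow x N.*2.+1 by rewrite ltW// odd_pow_gt0.
have c1 : q ^+ N.*2.+1 < 1 by rewrite exprn_ilt1// ltW.
have c0 : 0 < q ^+ N.*2.+1 by rewrite exprn_gt0.
move: h1 h2 h3 h4 h5 e2 e1 C0 o0 p0 p'0 w0 c0 c1.
move: (trunc_err _ _) (q ^+ N.+1.*2 / (1 - q ^+ 2)) (extremal_norm N) (Rintegral _ _ _).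
move: (odd_pow _ _) (norm_const _ _) (euler_quot x N.*2) (euler_quot x N.*2.+1).
move: (qpoch q N) (qpoch q N.*2) (odd_poch q N) (q ^+ N.*2.+1) (q ^+ N.*2) (theta3 0 q * psi q).
move=> p p' o c d T w C E E' eta eps X I h1 h2 h3 h4 h5 e2 e1 C0 o0 p0 p'0 w0 c0 c1.
have omx : 0 <= 1 - x by rewrite subr_ge0 ltW.
have cc : 0 < 1 - c ^+ 2 by rewrite subr_gt0 expr_lt1// ltW.
have k1 : (2 - eta) * X <= (1 - x) * C * (1 + w) * (4 * pi * (E * E')).
  apply: (@le_trans _ _ ((1 - x) * C * (1 + w) * ((2 - eta) * I))).
    rewrite mulrCA ler_wpM2l ?subr_ge0//.
  by rewrite ler_wpM2l// !mulr_ge0 ?omx ?(addr_ge0 ler01 w0).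
have k2 : (1 - eps) ^+ 2 * (p / o) ^+ 2 <= (1 + d) * T.
  have k3 : (1 - eps) * (p / o) <= p' / o.
    by rewrite mulrA ler_pM2r ?invr_gt0// -ler_pdivlMr.
  apply: le_trans h3; rewrite -exprMn ler_pXn2r// nnegrE.
    by rewrite mulr_ge0 ?subr_ge0 ?divr_ge0 ?(ltW p0) ?(ltW o0).
  by rewrite divr_ge0 ?(ltW p'0) ?(ltW o0).
have -> : (2 - eta) * (1 - eps) ^+ 2 * (1 - c ^+ 2) * X =
  (2 - eta) * X * ((1 - eps) ^+ 2 * (1 - c ^+ 2)) by ring.
apply: (@le_trans _ _ ((1 - x) * C * (1 + w) * (4 * pi * (E * E')) *
   ((1 - eps) ^+ 2 * (1 - c ^+ 2)))).
  by rewrite ler_wpM2r// mulr_ge0 ?sqr_ge0 ?(ltW cc).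
have -> : (1 - x) * C * (1 + w) * (4 * pi * (E * E')) * ((1 - eps) ^+ 2 * (1 - c ^+ 2)) =
  4 * pi * (1 - x) * (1 + w) * ((1 - eps) ^+ 2 * (C * (E * E') * (1 - c ^+ 2))) by ring.
rewrite h5 divfK ?gt_eqF// -[leRHS]mulrA ler_wpM2l//.
by rewrite !mulr_ge0 ?omx ?(addr_ge0 ler01 w0) ?pi_ge0.
Qed.

Let leq_expo N : [/\ (N <= N.*2.+1.*2.+1)%N, (N <= N.*2.*2.+1)%N,
  (N <= N.+1.*2.*2)%N, (N <= N.*2.+1.*2 * 2)%N & (N <= N.*2.*2)%N].
Proof. by split; lia. Qed.

(** Each truncation error is at most K x^N for the constant K below. *)
Lemma extremal_norm_lim (d : R) : 0 < d -> exists N,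
  extremal_norm N <= 2 * pi * (1 - x) * (theta3 0 q * psi q) * (1 + d).
Proof.
(* e satisfies (1 + e)^2 <= (1 + d) (1 - 4 e). *)
move=> d0; pose e := d / (7 + 4 * d); pose K := 1 + 4 / (1 - x) ^+ 2 + 1 / (1 - q ^+ 2).
have d4 : 0 < 7 + 4 * d by rewrite addr_gt0// mulr_gt0.
have e0 : 0 < e by rewrite divr_gt0.
have e4 : e <= 4^-1 by rewrite /e ler_pdivrMr//; lra.
have omx : 0 < 1 - x by rewrite subr_gt0.
have qq : 0 < 1 - q ^+ 2 by rewrite subr_gt0 exprn_ilt1// ltW.
have k1 : 0 <= 4 / (1 - x) ^+ 2 by rewrite divr_ge0// sqr_ge0.
have k2 : 0 <= 1 / (1 - q ^+ 2) by rewrite divr_ge0// ltW.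
have [N N0 KN] : exists2 N, (0 < N)%N & K * x ^+ N <= e.
  have cv : (fun n => K * x ^+ n) @ \oo --> (0 : R).
    rewrite -[X in _ --> X](mulr0 K); apply: cvgM; first exact: cvg_cst.
    by apply: cvg_expr; rewrite gtr0_norm.
  have /cvgrPdist_le /(_ e e0) [n _ /(_ n.+1 (leqnSn n))] := cv.
  by rewrite sub0r normrN => /(le_trans (ler_norm _)); exists n.+1.
exists N; have [n1 n2 n3 n4 n5] := leq_expo N; have xN : 0 < x ^+ N by rewrite exprn_gt0.
have le_xN n : (N <= n)%N -> x ^+ n <= x ^+ N by move=> Nn; rewrite ler_wiXn2l// ltW.
have qE n : q ^+ n = x ^+ n.*2 by rewrite -exprM mul2n.
have xe : x ^+ N <= e.
  by apply: le_trans KN; rewrite ler_peMl ?(ltW xN)// /K; lra.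
have err1 : trunc_err x N.*2 <= e.
  apply: le_trans KN; rewrite /trunc_err.
  have o1 : odd_pow x N.*2.+1 <= x ^+ N by rewrite /odd_pow le_xN.
  have o2 : odd_pow x N.*2 <= x ^+ N by rewrite /odd_pow le_xN.
  have o3 m : 1 - x <= 1 - odd_pow x m.
    by rewrite lerD2l lerN2 -[leRHS]expr1 ler_wiXn2l// ltW.
  apply: (@le_trans _ _ (4 * x ^+ N / (1 - x) ^+ 2)); last first.
    rewrite mulrAC /K; move: (4 / _) (1 / _) k1 k2 => u v u0 v0; nra.
  apply: ler_pM.
  - by rewrite mulr_ge0// addr_ge0// ltW// odd_pow_gt0.
  - by rewrite invr_ge0 mulr_ge0// (le_trans (ltW omx)).
  - lra.
  - rewrite lef_pV2 ?posrE ?exprn_gt0// ?mulr_gt0// ?(lt_le_trans omx)//.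
    by rewrite expr2 ler_pM// ltW.
have err2 : q ^+ N.+1.*2 / (1 - q ^+ 2) <= e.
  apply: le_trans KN; apply: (@le_trans _ _ (x ^+ N / (1 - q ^+ 2))).
    by rewrite ler_pM2r ?invr_gt0// qE le_xN.
  rewrite -[x ^+ N in leLHS]mul1r mulrAC /K.
  move: (4 / _) (1 / _) k1 k2 => u v u0 v0; nra.
have := extremal_norm_le N0 (le_trans err1 _) (le_trans err2 _).
have err3 : q ^+ N.*2.+1 ^+ 2 <= e.
  by apply: le_trans xe; rewrite qE -exprM le_xN.
have err4 : odd_pow x N.*2.+1 <= e by apply: le_trans xe; rewrite /odd_pow le_xN.
have err5 : q ^+ N.*2 <= e by apply: le_trans xe; rewrite qE le_xN.
have T0 : 0 < theta3 0 q * psi q by rewrite mulr_gt0 ?theta3_gt0 ?psi_gt0.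
have X0 : 0 <= extremal_norm N.
  by apply: Rintegral_ge0 => t _; rewrite divr_ge0 ?mulr_ge0 ?normc_ge0 ?sqr_ge0.
have w0 : 0 <= odd_pow x N.*2.+1 by rewrite ltW// odd_pow_gt0.
have c0 : 0 <= q ^+ N.*2 by rewrite exprn_ge0// ltW.
have ed : (1 + e) ^+ 2 * 2 <= (1 + d) * ((2 - e) * (1 - e) ^+ 2 * (1 - e)).
  have de : d = 7 * e + 4 * d * e by rewrite /e; field; rewrite gt_eqF.
  have h1 : (1 + e) ^+ 2 <= 1 + 3 * e by nra.
  have h2 : 1 - 4 * e <= (1 - e / 2) * (1 - e) ^+ 2 * (1 - e) by nra.
  nra.
move: ed err1 err2 err3 err4 err5 T0 X0 w0 c0.
move: (trunc_err _ _) (q ^+ N.+1.*2 / (1 - q ^+ 2)) (extremal_norm N) (odd_pow _ _).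
move: (theta3 0 q * psi q) (q ^+ N.*2.+1 ^+ 2) (q ^+ N.*2).
move=> T c a eta eps X w ed err1 err2 err3 err4 err5 T0 X0 w0 a0 main.
have m1 : 0 < (2 - e) * (1 - e) ^+ 2 * (1 - e).
  by rewrite !mulr_gt0 ?exprn_gt0//; lra.
rewrite -(ler_pM2l m1).
have g1 : (2 - e) * (1 - e) ^+ 2 * (1 - e) * X <=
    (2 - eta) * (1 - eps) ^+ 2 * (1 - c) * X.
  rewrite ler_wpM2r// ler_pM ?mulr_ge0 ?sqr_ge0//; try lra.
  rewrite ler_pM ?sqr_ge0//; try lra.
  by rewrite ler_pXn2r ?nnegrE//; lra.
apply: le_trans g1 _; apply: le_trans (main _ _) _; try lra.
have g2 : (1 + w) * (1 + a) <= (1 + e) ^+ 2 by rewrite expr2 ler_pM//; lra.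
have c1 : 0 < 2 * pi * (1 - x) * T by rewrite !mulr_gt0 ?pi_gt0.
have -> : 4 * pi * (1 - x) * (1 + w) * (1 + a) * T =
  2 * pi * (1 - x) * T * ((1 + w) * (1 + a) * 2) by ring.
have -> : (2 - e) * (1 - e) ^+ 2 * (1 - e) * (2 * pi * (1 - x) * T * (1 + d)) =
  2 * pi * (1 - x) * T * ((1 + d) * ((2 - e) * (1 - e) ^+ 2 * (1 - e))) by ring.
rewrite ler_pM2l//; apply: le_trans ed.
by rewrite ler_pM2r.
Qed.

(** The squared norm of 1 / z. *)
Definition inv_norm : R := \int[mu]_(t in `[0%R, (2 * pi)%R])
  (normc (dparam r t) / normc (param r t) ^+ 2).

Lemma continuous_inv_norm :
  continuous (fun t => normc (dparam r t) / normc (param r t) ^+ 2).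
Proof.
move=> t; apply: cvgM; first exact: continuous_normc (ccontinuous_dparam r) t.
apply: cvgV; first by rewrite expf_neq0// normc_eq0 param_neq0.
under eq_fun do rewrite sqr_normcRe; rewrite sqr_normcRe.
exact: continuous_sqr_normc (ccontinuous_param r) t.
Qed.

Lemma sqr_norm_inv beta : sqr_norm r (test_fun 0 beta) = normc beta ^+ 2 * inv_norm.
Proof.
rewrite -RintegralZl//; last exact/integrable_continuous/continuous_inv_norm.
apply: eq_Rintegral => t _.
rewrite /test_fun horner0 add0r normcM normcV exprMn exprVn.
by rewrite -mulrA [_^-1 * _]mulrC.
Qed.

Lemma inv_norm_gt0 : 0 < inv_norm.
Proof.
have := sqr_norm_inv 1; rewrite normc1 expr1n mul1r => <-.
have r0 : 0 < r by apply: lt_trans r1.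
apply: (@sqr_norm_gt0 _ _ r1 _ r^-1); rewrite ?invr_gt0//; first exact: ccontinuous_test.
move=> t; rewrite /test_fun horner0 add0r normcM normc1 mul1r normcV lef_pV2 ?posrE//.
  rewrite -(@ler_pXn2r _ 2)// ?nnegrE ?normc_ge0 ?(ltW r0)//.
  by have [|_ _ ->] := @boundary0_sqr _ _ x0 x1 (param r t); first by left; exists t.
by rewrite normc_gt0 param_neq0.
Qed.

Lemma horner_split (P : {poly R[i]}) : exists Q, P = Q * 'X + (P.[0])%:P.
Proof.
elim/poly_ind: P => [|P c _]; first by exists 0; rewrite horner0 polyC0 mul0r addr0.
by exists P; rewrite hornerMXaddC mulr0 add0r.
Qed.

(** If P^2 is close to the extremal function on the ellipse and at 0, then P(z) / z
is a test function whose pole has a coefficient close to 1. *)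
Lemma test_fun_norm_le (V : R) : 2 * pi * (1 - x) * (theta3 0 q * psi q) < V ->
  exists P beta, beta != 0 /\
    sqr_norm r (test_fun P beta) <= normc beta ^+ 2 * V.
Proof.
set V0 := 2 * pi * _ * _ => VV.
have V00 : 0 < V0.
  by rewrite !mulr_gt0 ?pi_gt0 ?subr_gt0 ?theta3_gt0 ?psi_gt0.
have d0 : 0 < (V - V0) / (2 * V0) by rewrite divr_gt0 ?subr_gt0// mulr_gt0.
have [N] := extremal_norm_lim d0; rewrite -/V0.
have -> : V0 * (1 + (V - V0) / (2 * V0)) = (V + V0) / 2 by field; rewrite gt_eqF.
move=> DN; have W0 := inv_norm_gt0.
pose e := (V - V0) / (2 * (V + inv_norm)).
have VW : 0 < V + inv_norm by rewrite addr_gt0// (lt_trans V00).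
have e0 : 0 < e by rewrite divr_gt0 ?subr_gt0// mulr_gt0.
have e1 : e < 1 by rewrite /e ltr_pdivrMr ?mulr_gt0//; lra.
have [P HP] := extremal_approx x0 x1 N e0.
have [Q PE] := horner_split P; set b := P.[0] in PE.
have b1 : 1 - e <= normc b ^+ 2.
  have h := HP 0 (or_intror erefl); rewrite extremal0 normcB in h.
  have := le_normc_sub 1 (1 - P.[0] ^+ 2); rewrite opprB [1 + (_ - 1)]addrC subrK normc1 normcX -/b.
  by move: h; rewrite -/b; lra.
exists Q, b; split.
  apply/eqP => b0; move: b1; rewrite b0 normc0 expr0n /=; lra.
apply: (@le_trans _ _ (extremal_norm N + e * inv_norm)).
  have cw := continuous_inv_norm; have ce := @continuous_extremal_weight N.
  rewrite -RintegralZl//; last exact: integrable_continuous.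
  rewrite -RintegralD//; last 2 first.
  - exact: integrable_continuous.
  - by apply: integrable_continuous => t; apply: cvgM; [exact: cst_continuous|exact: cw].
  have ct := ccontinuous_test r1 Q b.
  apply: le_Rintegral => //.
  - apply: integrable_continuous => t; under eq_fun do rewrite sqr_normcRe.
    apply: cvgM; first exact: continuous_sqr_normc ct t.
    exact: continuous_normc (ccontinuous_dparam r) t.
  - apply: integrable_continuous => t; apply: cvgD; first exact: ce.
    by apply: cvgM; [exact: cst_continuous|exact: cw].
  move=> t _; have z0 := param_neq0 r1 t.
  have -> : test_fun Q b (param r t) = P.[param r t] / param r t.
    by rewrite PE hornerMXaddC /test_fun; field.
  rewrite normcM normcV; set Z := normc (param r t); set D := normc (dparam r t).
  have Z0 : Z != 0 by rewrite normc_eq0.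
  have -> : (normc P.[param r t] / Z) ^+ 2 * D =
      normc (P.[param r t] ^+ 2) * (D / Z ^+ 2) by rewrite normcX; field.
  have -> : normc (extremal x N (param r t)) * D / Z ^+ 2 + e * (D / Z ^+ 2) =
      (normc (extremal x N (param r t)) + e) * (D / Z ^+ 2) by ring.
  rewrite ler_wpM2r ?mulr_ge0 ?invr_ge0 ?sqr_ge0 ?normc_ge0//.
  have := HP (param r t) (or_introl (ex_intro _ t erefl)).
  have := le_normcD (P.[param r t] ^+ 2 - extremal x N (param r t)) (extremal x N (param r t)).
  by rewrite subrK; lra.
have V1 : 0 < V by apply: lt_trans VV.
apply: (@le_trans _ _ ((1 - e) * V)); last by rewrite ler_wpM2r// ltW.
have eE : e * (V + inv_norm) = (V - V0) / 2 by rewrite /e; field; rewrite gt_eqF.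
by move: eE DN; lra.
Qed.

End ExtremalNorm.

(** * Elliptic integrals *)

Section SineSubstitution.
Variable R : realType.
Local Notation mu := (@lebesgue_measure R).
Implicit Types (t b : R) (G g : R -> R).

Lemma sub_itv01_measurable G : (forall t, -1 < t < 1 -> {for t, continuous G}) ->
  measurable_fun (`[0, 1[%classic : set R) G.
Proof.
move=> cG; apply: (@measurable_funS _ _ _ _ (`]-1, 1[%classic : set R)) => //.
  by apply: subset_itvr; rewrite bnd_simp ltrN10.
by apply: open_continuous_measurable_fun => // t; rewrite inE /= in_itv /=; exact: cG.
Qed.

Lemma integral_sin_subst b G g : 0 < b < pi / 2 ->
  (forall t, -1 < t < 1 -> {for t, continuous G}) ->
  (forall t, 0 <= t < pi / 2 -> G (sin t) * cos t = g t) ->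
  (\int[mu]_(t in `[0%R, (sin b)%R]) (G t)%:E = \int[mu]_(t in `[0%R, b]) (g t)%:E)%E.
Proof.
move=> /andP[b0 b1] cG Gg.
have pi0 := pi_gt0 R.
have dsin : (sin^`() = cos :> (R -> R))%classic.
  by apply/funext => t; rewrite derive1E; case: (is_derive_sin t).
have csin : continuous (@cos R) by exact: continuous_cos.
have sinb1 : sin b < 1.
  rewrite -(sin_pihalf R) ltr_sin// in_itv/=; apply/andP; split; lra.
rewrite -{1}(sin0 R) (@integration_by_substitution_increasing _ (@sin R)) ?(ltW b0)//.
- apply: eq_integral => t; rewrite inE /= in_itv /= => /andP[t0 tb].
  by rewrite dsin /= -(Gg t)// t0 (le_lt_trans tb).
- move=> u v; rewrite !in_itv/= => /andP[u0 ub] /andP[v0 vb] uv.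
  by rewrite ltr_sin// in_itv/=; apply/andP; split; lra.
- by rewrite dsin => t _; exact: csin.
- by rewrite dsin; apply: cvgP; apply: cvg_at_right_filter; exact: csin.
- by rewrite dsin; apply: cvgP; apply: cvg_at_left_filter; exact: csin.
- exact: is_derive1_LRcontinuous (@is_derive_sin R).
- rewrite sin0; apply: continuous_in_subspaceT => t; rewrite inE /= in_itv /= => /andP[t0 tb].
  by apply: cG; apply/andP; split; lra.
Qed.

(** G may be unbounded near 1; the interval is exhausted by the images under sine of
compact intervals. *)
Lemma integral_sin_subst_le G g :
  (forall t, -1 < t < 1 -> {for t, continuous G}) ->
  (forall t, 0 <= t < 1 -> 0 <= G t) -> continuous g -> (forall t, 0 <= g t) ->
  (forall t, 0 <= t < pi / 2 -> G (sin t) * cos t = g t) ->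
  (\int[mu]_(t in `[0%R, 1%R[) (G t)%:E <=
   \int[mu]_(t in `[0%R, (pi / 2)%R]) (g t)%:E)%E.
Proof.
move=> cG G0 cg g0 Gg; have pi0 := pi_gt0 R.
pose b n : R := pi / 2 - pi / 2 / n.+2%:R.
have bn n : 0 < b n < pi / 2.
  have n2 : 1 < n.+2%:R :> R by rewrite ltr1n.
  have h : 0 < pi / 2 / n.+2%:R :> R by rewrite !divr_gt0.
  have h2 : pi / 2 / n.+2%:R < pi / 2 :> R.
    by rewrite ltr_pdivrMr// ltr_pMr// divr_gt0.
  rewrite /b; move: (_ / n.+2%:R) h h2 => u h h2; apply/andP; split; lra.
have bS m n : (m <= n)%N -> b m <= b n.
  by move=> mn; rewrite /b lerD2l lerN2 ler_pM2l ?divr_gt0// lef_pV2 ?posrE// ler_nat !ltnS.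
have sinle u v : - (pi / 2) <= u -> v <= pi / 2 -> u <= v -> sin u <= sin v :> R.
  move=> u0 v0; rewrite le_eqVlt => /predU1P[->//|uv]; apply: ltW.
  by rewrite ltr_sin// in_itv/=; apply/andP; split; lra.
pose F n : set R := `[0, sin (b n)]%classic.
have sinb n : sin (b n) < 1.
  move: (b n) (bn n) => u /andP[u0 u1]; rewrite -(sin_pihalf R).
  by rewrite ltr_sin// in_itv/=; apply/andP; split; lra.
have FU : \bigcup_i F i = `[0, 1[%classic.
  apply/seteqP; split => [t [n _]|t].
    by rewrite /F /= !in_itv/= => /andP[-> tb]; exact: le_lt_trans (sinb n).
  rewrite /= in_itv/= => /andP[t0 t1].
  have at1 : asin t < pi / 2 by apply: asin_ltpi2; rewrite t1 andbT; lra.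
  have d0 : 0 < pi / 2 - asin t by rewrite subr_gt0.
  have [n _ nh] : \forall n \near \oo, pi / 2 / n.+2%:R <= pi / 2 - asin t.
    near=> n; rewrite ler_pdivrMr// -ler_pdivrMl//.
    apply: (@le_trans _ _ n%:R); last by rewrite ler_nat -addn2 leq_addr.
    near: n; exact: nbhs_infty_ger.
  exists n => //; rewrite /F /= in_itv/= t0 /=.
  rewrite -[leLHS](@asinK R) ?in_itv/=; last by apply/andP; split; lra.
  have at0 : - (pi / 2) <= asin t by apply: asin_geNpi2; apply/andP; split; lra.
  have := nh n (leqnn n) => hn.
  have bb := bn n.
  apply: sinle => //; first by case/andP: bb => _ /ltW.
  by move: hn; rewrite /b; move: (_ / n.+2%:R) => u; lra.
rewrite -FU; have ndF : nondecreasing_seq F.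
  move=> m n mn; rewrite subsetEset => t; rewrite /F /= !in_itv/= => /andP[-> tb] /=.
  apply: le_trans tb _; apply: sinle (bS _ _ mn).
    by move: (b m) (bn m) => u /andP[u0 _]; lra.
  by case/andP: (bn n) => _ /ltW.
have mG n : measurable_fun (F n) (EFin \o G).
  apply/measurable_EFinP; apply: measurable_funS (sub_itv01_measurable cG) => //.
  by rewrite -FU; exact: bigcup_sup.
have cv : (\int[mu]_(t in F i) (G t)%:E)%E @[i --> \oo] -->
    (\int[mu]_(t in \bigcup_i F i) (G t)%:E)%E.
  apply: ge0_nondecreasing_set_cvg_integral => //.
    by move=> n; exact: measurable_itv.
  move=> n t Ft; rewrite lee_fin G0//.
  have : (\bigcup_i F i) t by exists n.
  by rewrite FU /= in_itv.
rewrite -(cvg_lim _ cv)//; apply: lime_le; first exact: cvgP cv.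
near=> n; rewrite /F /= (integral_sin_subst (bn n) cG Gg).
apply: ge0_subset_integral => //.
- apply/measurable_EFinP/measurable_funTS; exact: continuous_measurable_fun.
- by move=> t _; rewrite lee_fin.
- by apply: subset_itvl; rewrite bnd_simp; have /andP[_ /ltW] := bn n.
Unshelve. all: by end_near. Qed.

Lemma integrable_sin_subst G g :
  (forall t, -1 < t < 1 -> {for t, continuous G}) ->
  (forall t, 0 <= t < 1 -> 0 <= G t) -> continuous g -> (forall t, 0 <= g t) ->
  (forall t, 0 <= t < pi / 2 -> G (sin t) * cos t = g t) ->
  mu.-integrable (`[0, 1[%classic : set R) (EFin \o G).
Proof.
move=> cG G0 cg g0 Gg; apply/integrableP; split.
  by apply/measurable_EFinP; exact: sub_itv01_measurable.
rewrite (_ : integral _ _ _ = (\int[mu]_(t in `[0%R, 1%R[) (G t)%:E)%E); last first.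
  apply: eq_integral => t; rewrite inE /= in_itv /= => t01.
  by rewrite ger0_norm ?G0.
apply: le_lt_trans (integral_sin_subst_le cG G0 cg g0 Gg) _.
rewrite ltey_eq (_ : (_ \is a fin_num)%E)//.
by apply: integrable_fin_num => //; exact: integrable_continuous.
Qed.

End SineSubstitution.

Section EllipticIntegrals.
Variable R : realType.
Local Notation mu := (@lebesgue_measure R).
Variables (r : R) (r1 : 1 < r).
Implicit Types (t : R).
Let k := Num.sqrt (1 - 1 / r ^+ 2).
Let r0 : 0 < r. Proof. exact: lt_trans r1. Qed.
Let rn0 : r != 0. Proof. by rewrite gt_eqF. Qed.

Lemma modulus_sqr : k ^+ 2 = 1 - 1 / r ^+ 2.
Proof.
rewrite sqr_sqrtr// subr_ge0 ler_pdivrMr ?exprn_gt0// mul1r.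
by rewrite expr_ge1// ltW.
Qed.

Let rr : 1 < r ^+ 2. Proof. by rewrite expr_gt1// ltW. Qed.

Let k2_01 : 0 < k ^+ 2 < 1.
Proof.
have h : 0 < 1 / r ^+ 2 < 1.
  by rewrite divr_gt0 ?exprn_gt0//= ltr_pdivrMr ?exprn_gt0// mul1r.
by rewrite modulus_sqr; move: h; lra.
Qed.

Definition weight t := normc (dparam r t) / normc (param r t) ^+ 2.

Lemma weightE t : weight t =
  Num.sqrt (r ^+ 2 * sin t ^+ 2 + cos t ^+ 2) /
  (r ^+ 2 * cos t ^+ 2 + sin t ^+ 2).
Proof. by rewrite /weight sqr_normcRe normcRe /= sqrrN !exprMn. Qed.

Let D t := 1 + (r ^+ 2 - 1) * sin t ^+ 2.
Let S t := Num.sqrt (1 - k ^+ 2 * sin t ^+ 2).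
Let GK t := (Num.sqrt ((1 - t ^+ 2) * (1 - k ^+ 2 * t ^+ 2)))^-1.
Let GP t := ((1 - (1 - r ^+ 2) * t ^+ 2) *
  Num.sqrt ((1 - t ^+ 2) * (1 - k ^+ 2 * t ^+ 2)))^-1.

Let sin2_le1 t : 0 <= sin t ^+ 2 <= 1.
Proof. by have := cos2Dsin2 t; have := sqr_ge0 (cos t); have := sqr_ge0 (sin t); lra. Qed.

Let radicand_gt0 t : 0 < 1 - k ^+ 2 * sin t ^+ 2.
Proof. by have := sin2_le1 t; have := k2_01; nra. Qed.

Let D_gt0 t : 0 < D t.
Proof. by rewrite /D; have := sin2_le1 t; have := rr; nra. Qed.

Let S_gt0 t : 0 < S t.
Proof. by rewrite sqrtr_gt0. Qed.

Let continuous_sqr (f : R -> R) (t : R) : {for t, continuous f} ->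
  {for t, continuous (fun u => f u ^+ 2)}.
Proof. by move=> cf; exact: (continuousM cf cf). Qed.

Let continuous_S : continuous S.
Proof.
move=> t; apply: (@continuous_comp _ _ _ (fun u => 1 - k ^+ 2 * sin u ^+ 2)).
  apply: cvgB; first exact: cvg_cst.
  by apply: cvgM; [exact: cvg_cst|apply: continuous_sqr; exact: continuous_sin].
exact: sqrt_continuous.
Qed.

Let continuous_D : continuous D.
Proof.
move=> t; apply: cvgD; first exact: cvg_cst.
by apply: cvgM; [exact: cvg_cst|apply: continuous_sqr; exact: continuous_sin].
Qed.

Let arg_gt0 t : -1 < t < 1 -> 0 < (1 - t ^+ 2) * (1 - k ^+ 2 * t ^+ 2).
Proof.
move=> /andP[t0 t1]; have h : t ^+ 2 < 1 by nra.
by apply: mulr_gt0; have := k2_01; have := sqr_ge0 t; nra.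
Qed.

Let continuous_sqrt_arg t :
  {for t, continuous (fun t => Num.sqrt ((1 - t ^+ 2) * (1 - k ^+ 2 * t ^+ 2)))}.
Proof.
apply: (@continuous_comp _ _ _ (fun t => (1 - t ^+ 2) * (1 - k ^+ 2 * t ^+ 2))).
  apply: cvgM; apply: cvgB; try exact: cvg_cst.
    by apply: continuous_sqr; exact: cvg_id.
  by apply: cvgM; [exact: cvg_cst|apply: continuous_sqr; exact: cvg_id].
exact: sqrt_continuous.
Qed.

Let den_gt0 t : 0 < 1 - (1 - r ^+ 2) * t ^+ 2.
Proof. by have := sqr_ge0 t; have := rr; nra. Qed.

Let continuous_GK t : -1 < t < 1 -> {for t, continuous GK}.
Proof.
move=> t1; apply: cvgV; last exact: continuous_sqrt_arg.
by rewrite gt_eqF// sqrtr_gt0 arg_gt0.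
Qed.

Let continuous_GP t : -1 < t < 1 -> {for t, continuous GP}.
Proof.
move=> t1; apply: cvgV.
  by rewrite mulf_neq0// gt_eqF// ?den_gt0// sqrtr_gt0 arg_gt0.
apply: cvgM; last exact: continuous_sqrt_arg.
apply: cvgB; first exact: cvg_cst.
by apply: cvgM; [exact: cvg_cst|apply: continuous_sqr; exact: cvg_id].
Qed.

Let cos_pos t : 0 <= t < pi / 2 -> 0 < cos t.
Proof.
by move=> /andP[t0 t1]; apply: cos_gt0_pihalf; rewrite t1 andbT; have := pi_gt0 R; lra.
Qed.

Let sqrt_sin t : 0 <= t < pi / 2 ->
  Num.sqrt ((1 - sin t ^+ 2) * (1 - k ^+ 2 * sin t ^+ 2)) = cos t * S t.
Proof.
move=> /cos_pos c0; have -> : 1 - sin t ^+ 2 = cos t ^+ 2.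
  by rewrite -(cos2Dsin2 t) addrK.
by rewrite sqrtrM ?sqr_ge0// sqrtr_sqr gtr0_norm.
Qed.

Let gK t := (S t)^-1.
Let gP t := (D t * S t)^-1.

Let GK_sin t : 0 <= t < pi / 2 -> GK (sin t) * cos t = gK t.
Proof.
move=> t0; rewrite /GK sqrt_sin// /gK; have := cos_pos t0; have := S_gt0 t.
by move=> s0 c0; field; rewrite !gt_eqF.
Qed.

Let GP_sin t : 0 <= t < pi / 2 -> GP (sin t) * cos t = gP t.
Proof.
move=> t0; rewrite /GP sqrt_sin// /gP.
have -> : 1 - (1 - r ^+ 2) * sin t ^+ 2 = D t by rewrite /D; ring.
have := cos_pos t0; have := S_gt0 t; have := D_gt0 t.
by move=> d0 s0 c0; field; rewrite !gt_eqF.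
Qed.

Let continuous_gK : continuous gK.
Proof. by move=> t; apply: cvgV; [rewrite gt_eqF|exact: continuous_S]. Qed.

Let continuous_gP : continuous gP.
Proof.
move=> t; apply: cvgV; first by rewrite gt_eqF// mulr_gt0.
by apply: cvgM; [exact: continuous_D|exact: continuous_S].
Qed.

Let iGK : mu.-integrable (`[0, 1[%classic : set R) (EFin \o GK).
Proof.
apply: (@integrable_sin_subst _ _ gK) => //.
- by move=> t _; rewrite invr_ge0 sqrtr_ge0.
- by move=> t; rewrite invr_ge0 ltW.
Qed.

Let iGP : mu.-integrable (`[0, 1[%classic : set R) (EFin \o GP).
Proof.
apply: (@integrable_sin_subst _ _ gP) => //.
- by move=> t _; rewrite invr_ge0 mulr_ge0 ?sqrtr_ge0// ltW.
- by move=> t; rewrite invr_ge0 mulr_ge0// ltW.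
Qed.

Let combination t : (r ^+ 2 + 1) * gP t - gK t = r * weight (pi / 2 - t).
Proof.
have sE : sin (pi / 2 - t) = cos t by rewrite sinB sin_pihalf cos_pihalf mul1r mul0r subr0.
have cE : cos (pi / 2 - t) = sin t by rewrite cosB sin_pihalf cos_pihalf mul1r mul0r add0r.
have SE : S t = Num.sqrt (r ^+ 2 * cos t ^+ 2 + sin t ^+ 2) / r.
  have -> : r ^+ 2 * cos t ^+ 2 + sin t ^+ 2 = r ^+ 2 * (1 - k ^+ 2 * sin t ^+ 2).
    have -> : cos t ^+ 2 = 1 - sin t ^+ 2 by rewrite -(cos2Dsin2 t) addrK.
    by rewrite modulus_sqr; field.
  by rewrite sqrtrM ?sqr_ge0// sqrtr_sqr gtr0_norm// mulrAC divff// mul1r.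
have Q2 : Num.sqrt (r ^+ 2 * cos t ^+ 2 + sin t ^+ 2) ^+ 2 = r ^+ 2 + 1 - D t.
  rewrite sqr_sqrtr ?(addr_ge0 (mulr_ge0 (sqr_ge0 _) (sqr_ge0 _)) (sqr_ge0 _))// /D.
  have -> : cos t ^+ 2 = 1 - sin t ^+ 2 by rewrite -(cos2Dsin2 t) addrK.
  by ring.
have DE : r ^+ 2 * sin t ^+ 2 + cos t ^+ 2 = D t.
  have -> : cos t ^+ 2 = 1 - sin t ^+ 2 by rewrite -(cos2Dsin2 t) addrK.
  by rewrite /D; ring.
rewrite weightE sE cE DE /gP /gK; have := S_gt0 t; have := D_gt0 t; rewrite SE.
move: (Num.sqrt _) (D t) Q2 => Q d Q2 d0 S0.
have Q0 : Q != 0 by apply: contraTneq S0 => ->; rewrite mul0r ltxx.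
have -> : r ^+ 2 + 1 = Q ^+ 2 + d by rewrite Q2; ring.
by field; rewrite Q0 rn0 gt_eqF.
Qed.

Let weight_ge0 t : 0 <= weight t.
Proof. by rewrite divr_ge0 ?sqr_ge0 ?normc_ge0. Qed.

Let continuous_weight : continuous weight.
Proof.
move=> t; apply: cvgM; first exact: continuous_normc (ccontinuous_dparam r) t.
apply: cvgV; first by rewrite expf_neq0// normc_eq0 param_neq0.
under eq_fun do rewrite sqr_normcRe; rewrite sqr_normcRe.
exact: continuous_sqr_normc (ccontinuous_param r) t.
Qed.

Let continuous_reflect (f : R -> R) c : continuous f -> continuous (fun t => f (c - t)).
Proof.
move=> cf t; apply: continuous_comp; last exact: cf.
by apply: cvgB; [exact: cvg_cst|exact: cvg_id].
Qed.

Lemma weight_quarter :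
  \int[mu]_(t in `[0, (2 * pi)%R]) weight t =
  4 * \int[mu]_(t in `[0, (pi / 2)%R]) weight t.
Proof.
have p0 := pi_gt0 R; have h0 := ltW p0.
have h1 : pi <= 2 * pi :> R by lra.
have h2 : 0 <= pi / 2 :> R by lra.
have h : pi / 2 <= pi :> R by lra.
have sh t : weight (pi + t) = weight t.
  by rewrite !weightE [pi + t]addrC sinDpi cosDpi !sqrrN.
have rf t : weight (pi - t) = weight t.
  rewrite !weightE sinB cosB sinpi cospi !mul0r !mulN1r addr0 sub0r opprK.
  by rewrite sqrrN.
have -> : \int[mu]_(t in `[0, (2 * pi)%R]) weight t =
    2 * \int[mu]_(t in `[0, pi]) weight t.
  rewrite (@Rintegral_split _ _ _ pi)//.
  have := @Rintegral_shift _ 0 pi pi _ (ltW p0) continuous_weight.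
  under eq_Rintegral do rewrite sh.
  have -> : pi + pi = 2 * pi :> R by ring.
  by rewrite addr0 => <-; ring.
rewrite (@Rintegral_split _ _ _ (pi / 2))//.
have := @Rintegral_reflect _ (pi / 2) pi pi _ h continuous_weight.
under eq_Rintegral do rewrite rf.
have -> : pi - pi / 2 = pi / 2 :> R by field.
rewrite subrr => ->; ring.
Qed.

(** With t = sin theta the integrand of (r^2 + 1) Pi - K becomes a multiple of
the arc length element divided by |z|^2. *)
Lemma elliptic_combination_le :
  (r ^+ 2 + 1) * ellipticPi (1 - r ^+ 2) k - ellipticK k <=
  r / 4 * \int[mu]_(t in `[0, (2 * pi)%R]) weight t.
Proof.
have p0 := pi_gt0 R.
have -> : ellipticK k = \int[mu]_(t in `[0%R, 1%R[) GK t by rewrite Rintegral_itv_bndo_bndc.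
have -> : ellipticPi (1 - r ^+ 2) k = \int[mu]_(t in `[0%R, 1%R[) GP t.
  by rewrite Rintegral_itv_bndo_bndc.
pose L t := (r ^+ 2 + 1) * GP t - GK t.
have iP : mu.-integrable (`[0, 1[%classic : set R) (EFin \o (fun t => (r ^+ 2 + 1) * GP t)).
  have : mu.-integrable (`[0, 1[%classic : set R)
    (fun t => (r ^+ 2 + 1)%:E * (EFin \o GP) t)%E by exact: integrableZl.
  by [].
rewrite -RintegralZl// -RintegralB// -/(L _).
pose l t := r * weight (pi / 2 - t).
have cl : continuous l.
  by move=> t; apply: cvgM; [exact: cvg_cst|exact: (continuous_reflect continuous_weight)].
have cw := continuous_reflect (c := pi / 2) continuous_weight.
have L0 t : 0 <= t < 1 -> 0 <= L t.
  move=> /andP[t0 t1]; have t2 : 0 <= t ^+ 2 < 1 by rewrite sqr_ge0 expr_lt1.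
  rewrite /L /GP /GK; set s := Num.sqrt _; set d := 1 - _.
  have s0 : 0 <= s^-1 by rewrite invr_ge0 sqrtr_ge0.
  have d0 : 0 < d by exact: den_gt0.
  have -> : (r ^+ 2 + 1) * (d * s)^-1 - s^-1 = (r ^+ 2 + 1 - d) / d * s^-1.
    rewrite invfM mulrA -{2}[s^-1]mul1r -mulrBl; congr (_ * _).
    by field; rewrite gt_eqF.
  rewrite mulr_ge0// divr_ge0// ?(ltW d0)// /d.
  by have := rr; nra.
have Ll t : 0 <= t < pi / 2 -> L (sin t) * cos t = l t.
  by move=> t0; rewrite /L mulrBl -mulrA GP_sin// GK_sin// combination.
have cL t : -1 < t < 1 -> {for t, continuous L}.
  move=> t1; apply: cvgB; last exact: continuous_GK.
  by apply: cvgM; [exact: cvg_cst|exact: continuous_GP].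
have l0 t : 0 <= l t by rewrite mulr_ge0// ltW.
have := integral_sin_subst_le cL L0 cl l0 Ll.
have il := integrable_continuous 0 (pi / 2) cl.
have iL := integrable_sin_subst cL L0 cl l0 Ll.
have -> : (\int[mu]_(t in `[0%R, 1%R[) (L t)%:E)%E = (\int[mu]_(t in `[0%R, 1%R[) L t)%:E.
  by rewrite fineK//; exact: integrable_fin_num.
have -> : (\int[mu]_(t in `[0%R, (pi / 2)%R]) (l t)%:E)%E =
    (\int[mu]_(t in `[0%R, (pi / 2)%R]) l t)%:E.
  by rewrite fineK//; exact: integrable_fin_num.
rewrite lee_fin => H; apply: le_trans H _.
rewrite RintegralZl//; last exact: integrable_continuous.
rewrite (Rintegral_reflect _ _ continuous_weight) ?subr0 ?subrr; last first.
  by rewrite divr_ge0// ltW.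
rewrite weight_quarter mulrA -[X in _ <= X * _](_ : r = _)//.
by field.
Qed.

End EllipticIntegrals.

(** * The lower bound *)

Section Bound.
Variable R : realType.

(** The infimum of the norms of test functions with a given pole need not be
attained by a polynomial, so that the bound is approached from below. *)
Lemma opnorm_ge_norm_ratio (x : R) (exterior : bool) : 0 < x -> x < 1 ->
  ((Num.sqrt (inv_norm x /
     (2 * pi * (1 - x) * (theta3 0 (x ^+ 2) * psi (x ^+ 2)))))%:E <=
   cauchy_opnorm (axis x) exterior)%E.
Proof.
move=> x0 x1; have q0 : 0 < x ^+ 2 by exact: exprn_gt0.
have q1 : x ^+ 2 < 1 by rewrite exprn_ilt1// ltW.
have W0 := inv_norm_gt0 x0 x1; have r1 := axis_gt1 x0 x1.
set V0 := 2 * pi * _ * _.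
have V00 : 0 < V0.
  by rewrite !mulr_gt0 ?pi_gt0 ?subr_gt0 ?theta3_gt0 ?psi_gt0.
set s1 := Num.sqrt _.
have s1_gt0 : 0 < s1 by rewrite sqrtr_gt0 divr_gt0.
have below (s : R) : 0 <= s -> s < s1 ->
    (s%:E <= cauchy_opnorm (axis x) exterior)%E.
  move=> s0 ss1; have sV : s ^+ 2 * V0 < inv_norm x.
    rewrite -ltr_pdivlMr// -[ltRHS]sqr_sqrtr ?divr_ge0 ?ltW//.
    by rewrite ltr_pXn2r// nnegrE (ltW s1_gt0).
  have s2 : 0 < s ^+ 2 + 1 by rewrite ltr_wpDl ?sqr_ge0.
  pose V := V0 + (inv_norm x - s ^+ 2 * V0) / (s ^+ 2 + 1).
  have VV : V0 < V by rewrite ltrDl divr_gt0// subr_gt0.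
  have sVW : s ^+ 2 * V <= inv_norm x.
    rewrite -subr_ge0; have -> : inv_norm x - s ^+ 2 * V =
      (inv_norm x - s ^+ 2 * V0) / (s ^+ 2 + 1) by rewrite /V; field; rewrite gt_eqF.
    by rewrite divr_ge0 ?ltW// subr_gt0.
  have [P [b [b0 Pb]]] := test_fun_norm_le x0 x1 VV.
  have b2 : 0 < normc b ^+ 2 by rewrite exprn_gt0// normc_gt0.
  apply: (@opnorm_ge_ratio _ _ r1 exterior P b) => //.
    by rewrite sqr_norm_inv// mulr_gt0.
  rewrite sqr_norm_inv//; apply: le_trans (ler_wpM2l (sqr_ge0 _) Pb) _.
  by rewrite mulrCA ler_wpM2l// ltW.
rewrite leNgt; apply/negP => lt1.
have := below 0 (lexx 0) s1_gt0; move: lt1 below.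
case: (cauchy_opnorm _ _) => [v||] //; rewrite lte_fin => vs below v0.
have v0' : 0 <= v by [].
have /below : 0 <= (v + s1) / 2 by rewrite divr_ge0// addr_ge0// ltW.
by rewrite lee_fin => /(_ ltac:(lra)); lra.
Qed.

(** The constants: x = (r - 1) / (r + 1) is the square root of the nome, and
sqrt (r^2 - 1) (1 - x) = 2 sqrt x. *)
Lemma elliptic_theta_le (r k x : R) : 1 < r ->
  k = Num.sqrt (1 - 1 / r ^+ 2) -> x = (r - 1) / (r + 1) ->
  2 / pi * k * (((r ^+ 2 + 1) * ellipticPi (1 - r ^+ 2) k - ellipticK k)
           / (theta2 0 (x ^+ 2) * theta3 0 (x ^+ 2))) <=
  inv_norm x / (2 * pi * (1 - x) * (theta3 0 (x ^+ 2) * psi (x ^+ 2))).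
Proof.
move=> r1 kE xE; have r0 : 0 < r by exact: lt_trans r1.
have rp : 0 < r + 1 by rewrite addr_gt0.
have x0 : 0 < x by rewrite xE divr_gt0 ?subr_gt0.
have x1 : x < 1 by rewrite xE ltr_pdivrMr//; lra.
have q0 : 0 < x ^+ 2 by exact: exprn_gt0.
have q1 : x ^+ 2 < 1 by rewrite exprn_ilt1// ltW.
have axisE : axis x = r.
  by rewrite /axis xE; field; apply/andP; split; rewrite gt_eqF//; lra.
have E := elliptic_combination_le r1; rewrite -kE in E.
have -> : inv_norm x = \int[lebesgue_measure]_(t in `[0, (2 * pi)%R]) weight r t.
  by rewrite /inv_norm axisE.
set W := Rintegral _ _ _ in E *.
have q4 : (x ^+ 2) `^ 4^-1 = Num.sqrt x.
  rewrite -powR_mulrn ?(ltW x0)// -powRrM.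
  have -> : 2%:R * 4^-1 = 2^-1 :> R by field.
  by rewrite powR12_sqrt// ltW.
have k0 : 0 < k.
  rewrite kE sqrtr_gt0 subr_gt0 ltr_pdivrMr ?exprn_gt0// mul1r.
  by rewrite expr_gt1// ltW.
have sx0 : 0 < Num.sqrt x by rewrite sqrtr_gt0.
have krx : k * r * (1 - x) = 2 * Num.sqrt x.
  have lhs0 : 0 <= k * r * (1 - x).
    by rewrite (mulr_ge0 (mulr_ge0 (ltW k0) (ltW r0)))// subr_ge0 ltW.
  have rhs0 : 0 <= 2 * Num.sqrt x by rewrite mulr_ge0// ltW.
  apply/eqP; rewrite -(eqrXn2 (isT : (0 < 2)%N) lhs0 rhs0).
  rewrite !exprMn kE modulus_sqr// sqr_sqrtr ?ltW// xE; apply/eqP; field.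
  by rewrite !gt_eqF.
have T0 := theta3_gt0 q0 q1; have P0 := psi_gt0 q0 q1; have p0 := pi_gt0 R.
rewrite theta2E q4.
move: (theta3 0 _) (psi _) (Num.sqrt x) T0 P0 sx0 krx => T P sx T0 P0 sx0 krx.
have x1' : 1 - x != 0 by rewrite gt_eqF// subr_gt0.
have [rn Tn Pn sn pn] : [/\ r != 0, T != 0, P != 0, sx != 0 & (pi : R) != 0].
  by rewrite !gt_eqF.
have kr : k = 2 * sx / (r * (1 - x)) by rewrite -krx; field; rewrite rn x1'.
have constE p : p != 0 -> W / (2 * p * (1 - x) * (T * P)) =
    2 / p * k * (r / 4 * W / (2 * sx * P * T)).
  by move=> pn0; rewrite kr; field; rewrite rn Tn Pn sn pn0 x1'.
rewrite constE//.
rewrite ler_wpM2l//; first by rewrite mulr_ge0 ?divr_ge0 ?ltW.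
by rewrite ler_pM2r// invr_gt0 !mulr_gt0.
Qed.

End Bound.

Theorem theorem1p13 (R : realType) (r : R) (exterior : bool) (hr : 1 < r) :
  let k := Num.sqrt (1 - 1 / r ^+ 2) in
  let q := ((r - 1) / (r + 1)) ^+ 2 in
  ((Num.sqrt (2 / pi * k
      * (((r ^+ 2 + 1) * ellipticPi (1 - r ^+ 2) k - ellipticK k)
           / (theta2 0 q * theta3 0 q))))%:E
   <= cauchy_opnorm r exterior)%E.
Proof.
cbv zeta; set x := (r - 1) / (r + 1).
have rp : 0 < r + 1 by rewrite addr_gt0// (lt_trans _ hr).
have x0 : 0 < x by rewrite divr_gt0// subr_gt0.
have x1 : x < 1 by rewrite ltr_pdivrMr//; lra.
have axisE : axis x = r.
  by rewrite /axis /x; field; apply/andP; split; rewrite gt_eqF//; lra.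
have H := opnorm_ge_norm_ratio exterior x0 x1; rewrite axisE in H.
refine (le_trans _ H); rewrite lee_fin; apply: ler_wsqrtr.
exact: (elliptic_theta_le hr erefl erefl).
Qed.
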